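(* Let $\mathbb{K}$ be a field, $q\in\mathbb{K}^*$ not a root of unity, and $R=\mathcal{O}_q(M_3)$. Then the group $\mathrm{Aut}(R)$ of $\mathbb{K}$-algebra automorphisms of $R$ is the semidirect product $\mathcal{H}\rtimes\langle\tau\rangle$ of the group $\mathcal{H}$ of torus automorphisms and the cyclic group of order $2$ generated by the transposition automorphism $\tau$.
   Context: $\mathcal{O}_q(M_3)$ is the $\mathbb{K}$-algebra generated by $Y_{i,\alpha}$, $1\le i,\alpha\le 3$, subject to: $Y_{i,\beta}Y_{i,\alpha}=q^{-1}Y_{i,\alpha}Y_{i,\beta}$ for $\alpha<\beta$; $Y_{j,\alpha}Y_{i,\alpha}=q^{-1}Y_{i,\alpha}Y_{j,\alpha}$ for $i<j$; $Y_{j,\beta}Y_{i,\alpha}=Y_{i,\alpha}Y_{j,\beta}$ for $i<j$, $\alpha>\beta$; $Y_{j,\beta}Y_{i,\alpha}=Y_{i,\alpha}Y_{j,\beta}-(q-q^{-1})Y_{i,\beta}Y_{j,\alpha}$ for $i<j$, $\alpha<\beta$. The transposition is the automorphism $\tau(Y_{i,\alpha})=Y_{\alpha,i}$. The torus automorphisms are the automorphisms $\sigma_h$, $h=(a_1,a_2,a_3,b_1,b_2)\in(\mathbb{K}^* )^5$, given by $\sigma_h(Y_{i,\alpha})=a_ib_\alpha Y_{i,\alpha}$ for $\alpha<3$ and $\sigma_h(Y_{i,3})=a_iY_{i,3}$; equivalently, the automorphisms acting on each generator $Y_{i,\alpha}$ by multiplication by a nonzero scalar. *)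

(* Defs.v *)
From HB Require Import structures.
From mathcomp Require Import all_boot all_order all_algebra.
Set Implicit Arguments. Unset Strict Implicit. Unset Printing Implicit Defensive.
Import GRing.Theory.
Local Open Scope ring_scope.

Definition qM3_rel (K : fieldType) (q : K) (B : algType K)
    (Y : 'I_3 -> 'I_3 -> B) : Prop :=
  (forall (i al be : 'I_3), (al < be)%N ->
      Y i be * Y i al = q^-1 *: (Y i al * Y i be)) /\
  (forall (i j al : 'I_3), (i < j)%N ->
      Y j al * Y i al = q^-1 *: (Y i al * Y j al)) /\
  (forall (i j al be : 'I_3), (i < j)%N -> (be < al)%N ->
      Y j be * Y i al = Y i al * Y j be) /\
  (forall (i j al be : 'I_3), (i < j)%N -> (al < be)%N ->
      Y j be * Y i al = Y i al * Y j be - (q - q^-1) *: (Y i be * Y j al)).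

(* R together with Y is the K-algebra presented by generators Y and the
   relations qM3_rel: every family satisfying the relations in any K-algebra
   B comes from a unique K-algebra morphism R -> B. *)
Definition is_OqM3 (K : fieldType) (q : K) (R : algType K)
    (Y : 'I_3 -> 'I_3 -> R) : Prop :=
  qM3_rel q Y /\
  forall (B : algType K) (Z : 'I_3 -> 'I_3 -> B), qM3_rel q Z ->
    (exists f : {lrmorphism R -> B}, forall i al, f (Y i al) = Z i al) /\
    (forall f g : {lrmorphism R -> B},
        (forall i al, f (Y i al) = g (Y i al)) -> f =1 g).

Definition is_alg_aut (K : fieldType) (R : algType K) (f : R -> R) : Prop :=
  exists g : {lrmorphism R -> R}, f =1 g /\ bijective f.

Definition bvec (K : fieldType) (b1 b2 : K) (al : 'I_3) : K :=
  if (nat_of_ord al == 0)%N then b1 else if (nat_of_ord al == 1)%N then b2 else 1.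

Definition acts_as_torus (K : fieldType) (R : algType K)
    (Y : 'I_3 -> 'I_3 -> R) (a : 'I_3 -> K) (b1 b2 : K) (f : R -> R) : Prop :=
  forall i al, f (Y i al) = (a i * bvec b1 b2 al) *: Y i al.

Definition torus_param (K : fieldType) (a : 'I_3 -> K) (b1 b2 : K) : Prop :=
  (forall i, a i != 0) /\ b1 != 0 /\ b2 != 0.

Definition is_torus_aut (K : fieldType) (R : algType K)
    (Y : 'I_3 -> 'I_3 -> R) (f : R -> R) : Prop :=
  is_alg_aut f /\
  exists (a : 'I_3 -> K) (b1 b2 : K), torus_param a b1 b2 /\
    acts_as_torus Y a b1 b2 f.

Definition acts_as_transpose (K : fieldType) (R : algType K)
    (Y : 'I_3 -> 'I_3 -> R) (f : R -> R) : Prop :=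
  forall i al, f (Y i al) = Y al i.

(* Main.v *)
(** R embeds in the quantum torus T on generators t_{i,alpha}, by Y_{i,alpha}
    |-> t_{i,alpha} + lower terms, in such a way that the minors det,
    [23|23], [12|23], [23|12] and the last row and column of Y become monomials.
    Let sigma be an automorphism with sigma(Y) = Y + (degree >= 2) on the
    generators, and let lead be the leading exponent for some order on the
    exponents. Since lead(sigma(m)), for m in the monoid of these monomials,
    determines the same commutation form as the exponent of m, terms of different
    weights modulo the radical of the form cannot cancel when sigma is applied
    to an element of R expanded in T. Applied to the expansion of sigma^-1(m),
    with an order and its opposite, this shows that all exponents of sigma(m)
    have the weight of m. For m = Y_{2,3}, Y_{3,2}, Y_{3,3} or [23|23] this means
    that sigma(m) is m times a polynomial in det, and comparing the degrees for
    sigma and sigma^-1 gives sigma(m) = m; so sigma fixes Y_{2,2} as well.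
    Reversing the rows and columns turns q into q^-1 and shows that sigma also
    fixes Y_{1,1}, Y_{1,2} and Y_{2,1}; commutators of the generators obtained so
    far give Y_{1,3} and Y_{3,1}, whence sigma = id.
    An arbitrary automorphism has no constant terms on the generators, because
    they q-commute, and its linear part satisfies the defining relations. Thus
    the image of Y_{1,3} has a linear part which q-commutes with all
    generators modulo higher degrees, hence is a multiple of Y_{1,3} or
    Y_{3,1}; up to tau, the commutation weights then force the linear part to be
    diagonal, and composing with a torus automorphism makes it trivial. *)
Require Import Defs.
From HB Require Import structures.
From mathcomp Require Import all_boot all_order all_algebra.
From mathcomp Require Import finmap monalg boolp.
From mathcomp Require Import zify ring lra.
Import Order.TTheory GRing.Theory Num.Theory.
Local Open Scope ring_scope.
Set Implicit Arguments.
Unset Strict Implicit.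
Unset Printing Implicit Defensive.

(** * Linear extension of maps given on a basis *)

Section LinearExtension.
Variables (K : fieldType) (E : choiceType) (W : lmodType K).
Implicit Types (phi : E -> W) (f g : {malg K[E]}).

Definition linext phi f : W := \sum_(k <- msupp f) f@_k *: phi k.

Lemma linextEw phi f (d : {fset E}) :
  (msupp f `<=` d)%fset -> linext phi f = \sum_(k <- d) f@_k *: phi k.
Proof.
move=> sfd; rewrite /linext; apply: big_fset_incl => // k _ /mcoeff_outdom ->.
by rewrite scale0r.
Qed.

Lemma linextD phi f g : linext phi (f + g) = linext phi f + linext phi g.
Proof.
pose d := (msupp f `|` msupp g)%fset.
rewrite (@linextEw _ (f + g) d) ?msuppD_le // (@linextEw _ f d) ?fsubsetUl //.
rewrite (@linextEw _ g d) ?fsubsetUr // -big_split /=; apply: eq_bigr => k _.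
by rewrite mcoeffD scalerDl.
Qed.

Lemma linextZ phi c f : linext phi (c *: f) = c *: linext phi f.
Proof.
rewrite (@linextEw _ _ (msupp f)) ?msuppZ_le // scaler_sumr.
by apply: eq_bigr => k _; rewrite mcoeffZ scalerA.
Qed.

Lemma linext_basis phi k : linext phi << k >> = phi k.
Proof.
by rewrite (@linextEw _ _ [fset k]%fset) ?msuppU_le // big_seq_fset1 mcoeffUU scale1r.
Qed.

Lemma eq_linext phi psi f : (forall k, f@_k != 0 -> phi k = psi k) ->
  linext phi f = linext psi f.
Proof.
move=> eq_phi; apply: eq_big_seq => k; rewrite -mcoeff_neq0 => fk.
by rewrite eq_phi.
Qed.

Lemma linextDf phi psi f : linext (fun k => phi k + psi k) f = linext phi f + linext psi f.
Proof. by rewrite -big_split /=; apply: eq_bigr => k _; rewrite scalerDr. Qed.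

Lemma linextZf c phi f : linext (fun k => c *: phi k) f = c *: linext phi f.
Proof. by rewrite scaler_sumr; apply: eq_bigr => k _; rewrite !scalerA mulrC. Qed.

End LinearExtension.

Lemma malg_linext (K : fieldType) (E : choiceType) (f : {malg K[E]}) :
  f = linext (fun k => << k >>) f.
Proof.
rewrite [LHS]monalgE; apply: eq_bigr => k _; apply/malgP => l.
by rewrite mcoeffZ !mcoeffU mulr_natr.
Qed.

Lemma malg_ind (K : fieldType) (E : choiceType) (P : {malg K[E]} -> Prop) :
  P 0 -> (forall f g, P f -> P g -> P (f + g)) ->
  (forall c k, P (c *: << k >>)) -> forall f, P f.
Proof.
move=> P0 PD PZ f; rewrite (malg_linext f) /linext.
by apply: big_ind => // k _; apply: PZ.
Qed.

(** * Group algebras twisted by a bicharacter *)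

Section TwistedGroupAlgebra.
Variables (K : fieldType) (E : zmodType).

Record bichar := Bichar {
  bc :> E -> E -> K;
  bcDl : forall a b d, bc (a + b) d = bc a d * bc b d;
  bcDr : forall a b d, bc a (b + d) = bc a b * bc a d;
  bc_neq0 : forall a b, bc a b != 0 }.

Variable c : bichar.

Lemma bc0l a : c 0 a = 1.
Proof.
by apply: (mulfI (bc_neq0 c 0 a)); rewrite -bcDl addr0 mulr1.
Qed.
Lemma bc0r a : c a 0 = 1.
Proof.
by apply: (mulfI (bc_neq0 c a 0)); rewrite -bcDr addr0 mulr1.
Qed.

(** An alias indexed by the bicharacter, so that each twist carries its own canonical product on the
    same module. *)
Definition tga_of (_ : bichar) : Type := {malg K[E]}.
HB.instance Definition _ b := GRing.Lmodule.on (tga_of b).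
Local Notation tga := (tga_of c).

Lemma tga_ind (P : tga -> Prop) :
  P 0 -> (forall f g, P f -> P g -> P (f + g)) ->
  (forall a k, P (a *: (<< k >> : tga))) -> forall f, P f.
Proof. exact: malg_ind. Qed.

Definition tga_mul (f g : tga) : tga :=
  linext (fun k => linext (fun l => c k l *: << k + l >>) g) f.
Lemma tga_mulDl : left_distributive tga_mul +%R.
Proof. by move=> f g h; rewrite /tga_mul linextD. Qed.
Lemma tga_mulDr : right_distributive tga_mul +%R.
Proof.
move=> f g h; rewrite /tga_mul -linextDf; apply: eq_linext => k _.
exact: linextD.
Qed.
Lemma tga_mulZl a f g : tga_mul (a *: f) g = a *: tga_mul f g.
Proof. by rewrite /tga_mul linextZ. Qed.
Lemma tga_mulZr a f g : tga_mul f (a *: g) = a *: tga_mul f g.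
Proof.
rewrite /tga_mul -linextZf; apply: eq_linext => k _; exact: linextZ.
Qed.
Lemma tga_mulUU k l : tga_mul << k >> << l >> = c k l *: << k + l >>.
Proof. by rewrite /tga_mul !linext_basis. Qed.
Lemma tga_mul0l f : tga_mul 0 f = 0.
Proof. by rewrite /tga_mul /linext msupp0 big_seq_fset0. Qed.
Lemma tga_mul0r f : tga_mul f 0 = 0.
Proof. by have := tga_mulZr 0 f 0; rewrite !scale0r. Qed.

(** On basis elements this is the cocycle identity [c i j * c (i + j) k = c j k * c i (j + k)], a
    consequence of bimultiplicativity. *)
Lemma tga_mulA : associative tga_mul.
Proof.
move=> f g h; elim/tga_ind: f => [|f1 f2 H1 H2|a i]; first by rewrite !tga_mul0l.
  by rewrite !tga_mulDl H1 H2.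
rewrite !tga_mulZl; congr (_ *: _).
elim/tga_ind: g => [|g1 g2 H1 H2|b j]; first by rewrite !(tga_mul0l, tga_mul0r).
  by rewrite !(tga_mulDl, tga_mulDr) H1 H2.
rewrite !(tga_mulZl, tga_mulZr); congr (_ *: _).
elim/tga_ind: h => [|h1 h2 H1 H2|d k]; first by rewrite !tga_mul0r.
  by rewrite !tga_mulDr H1 H2.
rewrite !tga_mulZr !tga_mulUU !(tga_mulZl, tga_mulZr) !tga_mulUU !scalerA addrA.
by congr (_ *: _); rewrite bcDl bcDr; ring.
Qed.

Definition tga_one : tga := << 0 >>.
Lemma tga_mul1l : left_id tga_one tga_mul.
Proof.
elim/tga_ind => [|f1 f2 H1 H2|a i]; first by rewrite tga_mul0r.
  by rewrite !tga_mulDr H1 H2.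
by rewrite tga_mulZr tga_mulUU bc0l scale1r add0r.
Qed.
Lemma tga_mul1r : right_id tga_one tga_mul.
Proof.
elim/tga_ind => [|f1 f2 H1 H2|a i]; first by rewrite tga_mul0l.
  by rewrite !tga_mulDl H1 H2.
by rewrite tga_mulZl tga_mulUU bc0r scale1r addr0.
Qed.
Lemma tga_one_neq0 : tga_one != 0.
Proof. by rewrite monalgU_eq0 oner_eq0. Qed.

HB.instance Definition _ := GRing.Zmodule_isNzRing.Build tga
  tga_mulA tga_mul1l tga_mul1r tga_mulDl tga_mulDr tga_one_neq0.
Lemma tga_scaleAl a (f g : tga) : a *: (f * g) = (a *: f) * g.
Proof. by rewrite [RHS]tga_mulZl. Qed.
HB.instance Definition _ := GRing.Lmodule_isLalgebra.Build K tga tga_scaleAl.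
Lemma tga_scaleAr a (f g : tga) : a *: (f * g) = f * (a *: g).
Proof. by rewrite [RHS]tga_mulZr. Qed.
HB.instance Definition _ := GRing.Lalgebra_isAlgebra.Build K tga tga_scaleAr.

End TwistedGroupAlgebra.

(* The algebra is only used through this opaque interface: letting the
   unifier unfold finitely supported functions is very expensive. *)
Record tga_spec (K : fieldType) (E : zmodType) (c : bichar K E) := TgaSpec {
  tga_car :> algType K;
  mon : E -> tga_car;
  coef : tga_car -> E -> K;
  supp : tga_car -> seq E;
  monM : forall k l, mon k * mon l = c k l *: mon (k + l);
  mon0 : mon 0 = 1;
  coefD : forall f g x, coef (f + g) x = coef f x + coef g x;
  coefZ : forall a f x, coef (a *: f) x = a * coef f x;
  coef_mon : forall k x, coef (mon k) x = (k == x)%:R;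
  tgaP : forall f g, (forall x, coef f x = coef g x) -> f = g;
  coef_neq0 : forall f x, (coef f x != 0) = (x \in supp f);
  supp_uniq : forall f, uniq (supp f);
  tga_expand : forall f, f = \sum_(k <- supp f) coef f k *: mon k }.

Definition tga_impl (K : fieldType) (E : zmodType) (c : bichar K E) : tga_spec c.
Proof.
refine (@TgaSpec K E c (tga_of c) (fun k => << k >>) (fun f x => f@_x)
  (fun f => enum_fset (msupp f)) _ _ _ _ _ _ _ _ _).
- exact: tga_mulUU.
- by [].
- by move=> f g x; exact: mcoeffD.
- by move=> a f x; exact: mcoeffZ.
- by move=> k x; exact: mcoeffU.
- by move=> f g; move/malgP.
- by move=> f x; exact: mcoeff_neq0.
- by move=> f; exact: fset_uniq.
- by move=> f; exact: malg_linext.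
Qed.

Definition tga (K : fieldType) (E : zmodType) (c : bichar K E) : algType K :=
  tga_car (tga_impl c).

(** * Coefficients and products in the twisted group algebra *)

Section TgaTheory.
Variables (K : fieldType) (E : zmodType) (c : bichar K E).
Local Notation tga := (tga c).
Local Notation mon := (mon (tga_impl c)).
Implicit Types (f g : tga) (x y z : E).

Lemma tgaZl (a : K) f g : (a *: f) * g = a *: (f * g). Proof. by rewrite scalerAl. Qed.
Lemma tgaZr (a : K) f g : f * (a *: g) = a *: (f * g). Proof. by rewrite scalerAr. Qed.
Lemma coef0 x : coef (0 : tga) x = 0.
Proof. by rewrite -(scale0r (0 : tga)) coefZ mul0r. Qed.
Lemma coefN f x : coef (- f) x = - coef f x.
Proof. by rewrite -scaleN1r coefZ mulN1r. Qed.
Lemma coefB f g x : coef (f - g) x = coef f x - coef g x.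
Proof. by rewrite coefD coefN. Qed.
Lemma coef_sum (I : Type) (r : seq I) (P : pred I) (F : I -> tga) x :
  coef (\sum_(i <- r | P i) F i) x = \sum_(i <- r | P i) coef (F i) x.
Proof.
by elim/big_rec2: _ => [|i a b _ <-]; [rewrite coef0 | rewrite coefD].
Qed.
Lemma coef_mon_neq0 k x : (coef (mon k) x != 0) = (k == x).
Proof. by rewrite coef_mon; case: (k == x); rewrite ?oner_eq0 ?eqxx. Qed.
Lemma mon_ind (P : tga -> Prop) :
  P 0 -> (forall f g, P f -> P g -> P (f + g)) ->
  (forall a k, P (a *: mon k)) -> forall f, P f.
Proof.
by move=> P0 PD PZ f; rewrite (tga_expand f); apply: big_ind => // k _; apply: PZ.
Qed.

Lemma tga_coefM f g z :
  coef (f * g) z = \sum_(k <- supp f) coef f k * (c k (z - k) * coef g (z - k)).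
Proof.
have -> : f * g = \sum_(k <- supp f) coef f k *: (mon k * g).
  by rewrite {1}(tga_expand f) mulr_suml; apply: eq_bigr => k _; rewrite scalerAl.
rewrite coef_sum; apply: eq_bigr => k _; rewrite coefZ; congr (_ * _).
elim/mon_ind: g => [|g1 g2 H1 H2|a l].
- by rewrite mulr0 coef0 coef0 mulr0.
- by rewrite mulrDr !coefD H1 H2 mulrDr.
- rewrite tgaZr monM !coefZ !coef_mon.
  rewrite [l == _]eq_sym subr_eq [_ == z]eq_sym [l + k]addrC.
  by case: eqP => [->|_]; rewrite ?mulr0 // [k + l]addrC addrK !mulr1 mulrC.
Qed.

Lemma tga_coefM_neq0 f g z : coef (f * g) z != 0 ->
  exists x y, [/\ z = x + y, coef f x != 0 & coef g y != 0].
Proof.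
rewrite tga_coefM => /eqP H.
case: (boolP (has (fun x => coef g (z - x) != 0) (supp f))).
  case/hasP => x xf gx; exists x, (z - x); split=> //; first by rewrite addrC subrK.
  by rewrite coef_neq0.
move=> /hasPn Hn; case: H; apply: big1_seq => x /= /Hn.
by rewrite negbK => /eqP->; rewrite !mulr0.
Qed.

Section Lin.
Variables (W : lmodType K) (phi : E -> W).
Definition lin f : W := \sum_(k <- supp f) coef f k *: phi k.

Lemma linEw f (d : seq E) : uniq d -> {subset supp f <= d} ->
  lin f = \sum_(k <- d) coef f k *: phi k.
Proof.
move=> ud sd; rewrite [RHS](bigID (mem (supp f))) /= [X in _ = _ + X]big1_seq ?addr0.
  rewrite -big_filter; apply: perm_big; apply: uniq_perm; rewrite ?filter_uniq ?supp_uniq //.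
  by move=> k; rewrite mem_filter; case: (boolP (k \in supp f)) => // /sd ->.
by move=> k /andP[]; rewrite -coef_neq0 negbK => /eqP ->; rewrite scale0r.
Qed.
Lemma linD f g : lin (f + g) = lin f + lin g.
Proof.
pose d := undup (supp f ++ supp g ++ supp (f + g)).
have ud : uniq d by exact: undup_uniq.
have sd h : {subset supp h <= supp f ++ supp g ++ supp (f + g)} -> lin h = \sum_(k <- d) coef h k *: phi k.
  by move=> hd; apply: linEw => // k /hd; rewrite mem_undup.
rewrite !sd; try by move=> k; rewrite !mem_cat => ->; rewrite ?orbT.
by rewrite -big_split; apply: eq_bigr => k _; rewrite coefD scalerDl.
Qed.
Lemma linZ a f : lin (a *: f) = a *: lin f.
Proof.
rewrite (@linEw (a *: f) (supp f)) ?supp_uniq //.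
  by rewrite scaler_sumr; apply: eq_bigr => k _; rewrite coefZ scalerA.
by move=> k; rewrite -!coef_neq0 coefZ mulf_eq0 negb_or => /andP[].
Qed.
Lemma lin0 : lin 0 = 0.
Proof. by have := linZ 0 0; rewrite !scale0r. Qed.
Lemma lin_mon k : lin (mon k) = phi k.
Proof.
rewrite (@linEw (mon k) [:: k]) // => [|l]; first by rewrite big_seq1 coef_mon eqxx scale1r.
by rewrite -coef_neq0 coef_mon_neq0 inE eq_sym.
Qed.
End Lin.
End TgaTheory.

(** * Lexicographic orders on exponents *)

Section Orders.
Variable n : nat.
Local Notation E := 'rV[int]_n.

Definition dot (v x : E) : int := \sum_k v 0 k * x 0 k.

Lemma dotDr v x y : dot v (x + y) = dot v x + dot v y.
Proof. by rewrite /dot -big_split; apply: eq_bigr => k _; rewrite mxE mulrDr. Qed.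
Lemma dotNr v x : dot v (- x) = - dot v x.
Proof. by rewrite /dot -sumrN; apply: eq_bigr => k _; rewrite mxE mulrN. Qed.
Lemma dotBr v x y : dot v (x - y) = dot v x - dot v y.
Proof. by rewrite dotDr dotNr. Qed.
Lemma dot0r v : dot v 0 = 0.
Proof. by rewrite /dot big1 // => k _; rewrite mxE mulr0. Qed.
Lemma dotNl v x : dot (- v) x = - dot v x.
Proof. by rewrite /dot -sumrN; apply: eq_bigr => k _; rewrite mxE mulNr. Qed.
Lemma dot_delta k x : dot (delta_mx 0 k) x = x 0 k.
Proof.
rewrite /dot (bigD1 k) //= mxE !eqxx mul1r big1 ?addr0 // => i ik.
by rewrite mxE (negbTE ik) mul0r.
Qed.

(** Lexicographic positivity for the forms in [ls]. Differences in [nul ls] count as ties, so the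
    comparison is only a preorder. *)
Fixpoint pos (ls : seq E) (x : E) : bool :=
  if ls is v :: ls' then (0 < dot v x) || ((dot v x == 0) && pos ls' x) else false.

Definition nul (ls : seq E) (x : E) : bool := all (fun v => dot v x == 0) ls.

Lemma pos_cat l1 l2 x : pos (l1 ++ l2) x = pos l1 x || (nul l1 x && pos l2 x).
Proof. by elim: l1 => //= v l ->; case: ltrgt0P. Qed.

Lemma pos0 ls : pos ls 0 = false.
Proof. by elim: ls => //= v l ->; rewrite dot0r. Qed.

Lemma posD ls x y : pos ls x -> pos ls y -> pos ls (x + y).
Proof.
elim: ls => //= v l IH; rewrite dotDr.
case: (ltrgt0P (dot v x)) => //= Hx; case: (ltrgt0P (dot v y)) => //= Hy;
  rewrite ?Hx ?Hy ?addr0 ?add0r ?Hx ?Hy ?addr_gt0 //=.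
Qed.

Lemma pos_nulD ls x y : pos ls x -> nul ls y -> pos ls (x + y).
Proof.
elim: ls => //= v l IH + /andP[/eqP vy]; rewrite dotDr vy addr0.
by case: (ltrgt0P (dot v x)) => //= _; apply: IH.
Qed.

Lemma nulD ls x y : nul ls x -> nul ls y -> nul ls (x + y).
Proof.
move=> /allP Hx /allP Hy; apply/allP => v vl.
by rewrite dotDr (eqP (Hx v vl)) (eqP (Hy v vl)) addr0.
Qed.

Lemma nulN ls x : nul ls (- x) = nul ls x.
Proof. by apply: eq_all => v; rewrite dotNr oppr_eq0. Qed.

Lemma pos_opp ls x : pos (map -%R ls) x = pos ls (- x).
Proof. by elim: ls => //= v l ->; rewrite dotNl dotNr. Qed.

Lemma nul_opp ls x : nul (map -%R ls) x = nul ls x.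
Proof. by rewrite /nul all_map; apply: eq_all => v /=; rewrite dotNl oppr_eq0. Qed.

Lemma pos_total ls x : [|| pos ls x, pos ls (- x) | nul ls x].
Proof.
elim: ls => //= v l IH; rewrite dotNr oppr_gt0 oppr_eq0.
by case: (ltrgt0P (dot v x)).
Qed.

Lemma posN ls x : pos ls x -> ~~ pos ls (- x).
Proof. by move=> Hx; apply/negP => /(posD Hx); rewrite subrr pos0. Qed.

Definition coords : seq E := [seq delta_mx 0 k | k : 'I_n].
Lemma nul_coords x : nul coords x = (x == 0).
Proof.
apply/allP/eqP => [H|-> v _]; last by rewrite dot0r.
apply/rowP => k; rewrite mxE; apply/eqP; rewrite -dot_delta; apply: H.
exact: image_f.
Qed.

(** The coordinates only break the ties left by [ls], which makes the order total without disturbing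
    the coarse comparison [pos ls]. *)
Definition lexi ls := pos (ls ++ coords).
Lemma lexiE ls x : lexi ls x = pos ls x || (nul ls x && pos coords x).
Proof. exact: pos_cat. Qed.
Lemma lexi_total ls x : [|| lexi ls x, lexi ls (- x) | x == 0].
Proof.
have := pos_total (ls ++ coords) x; rewrite /lexi /nul all_cat.
by rewrite -!/(nul _ _) nul_coords; do 2!case: pos => //=; case/andP.
Qed.
Lemma lexiD ls x y : lexi ls x -> lexi ls y -> lexi ls (x + y).
Proof. exact: posD. Qed.
Lemma lexi0 ls : lexi ls 0 = false.
Proof. exact: pos0. Qed.
Lemma lexiN ls x : lexi ls x -> ~~ lexi ls (- x).
Proof. exact: posN. Qed.

Lemma lexi_max ls (s : seq E) : s != [::] ->
  exists2 x, x \in s & forall y, y \in s -> (y == x) || lexi ls (x - y).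
Proof.
elim: s => //= a [|b s] IH _.
  by exists a; rewrite ?mem_head // => y; rewrite inE => ->.
have [//|x xs Hx] := IH _.
have /or3P[H|H|/eqP H] := lexi_total ls (x - a).
- exists x; first by rewrite inE xs orbT.
  by move=> y; rewrite inE => /orP[/eqP->|/Hx //]; rewrite H orbT.
- rewrite opprB in H; exists a; first by rewrite mem_head.
  move=> y; rewrite inE => /orP[->//|/Hx /orP[/eqP->|H']]; first by rewrite H orbT.
  by rewrite -(subrKA x) lexiD ?orbT.
- exists x; first by rewrite inE xs orbT.
  by move=> y; rewrite inE => /orP[/eqP->|/Hx //]; rewrite eq_sym -subr_eq0 H eqxx.
Qed.

End Orders.

(** * Leading exponents *)

Section Lead.
Variables (K : fieldType) (n : nat).
Local Notation E := 'rV[int]_n.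
Variable c : bichar K E.
Implicit Types (f g : tga c) (x y z : E).

Variable ls : seq E.

Definition lead f x :=
  coef f x != 0 /\ forall y, coef f y != 0 -> (y == x) || lexi ls (x - y).

Lemma lead_neq0 f x : lead f x -> f != 0.
Proof. by case=> fx _; apply: contra_neq fx => ->; rewrite coef0. Qed.

Lemma tga_neq0 f : f != 0 -> exists x, coef f x != 0.
Proof.
move=> f0; case: (boolP (nilp (supp f))) => [/nilP s0|].
  by case/eqP: f0; rewrite (tga_expand f) s0 big_nil.
by case s0: (supp f) => [//|x s] _; exists x; rewrite coef_neq0 s0 mem_head.
Qed.

Lemma lead_exists f : f != 0 -> exists x, lead f x.
Proof.
move=> /tga_neq0[x0]; rewrite coef_neq0 => Hx0.
have [|x xf Hx] := @lexi_max n ls (supp f).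
  by case: (supp f) Hx0.
exists x; split; first by rewrite coef_neq0.
by move=> y; rewrite coef_neq0; apply: Hx.
Qed.

Lemma lead_uniq f x y : lead f x -> lead f y -> x = y.
Proof.
move=> [fx Hx] [fy Hy]; apply/eqP; have := Hx _ fy; rewrite [y == x]eq_sym.
case/orP=> // H1; have := Hy _ fx; case/orP=> // /(lexiD H1).
by rewrite addrA subrK subrr lexi0.
Qed.

(** Any other exponent [k] of [f] lies below [x], so [x + y - k] lies above [y] and is no exponent
    of [g]; one term of the convolution remains. *)
Lemma leadM_coef f g x y : lead f x -> lead g y ->
  coef (f * g) (x + y) = coef f x * (c x y * coef g y).
Proof.
move=> [fx Hx] [gy Hy]; rewrite tga_coefM.
rewrite (bigD1_seq x) ?supp_uniq //=; last by rewrite -coef_neq0.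
rewrite [x + y]addrC addrK big1_seq ?addr0 // => k /andP[kx].
rewrite -coef_neq0 => /Hx; rewrite (negbTE kx) /= => Hk.
case: (eqVneq (coef g (y + x - k)) 0) => [->|/Hy]; first by rewrite !mulr0.
rewrite -addrA -subr_eq0 opprD [y + (x - k)]addrC addrK addrA subrr add0r subr_eq0 eq_sym (negbTE kx) /=.
by rewrite (negbTE (lexiN Hk)).
Qed.

Lemma leadM f g x y : lead f x -> lead g y -> lead (f * g) (x + y).
Proof.
move=> Hf Hg; split.
  rewrite (leadM_coef Hf Hg) !mulf_eq0 !negb_or bc_neq0 /=.
  by case: Hf => -> _; case: Hg.
case: Hf => fx Hx; case: Hg => gy Hy z /tga_coefM_neq0[k [l [-> /Hx Hk /Hy Hl]]].
case/orP: Hk => [/eqP->|Hk]; case/orP: Hl => [/eqP->|Hl]; first by rewrite eqxx.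
- by rewrite opprD addrACA subrr add0r Hl orbT.
- by rewrite opprD addrACA subrr addr0 Hk orbT.
- by rewrite opprD addrACA lexiD ?orbT.
Qed.

Lemma lead_comm f g a x y : lead f x -> lead g y -> f * g = a *: (g * f) ->
  c x y = a * c y x.
Proof.
move=> Hx Hy fg; have := leadM_coef Hx Hy; rewrite fg coefZ addrC.
rewrite (leadM_coef Hy Hx) => H.
have nz : coef f x * coef g y != 0 by rewrite mulf_neq0 //; [case: Hx | case: Hy].
apply: (mulIf nz); rewrite [LHS]mulrCA [LHS](_ : _ = coef f x * (c x y * coef g y)); last by ring.
by rewrite -H; ring.
Qed.

Lemma leadZ f a x : a != 0 -> lead f x -> lead (a *: f) x.
Proof.
move=> a0 [fx Hx]; split; first by rewrite coefZ mulf_neq0.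
by move=> y; rewrite coefZ mulf_eq0 (negbTE a0) => /Hx.
Qed.

Lemma lead_mon x : lead (mon (tga_impl c) x) x.
Proof.
split; first by rewrite coef_mon eqxx oner_eq0.
by move=> y; rewrite coef_mon [y == x]eq_sym; case: (x == y); rewrite ?eqxx.
Qed.

End Lead.

(** For any total order, here the one given by the coordinates alone, the product of the leading
    terms survives. *)
Lemma tga_mulf_eq0 (K : fieldType) (n : nat) (c : bichar K 'rV[int]_n) (f g : tga c) :
  (f * g == 0) = (f == 0) || (g == 0).
Proof.
apply/idP/orP => [|[]/eqP->]; rewrite ?mul0r ?mulr0 //.
case: (eqVneq f 0) => [|/(lead_exists [::])[x Hx]]; first by left.
case: (eqVneq g 0) => [|/(lead_exists [::])[y Hy]]; first by right.
by move=> H; have := lead_neq0 (leadM Hx Hy); rewrite H.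
Qed.

(** * The commutation form of the quantum torus *)

Notation E9 := 'rV[int]_9.

(* The pair [(i, alpha)] is encoded by the single index [3 * i + alpha], from 0;
   [omega] is defined by [t_k t_l = q ^ omega k l t_l t_k]. *)
Definition omega (k l : nat) : int :=
  if (k %/ 3 == l %/ 3)%N then ((k %% 3 < l %% 3)%N : nat)%:Z - ((l %% 3 < k %% 3)%N : nat)%:Z
  else if (k %% 3 == l %% 3)%N then ((k %/ 3 < l %/ 3)%N : nat)%:Z - ((l %/ 3 < k %/ 3)%N : nat)%:Z
  else 0.

Lemma omegaN k l : omega l k = - omega k l.
Proof.
rewrite /omega [(l %/ 3 == _)%N]eq_sym [(l %% 3 == _)%N]eq_sym.
by case: ifP => _; [|case: ifP => _]; rewrite ?oppr0 ?opprB.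
Qed.

(** The power of [q] that arises when a product of two ordered monomials is reordered: only the
    pairs with [l < k] have to be exchanged. *)
Definition beta (x y : E9) : int :=
  \sum_(k < 9) \sum_(l < 9) if (l < k)%N then omega k l * (x 0 k * y 0 l) else 0.
Definition omega_col (l : 'I_9) : E9 := \row_k omega k l.
(** The monomial of exponent [x] commutes with [t_l] up to [q ^ weight x l]; the radical of [Lambda]
    consists of the [x] all of whose weights vanish. *)
Definition weight (x : E9) (l : 'I_9) : int := dot (omega_col l) x.
Definition Lambda (x y : E9) : int := \sum_(l < 9) weight x l * y 0 l.

Lemma betaDl x y z : beta (x + y) z = beta x z + beta y z.
Proof.
rewrite -big_split; apply: eq_bigr => k _; rewrite -big_split.
by apply: eq_bigr => l _ /=; case: ifP => _; rewrite ?mxE ?addr0 //; ring.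
Qed.
Lemma betaDr x y z : beta x (y + z) = beta x y + beta x z.
Proof.
rewrite -big_split; apply: eq_bigr => k _; rewrite -big_split.
by apply: eq_bigr => l _ /=; case: ifP => _; rewrite ?mxE ?addr0 //; ring.
Qed.

Lemma LambdaE x y : Lambda x y = \sum_(k < 9) \sum_(l < 9) omega k l * (x 0 k * y 0 l).
Proof.
rewrite exchange_big; apply: eq_bigr => l _.
rewrite /weight /dot mulr_suml; apply: eq_bigr => k _; rewrite mxE; ring.
Qed.

Lemma beta_Lambda x y : beta x y = beta y x + Lambda x y.
Proof.
apply/eqP; rewrite addrC -subr_eq; apply/eqP; rewrite LambdaE.
rewrite {2}/beta exchange_big -sumrB; apply: eq_bigr => k _.
rewrite -sumrB; apply: eq_bigr => l _.
case: (ltngtP l k) => [lk|kl|kl]; rewrite ?subr0 ?sub0r //.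
  by rewrite (omegaN k l); ring.
have -> : omega k l = 0 by have := omegaN k l; rewrite kl; lia.
by rewrite mul0r.
Qed.

Lemma LambdaDl x y z : Lambda (x + y) z = Lambda x z + Lambda y z.
Proof.
by rewrite -big_split; apply: eq_bigr => k _; rewrite /weight dotDr mulrDl.
Qed.
Lemma LambdaDr x y z : Lambda x (y + z) = Lambda x y + Lambda x z.
Proof. by rewrite -big_split; apply: eq_bigr => k _; rewrite mxE mulrDr. Qed.
Lemma LambdaNl x y : Lambda (- x) y = - Lambda x y.
Proof. by rewrite -sumrN; apply: eq_bigr => k _; rewrite /weight dotNr mulNr. Qed.
Lemma LambdaNr x y : Lambda x (- y) = - Lambda x y.
Proof. by rewrite -sumrN; apply: eq_bigr => k _; rewrite mxE mulrN. Qed.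
Lemma LambdaBl x y z : Lambda (x - y) z = Lambda x z - Lambda y z.
Proof. by rewrite LambdaDl LambdaNl. Qed.
Lemma LambdaBr x y z : Lambda x (y - z) = Lambda x y - Lambda x z.
Proof. by rewrite LambdaDr LambdaNr. Qed.
Lemma Lambda_delta x k : Lambda x (delta_mx 0 k) = weight x k.
Proof.
rewrite /Lambda (bigD1 k) //= mxE !eqxx mulr1 big1 ?addr0 // => i ik.
by rewrite mxE (negbTE ik) mulr0.
Qed.

(** * Deciding identities in the quantum torus by computation *)

Section QTorus.
Variables (K : fieldType) (q : K) (hq0 : q != 0).

Definition qbc : bichar K E9.
Proof.
refine (@Bichar K E9 (fun x y => q ^ beta x y) _ _ _) => [a b d|a b d|a b].
- by rewrite betaDl expfzDr.
- by rewrite betaDr expfzDr.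
- by rewrite expfz_neq0.
Defined.

Local Notation T := (tga qbc).

(* The terms [(a, n, x)] stand for [a * q ^ n] times the monomial of exponent [x];
   identities in [T] between such lists are decided by computation. *)
Definition lit : Type := seq (int * int * seq int).
Definition expo (s : seq int) : E9 := \row_k nth 0 s k.
Definition ev (f : lit) : T :=
  foldr (fun t acc => (t.1.1%:~R * q ^ t.1.2) *: mon (tga_impl qbc) (expo t.2) + acc) 0 f.

Definition addL (s t : seq int) : seq int :=
  [seq nth 0 s k + nth 0 t k | k <- iota 0 9].
Definition betaL (s t : seq int) : int :=
  foldr (fun k a => foldr (fun l b =>
    (if (l < k)%N then omega k l * (nth 0 s k * nth 0 t l) else 0) + b) 0 (iota 0 9) + a) 0 (iota 0 9).

Lemma big_iota9 (F : nat -> int) :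
  \sum_(k < 9) F k = foldr (fun k a => F k + a) 0 (iota 0 9).
Proof. by rewrite -(big_mkord xpredT) /index_iota unlock. Qed.

Lemma expo_addL s t : expo (addL s t) = expo s + expo t.
Proof.
apply/rowP => k; rewrite !mxE (nth_map 0%N) ?size_iota // nth_iota //.
Qed.
Lemma beta_expo s t : beta (expo s) (expo t) = betaL s t.
Proof.
rewrite /betaL -big_iota9; apply: eq_bigr => k _.
by rewrite -big_iota9; apply: eq_bigr => l _; rewrite !mxE.
Qed.

Definition scaleL (a n : int) (f : lit) : lit :=
  [seq (a * t.1.1, n + t.1.2, t.2) | t <- f].
Definition mulL (f g : lit) : lit :=
  flatten [seq [seq (t.1.1 * u.1.1, t.1.2 + u.1.2 + betaL t.2 u.2, addL t.2 u.2) | u <- g] | t <- f].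
Fixpoint insL (t : int * int * seq int) (f : lit) : lit :=
  if f is u :: f' then
    if (t.1.2 == u.1.2) && (t.2 == u.2) then (t.1.1 + u.1.1, u.1.2, u.2) :: f'
    else u :: insL t f'
  else [:: t].
(** Powers of [q] are compared as formal exponents, so the test is sound for every nonzero [q]. *)
Definition zeroL (f : lit) : bool := all (fun t => t.1.1 == 0) (foldr insL [::] f).

Lemma ev_cat f g : ev (f ++ g) = ev f + ev g.
Proof. by elim: f => [|t f IH] /=; rewrite ?add0r // IH addrA. Qed.
Lemma ev_scale a n f : ev (scaleL a n f) = (a%:~R * q ^ n) *: ev f.
Proof.
elim: f => [|t f IH] /=; first by rewrite scaler0.
by rewrite IH scalerDr scalerA intrM (expfzDr _ _ hq0) mulrACA.
Qed.
Lemma ev_coefM (a b m n p : int) :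
  (a * b)%:~R * q ^ (m + n + p) = a%:~R * q ^ m * (b%:~R * q ^ n) * q ^ p :> K.
Proof. by rewrite intrM !expfzDr //; ring. Qed.
Lemma ev_mul f g : ev (mulL f g) = ev f * ev g.
Proof.
elim: f => [|t f IH] /=; first by rewrite mul0r.
rewrite mulrDl -IH /mulL /= ev_cat; apply: (f_equal2 +%R) => [{IH}|]; last by [].
elim: g => [|u g IH] /=; first by rewrite mulr0.
rewrite mulrDr -IH tgaZl tgaZr monM !scalerA expo_addL /= beta_expo.
by rewrite ev_coefM.
Qed.
Lemma ev_ins t f : ev (insL t f) = ev (t :: f).
Proof.
elim: f => //= u f IH; case: ifP => [/andP[/eqP -> /eqP ->]|_] /=.
  by rewrite intrD mulrDl scalerDl addrA.
by rewrite IH /= addrCA.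
Qed.
Lemma ev_zero f : zeroL f -> ev f = 0.
Proof.
have -> : ev f = ev (foldr insL [::] f) by elim: f => //= t f IH; rewrite ev_ins /= IH.
rewrite /zeroL; elim: (foldr _ _ _) => //= t g IH /andP[/eqP -> /IH ->].
by rewrite mul0r scale0r addr0.
Qed.
Lemma ev_eq f g : zeroL (f ++ scaleL (-1) 0 g) -> ev f = ev g.
Proof.
move=> /ev_zero; rewrite ev_cat ev_scale expr0z mulr1 scaleN1r.
by move/eqP; rewrite subr_eq0 => /eqP.
Qed.
End QTorus.

(* The images of the generators in the quantum torus, obtained by inverting
   Cauchon's deleting derivations algorithm. *)
Definition gen_lit (k : nat) : lit := nth [::]
 [:: [:: (1%Z, 0%Z, [:: 1%Z; 0; 0; 0; 0; 0; 0; 0; 0]);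
         (1%Z, 1%Z, [:: 0; 1%Z; 0; 1%Z; -1%Z; 0; 0; 0; 0]);
         (1%Z, 1%Z, [:: 0; 0; 1%Z; 1%Z; 0; -1%Z; 0; 0; 0]);
         (1%Z, 1%Z, [:: 0; 1%Z; 0; 0; 0; 0; 1%Z; -1%Z; 0]);
         (1%Z, 2%Z, [:: 0; 0; 1%Z; 0; 1%Z; -1%Z; 1%Z; -1%Z; 0]);
         (1%Z, 1%Z, [:: 0; 0; 1%Z; 0; 0; 0; 1%Z; 0; -1%Z])];
     [:: (1%Z, 0%Z, [:: 0; 1%Z; 0; 0; 0; 0; 0; 0; 0]);
         (1%Z, 1%Z, [:: 0; 0; 1%Z; 0; 1%Z; -1%Z; 0; 0; 0]);
         (1%Z, 1%Z, [:: 0; 0; 1%Z; 0; 0; 0; 0; 1%Z; -1%Z])];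
     [:: (1%Z, 0%Z, [:: 0; 0; 1%Z; 0; 0; 0; 0; 0; 0])];
     [:: (1%Z, 0%Z, [:: 0; 0; 0; 1%Z; 0; 0; 0; 0; 0]);
         (1%Z, 1%Z, [:: 0; 0; 0; 0; 1%Z; 0; 1%Z; -1%Z; 0]);
         (1%Z, 1%Z, [:: 0; 0; 0; 0; 0; 1%Z; 1%Z; 0; -1%Z])];
     [:: (1%Z, 0%Z, [:: 0; 0; 0; 0; 1%Z; 0; 0; 0; 0]);
         (1%Z, 1%Z, [:: 0; 0; 0; 0; 0; 1%Z; 0; 1%Z; -1%Z])];
     [:: (1%Z, 0%Z, [:: 0; 0; 0; 0; 0; 1%Z; 0; 0; 0])];
     [:: (1%Z, 0%Z, [:: 0; 0; 0; 0; 0; 0; 1%Z; 0; 0])];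
     [:: (1%Z, 0%Z, [:: 0; 0; 0; 0; 0; 0; 0; 1%Z; 0])];
     [:: (1%Z, 0%Z, [:: 0; 0; 0; 0; 0; 0; 0; 0; 1%Z])]] k.

Definition relL (k l : nat) : lit :=
  mulL (gen_lit k) (gen_lit l) ++ scaleL (-1) (omega k l) (mulL (gen_lit l) (gen_lit k)) ++
  (if (l %/ 3 < k %/ 3)%N && (l %% 3 < k %% 3)%N then
     let p := mulL (gen_lit (3 * (l %/ 3) + k %% 3)) (gen_lit (3 * (k %/ 3) + l %% 3)) in
     scaleL 1 1 p ++ scaleL (-1) (-1) p else [::]).

Lemma relL_zero : all (fun k => all (fun l => zeroL (relL k l)) (iota 0 k)) (iota 0 9).
Proof. by vm_compute. Qed.

(** * Generators indexed by a single number, and their relations *)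

Lemma rw_subproof (k : 'I_9) : (k %/ 3 < 3)%N.
Proof. by rewrite ltn_divLR. Qed.
Definition rw (k : 'I_9) : 'I_3 := Ordinal (rw_subproof k).
Definition cl (k : 'I_9) : 'I_3 := Ordinal (ltn_pmod k (isT : 0 < 3)%N).
Lemma ix_subproof (i a : 'I_3) : (3 * i + a < 9)%N.
Proof. by case: i a => [i Hi] [a Ha] /=; lia. Qed.
Definition ix (i a : 'I_3) : 'I_9 := Ordinal (ix_subproof i a).
Lemma rw_ix i a : rw (ix i a) = i.
Proof. by apply: val_inj; case: i a => [i Hi] [a Ha] /=; lia. Qed.
Lemma cl_ix i a : cl (ix i a) = a.
Proof. by apply: val_inj; case: i a => [i Hi] [a Ha] /=; lia. Qed.
Lemma ix_rw_cl k : ix (rw k) (cl k) = k.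
Proof. by apply: val_inj; case: k => [k Hk] /=; lia. Qed.

(** [l] is strictly north-west of [k] in the matrix, the position in which the commutation relation
    has a correction term. *)
Definition NW (l k : 'I_9) : bool := (rw l < rw k)%N && (cl l < cl k)%N.

Definition rel9 (K : fieldType) (q : K) (B : algType K) (X : 'I_9 -> B) : Prop :=
  forall k l : 'I_9, (l < k)%N ->
    X k * X l = q ^ omega k l *: (X l * X k)
      - (if NW l k then (q - q^-1) *: (X (ix (rw l) (cl k)) * X (ix (rw k) (cl l))) else 0).

Lemma omegaE (k l : 'I_9) : omega k l =
  if rw k == rw l then ((cl k < cl l)%N : nat)%:Z - ((cl l < cl k)%N : nat)%:Z
  else if cl k == cl l then ((rw k < rw l)%N : nat)%:Z - ((rw l < rw k)%N : nat)%:Z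
  else 0.
Proof. by []. Qed.

Lemma rel9P (K : fieldType) (q : K) (B : algType K) (X : 'I_9 -> B) :
  rel9 q X <-> qM3_rel q (fun i a => X (ix i a)).
Proof.
split=> [H|[H1 [H2 [H3 H4]]] k l lk].
- split; [|split; [|split]].
  + move=> i a b ab; rewrite H; last by rewrite /=; lia.
    by rewrite /NW omegaE !rw_ix !cl_ix eqxx ltnn ab subr0 ltnNge (ltnW ab).
  + move=> i j a ij; rewrite H; last by rewrite /=; lia.
    rewrite /NW omegaE !rw_ix !cl_ix eqxx ltnn ij andbF subr0 ltnNge (ltnW ij) /=.
    by rewrite -val_eqE /= eqn_leq (leqNgt j i) ij.
  + move=> i j a b ij ba; rewrite H; last by have := ltn_ord a; rewrite /=; have := ltn_ord b; lia.
    rewrite /NW omegaE !rw_ix !cl_ix ij (ltnNge a) (ltnW ba) subr0 /=.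
    by rewrite -val_eqE -[b == a]val_eqE /= !eqn_leq (leqNgt j i) ij (leqNgt a b) ba andbF expr0z scale1r.
  + move=> i j a b ij ab; rewrite H; last by have := ltn_ord a; rewrite /=; have := ltn_ord b; lia.
    rewrite /NW omegaE !rw_ix !cl_ix ij ab /=.
    by rewrite -val_eqE -[b == a]val_eqE /= !eqn_leq (leqNgt j i) ij (leqNgt b a) ab expr0z scale1r.
- rewrite -(ix_rw_cl k) -(ix_rw_cl l) in lk *; move: lk.
  move: (rw k) (rw l) (cl k) (cl l) => j i b a.
  have := ltn_ord a; have := ltn_ord b => Hb Ha lk.
  rewrite /NW omegaE !rw_ix !cl_ix; rewrite /= in lk.
  case: (ltngtP i j) => [ij|ji|/val_inj ij]; [|lia|].
    rewrite -val_eqE /= [j == i :> nat]eq_sym (ltn_eqF ij).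
    case: (ltngtP a b) => [ab|ba|/val_inj ab].
    * by rewrite H4 // -val_eqE /= [b == a :> nat]eq_sym (ltn_eqF ab) expr0z scale1r.
    * by rewrite H3 // -val_eqE /= (ltn_eqF ba) expr0z scale1r subr0.
    * by rewrite ab H2 // eqxx subr0.
  subst j; rewrite eqxx; have ab : (a < b)%N by lia.
  by rewrite H1 // ab ltnNge (ltnW ab) subr0.
Qed.

(** * The images of the generators in the quantum torus *)

Section TorusGens.
Variables (K : fieldType) (q : K) (hq0 : q != 0).
Local Notation T := (tga (qbc hq0)).
Definition tgen (k : nat) : T := ev hq0 (gen_lit k).

Lemma tgen_rel9 : rel9 q (fun k : 'I_9 => tgen k).
Proof.
move=> k l lk; have /allP/(_ (k : nat)) := relL_zero.
rewrite mem_iota ltn_ord => /(_ isT) /allP /(_ (l : nat)).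
rewrite mem_iota add0n lk => /(_ isT) /(ev_zero hq0).
rewrite /relL !ev_cat ev_scale !ev_mul mulN1r scaleNr addrA => H.
apply/eqP; rewrite -subr_eq0 opprB addrA addrAC -[X in _ == X]H; apply/eqP.
apply: (f_equal2 +%R) => //.
have -> : ((l %/ 3 < k %/ 3) && (l %% 3 < k %% 3))%N = NW l k by [].
case: (NW l k) => //=.
rewrite ev_cat !ev_scale ev_mul mul1r expr1z mulN1r.
by rewrite scalerBl exprN1 scaleNr.
Qed.

Lemma coef_ev_neq0 f x : coef (ev hq0 f) x != 0 -> x \in map expo (map snd f).
Proof.
elim: f => [|t f IH] /=; first by rewrite coef0 eqxx.
rewrite coefD coefZ coef_mon inE; rewrite [x == _]eq_sym; case: (eqVneq (expo t.2) x) => [//|_ H].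
by rewrite IH ?orbT //; rewrite mulr0 add0r in H.
Qed.

Lemma expo_inj s t : size s = 9 -> size t = 9 -> expo s = expo t -> s = t.
Proof.
move=> ss st /rowP H; apply: (@eq_from_nth _ 0); rewrite ss ?st // => k k9.
by have := H (Ordinal k9); rewrite !mxE.
Qed.

Lemma coef_ev f t : all (fun t : int * int * seq int => size t.2 == 9) f ->
  uniq (map snd f) -> t \in f -> coef (ev hq0 f) (expo t.2) = t.1.1%:~R * q ^ t.1.2.
Proof.
elim: f => [//|u f IH] /= /andP[/eqP su sf] /andP[uf Uf].
have Hne v : v \in f -> expo u.2 != expo v.2.
  move=> vf; apply: contraNneq uf => /(expo_inj su) E; rewrite E ?map_f //.
  exact/eqP/(allP sf).
rewrite inE coefD coefZ coef_mon => /predU1P[->|tf].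
  rewrite eqxx mulr1 [X in _ + X](_ : _ = 0) ?addr0 //; apply/eqP.
  apply: contraT => /coef_ev_neq0/mapP[s /mapP[v /Hne /eqP uv ->] Es].
  by case: uv.
by rewrite IH // (negbTE (Hne _ tf)) mulr0 add0r.
Qed.

Lemma gen_lit_wf (k : 'I_9) : [&& all (fun t : int * int * seq int => size t.2 == 9) (gen_lit k),
  uniq (map snd (gen_lit k)) & all (fun t : int * int * seq int => t.1.1 == 1) (gen_lit k)].
Proof. by case: k => k; do 9?[case: k => [|k] //]. Qed.

Lemma coef_tgen (k : 'I_9) t : t \in gen_lit k -> coef (tgen k) (expo t.2) = q ^ t.1.2.
Proof.
case/and3P: (gen_lit_wf k) => H1 H2 /allP H3 tk.
by rewrite (coef_ev H1 H2 tk) (eqP (H3 _ tk)) mul1r.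
Qed.

Local Notation e k := (delta_mx 0 k : E9).

Lemma expo_delta (k : 'I_9) : expo [seq (i == k :> nat)%:Z | i <- iota 0 9] = e k.
Proof.
apply/rowP => i; rewrite !mxE (nth_map 0%N) ?size_iota // nth_iota // add0n.
by rewrite eqxx natz.
Qed.

Lemma coef_tgen_e (k : 'I_9) : coef (tgen k) (e k) = 1.
Proof.
have tk : (1%Z, 0%Z, [seq (i == k :> nat)%:Z | i <- iota 0 9]) \in gen_lit k.
  by case: k => k; do 9?[case: k => [|k] //].
by rewrite -expo_delta; have /= -> := coef_tgen tk; rewrite expr0z.
Qed.

Lemma supp_tgen (k : 'I_9) x : (coef (tgen k) x != 0) = (x \in map expo (map snd (gen_lit k))).
Proof.
apply/idP/idP => [/coef_ev_neq0 //|/mapP[s /mapP[t tk ->] ->]].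
by rewrite coef_tgen // expfz_neq0.
Qed.

(** The forms that depend only on row sums and column sums. All terms of the image of a generator
    agree on them, which makes them the multidegrees of [R]. *)
Definition mvec (r s : nat -> int) : E9 := \row_k (r (k %/ 3)%N + s (k %% 3)%N).
(* [psi] is largest on the term [t_k] of the image of the generator [k]. *)
Definition psi : E9 := \row_k (k %/ 3 * (k %% 3))%:Z.

Lemma dot_row (f : nat -> int) s :
  dot (\row_(k < 9) f k) (expo s) = foldr (fun k a => f k * nth 0 s k + a) 0 (iota 0 9).
Proof. by rewrite -big_iota9; apply: eq_bigr => k _; rewrite !mxE. Qed.

Lemma tgen_mvec r s (k : 'I_9) x : coef (tgen k) x != 0 ->
  dot (mvec r s) x = r (rw k) + s (cl k).
Proof.
rewrite supp_tgen => /mapP[t tk ->]; rewrite (dot_row (fun k => r (k %/ 3)%N + s (k %% 3)%N)).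
move: k tk => [k k9] /=; move: k9; do 9?[case: k => [|k] //]; move=> _ /=; rewrite !inE;
  repeat (case/predU1P => [->|]); try move/eqP ->; rewrite /=; ring.
Qed.

Lemma tgen_psi (k : 'I_9) x : coef (tgen k) x != 0 -> x = e k \/ 0 < dot psi (e k - x).
Proof.
rewrite supp_tgen -expo_delta dotBr => /mapP[t tk ->]; rewrite !(dot_row (fun k => (k %/ 3 * (k %% 3))%:Z)).
suff : (t == [seq (i == k :> nat)%:Z | i <- iota 0 9]) ||
   (0 < foldr (fun j a => (j %/ 3 * (j %% 3))%:Z * nth 0 [seq (i == k :> nat)%:Z | i <- iota 0 9] j + a) 0 (iota 0 9) -
   foldr (fun k a => (k %/ 3 * (k %% 3))%:Z * nth 0 t k + a) 0 (iota 0 9)).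
  by case/orP => [/eqP ->|]; [left|right].
move: t tk; apply/allP; move: k => [k k9] /=; move: k9.
by do 9?[case: k => [|k] //].
Qed.

Definition mdeg_list (ls : seq E9) := forall v, v \in ls -> exists r s, v = mvec r s.

(** Multidegree forms do not distinguish the terms of [tgen k], so [psi] decides, and it singles out
    [e k]. *)
Lemma lead_tgen ls (k : 'I_9) : mdeg_list ls -> lead (ls ++ [:: psi]) (tgen k) (e k).
Proof.
move=> Hls; split; first by rewrite coef_tgen_e oner_eq0.
move=> x xk; have [->|H] := tgen_psi xk; first by rewrite eqxx.
apply/orP; right; rewrite lexiE pos_cat; apply/orP; left; apply/orP; right.
rewrite /= H andbT; apply/allP => v /Hls[r [s ->]].
by rewrite dotBr !(tgen_mvec _ _ (k := k)) ?subrr // coef_tgen_e oner_eq0.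
Qed.

End TorusGens.

Notation o9 k := (@Ordinal 9 k isT).

(** * Quantum minors that become monomials *)

Section Minors.
Variables (K : fieldType) (q : K) (B : algType K) (X : 'I_9 -> B).
(* The minors [23|23], [12|23], [23|12] and the quantum determinant. *)
Definition mn_d : B := X (o9 4) * X (o9 8) - q *: (X (o9 5) * X (o9 7)).
Definition mn_u : B := X (o9 1) * X (o9 5) - q *: (X (o9 2) * X (o9 4)).
Definition mn_v : B := X (o9 3) * X (o9 7) - q *: (X (o9 4) * X (o9 6)).
Definition mn_D : B := X (o9 0) * mn_d
  - q *: (X (o9 1) * (X (o9 3) * X (o9 8) - q *: (X (o9 5) * X (o9 6))))
  + q ^+ 2 *: (X (o9 2) * mn_v).
End Minors.

Section TorusMinors.
Variables (K : fieldType) (q : K) (hq0 : q != 0).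
Local Notation T := (tga (qbc hq0)).
Local Notation G := (fun k : 'I_9 => tgen hq0 k).
Local Notation m s := (mon (tga_impl (qbc hq0)) (expo s)).

Lemma ev1 s : ev hq0 [:: (1%Z, 0%Z, s)] = m s.
Proof. by rewrite /ev /= expr0z mulr1 scale1r addr0. Qed.

Definition minorL (a b c d : nat) : lit :=
  mulL (gen_lit a) (gen_lit d) ++ scaleL (-1) 1 (mulL (gen_lit b) (gen_lit c)).

Lemma ev_minorL a b c d :
  tgen hq0 a * tgen hq0 d - q *: (tgen hq0 b * tgen hq0 c) = ev hq0 (minorL a b c d).
Proof.
by rewrite ev_cat ev_scale !ev_mul expr1z mulN1r scaleNr.
Qed.

Lemma tgen_minor_d : mn_d q G = m [:: 0; 0; 0; 0; 1; 0; 0; 0; 1].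
Proof.
by rewrite -ev1 /mn_d ev_minorL; apply: ev_eq; vm_compute.
Qed.
Lemma tgen_minor_u : mn_u q G = m [:: 0; 1; 0; 0; 0; 1; 0; 0; 0].
Proof.
by rewrite -ev1 /mn_u ev_minorL; apply: ev_eq; vm_compute.
Qed.
Lemma tgen_minor_v : mn_v q G = m [:: 0; 0; 0; 1; 0; 0; 0; 1; 0].
Proof.
by rewrite -ev1 /mn_v ev_minorL; apply: ev_eq; vm_compute.
Qed.
Lemma tgen_minor_D : mn_D q G = m [:: 1; 0; 0; 0; 1; 0; 0; 0; 1].
Proof.
rewrite -ev1 /mn_D /mn_d /mn_v !ev_minorL.
(* The scalars are brought to the form of an integer times an integral power of [q], as in
   [ev_scale]. *)
have -> : q ^+ 2 = 1%:~R * q ^ 2 by rewrite mul1r.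
rewrite -[- (q *: _)]scaleNr (_ : - q = (-1)%:~R * q ^ 1); last by rewrite expr1z mulN1r.
rewrite /tgen -!ev_mul -!ev_scale -!ev_cat.
by apply: ev_eq; vm_compute.
Qed.
Lemma tgen_mon k : (k \in [:: 2; 5; 6; 7; 8])%N ->
  tgen hq0 k = m [seq (i == k :> nat)%:Z | i <- iota 0 9].
Proof.
by rewrite -ev1 !inE => /orP[|/orP[|/orP[|/orP[]]]] /eqP ->.
Qed.
End TorusMinors.

(** * Induction on the generators *)

Section SubAlgebra.
Variables (K : fieldType) (R : algType K) (S : subalgClosed R).
Record subalg := SubAlg { subalg_val : R; subalg_valP : subalg_val \in S }.
HB.instance Definition _ := [isSub for subalg_val].
HB.instance Definition _ := [Choice of subalg by <:].
HB.instance Definition _ := [SubChoice_isSubAlgebra of subalg by <:].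
Lemma subalg_val_linear : linear subalg_val. Proof. by []. Qed.
HB.instance Definition _ := GRing.isLinear.Build K subalg R _ subalg_val subalg_val_linear.
Lemma subalg_val_monoid : monoid_morphism subalg_val. Proof. by []. Qed.
HB.instance Definition _ := GRing.isMonoidMorphism.Build subalg R subalg_val subalg_val_monoid.
End SubAlgebra.

Section GenInd.
Variables (K : fieldType) (R : algType K) (P : R -> Prop).
Hypotheses (P1 : P 1) (PD : forall a x y, P x -> P y -> P (a *: x + y))
  (PM : forall x y, P x -> P y -> P (x * y)).
Definition asb_pred : {pred R} := fun x => `[< P x >].
Lemma asb_closed : GRing.subalg_closed asb_pred.
Proof.
split; first exact/asboolP.
  by move=> a x y /asboolP Hx /asboolP Hy; apply/asboolP; apply: PD.
by move=> x y /asboolP Hx /asboolP Hy; apply/asboolP; apply: PM.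
Qed.
HB.instance Definition _ := GRing.isSubalgClosed.Build K R asb_pred asb_closed.

(** The elements with [P] form a subalgebra [S] containing the generators. The universal property
    gives a morphism from [R] to [S], whose composite with the inclusion is the identity by
    uniqueness. *)
Lemma gen_ind (q : K) (Y : 'I_3 -> 'I_3 -> R) : is_OqM3 q Y ->
  (forall i a, P (Y i a)) -> forall x, P x.
Proof.
move=> [[H1 [H2 [H3 H4]]] HU] PY x.
pose S : subalgClosed R := asb_pred.
have YS i a : Y i a \in S by exact/asboolP.
pose Z i a : subalg S := SubAlg (YS i a).
have HZ : qM3_rel q Z.
  split; [|split; [|split]].
  - by move=> i a b ab; apply: val_inj; exact: H1.
  - by move=> i j a ij; apply: val_inj; exact: H2.
  - by move=> i j a b ij ba; apply: val_inj; exact: H3.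
  - by move=> i j a b ij ab; apply: val_inj; exact: H4.
have [[f Hf] _] := HU _ _ HZ.
have [_ Hu] := HU R Y (conj H1 (conj H2 (conj H3 H4))).
pose g : {lrmorphism R -> R} := @subalg_val K R S \o f.
have := Hu g idfun _ x; rewrite /g /= => <-.
  exact/asboolP/(subalg_valP (f x)).
by move=> i a; rewrite Hf.
Qed.
End GenInd.

(** * Spanning by ordered monomials *)

Inductive lspan (K : fieldType) (V : lmodType K) (S : V -> Prop) : V -> Prop :=
| lspan0 : lspan S 0
| lspanD a y z : S y -> lspan S z -> lspan S (a *: y + z).

Section Lspan.
Variables (K : fieldType) (V : lmodType K) (S : V -> Prop).
Lemma lspan_mem x : S x -> lspan S x.
Proof. by move=> Sx; rewrite -[x]addr0 -[x]scale1r; do 2?constructor. Qed.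
Lemma lspan_lin a x y : lspan S x -> lspan S y -> lspan S (a *: x + y).
Proof.
move=> Hx Hy; elim: Hx => [|b u v Su _ IH]; first by rewrite scaler0 add0r.
by rewrite scalerDr scalerA -addrA; constructor.
Qed.
Lemma lspan_trans (S' : V -> Prop) x : (forall y, S' y -> lspan S y) ->
  lspan S' x -> lspan S x.
Proof.
move=> SS'; elim => [|a y z /SS' Hy _ IH]; first by constructor.
exact: lspan_lin.
Qed.
End Lspan.

Section Words.
Variables (K : fieldType) (q : K) (B : algType K) (X : 'I_9 -> B).
Hypothesis HX : rel9 q X.

Definition word (w : seq 'I_9) : B := \prod_(k <- w) X k.
Definition ssorted (w : seq 'I_9) := sorted (fun k l : 'I_9 => k <= l)%N w.

(** The word read as a number in base 9: the termination measure for straightening. *)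
Fixpoint wval (w : seq 'I_9) : nat := if w is k :: w' then k * 9 ^ size w' + wval w' else 0.
Lemma wval_lt w : (wval w < 9 ^ size w)%N.
Proof.
elim: w => //= k w IH; rewrite expnS; have := ltn_ord k.
set N := (9 ^ _)%N in IH *; move=> Hk.
have : (k * N <= 8 * N)%N by rewrite leq_mul2r -ltnS Hk orbT.
lia.
Qed.
Lemma wval_cat p s t : size s = size t -> (wval s < wval t)%N ->
  (wval (p ++ s) < wval (p ++ t))%N.
Proof. by move=> st Hst; elim: p => //= k p IH; rewrite !size_cat st ltn_add2l. Qed.
Lemma wval_cons (k l : 'I_9) s t : size s = size t -> (k < l)%N ->
  (wval (k :: s) < wval (l :: t))%N.
Proof.
move=> st kl /=; have := wval_lt s; rewrite st; set N := (9 ^ _)%N => Hs.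
have : (k.+1 * N <= l * N)%N by rewrite leq_mul2r kl orbT.
rewrite mulSn; lia.
Qed.

Lemma not_sorted_split (w : seq 'I_9) : ~~ ssorted w ->
  exists p k l s, w = p ++ k :: l :: s /\ (l < k)%N.
Proof.
elim: w => //= k [|l w] IH //=; case: (leqP k l) => [kl|lk] /=.
  by move=> /IH[p [k' [l' [s [-> H]]]]]; exists (k :: p), k', l', s.
by exists [::], k, l, w.
Qed.

(** A descent [k l] with [l < k] is replaced by [l k] and by a pair starting in the row of [l],
    above that of [k]. Both start with a letter smaller than [k], so [wval] decreases at constant
    length. *)
Lemma straighten w : lspan (fun x => exists2 v, ssorted v & x = word v) (word w).
Proof.
move: {2}(wval w).+1 (ltnSn (wval w)) => n; elim: n w => // n IH w.
case: (boolP (ssorted w)) => [sw _|]; first by apply: lspan_mem; exists w.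
move=> /not_sorted_split[p [k [l [s [-> lk]]]]] Hn.
have wdE (a b : 'I_9) : word (p ++ a :: b :: s) = word p * (X a * X b * word s).
  by rewrite /word big_cat !big_cons /= !mulrA.
have IH' (a b : 'I_9) : (a < k)%N -> lspan (fun x => exists2 v, ssorted v & x = word v)
    (word (p ++ a :: b :: s)).
  move=> ak; apply: IH; rewrite ltnS in Hn; apply: leq_trans Hn; apply: wval_cat => //.
  exact: wval_cons.
rewrite wdE HX // mulrBl mulrBr -scalerAl -scalerAr -wdE.
apply: lspan_lin; first exact: IH'.
case: ifP => [/andP[rlk _]|_]; last by rewrite mul0r mulr0 oppr0; constructor.
rewrite -scalerAl -scalerAr -wdE -scaleNr -[_ *: _]addr0.
apply: lspan_lin; last by constructor.
by apply: IH'; move: rlk => /=; lia.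
Qed.

(** Exponents are integers because they are shared with the torus; the absolute value is a
    convention, meaningful for nonnegative [x]. *)
Definition ordmon (x : E9) : B := \prod_(k <- enum 'I_9) X k ^+ `|x 0%R k|%N.
Definition cnt (w : seq 'I_9) : E9 := \row_k (count_mem k w)%:Z.

Lemma sorted_flat w : ssorted w ->
  w = flatten [seq nseq (count_mem k w) k | k <- enum 'I_9].
Proof.
move=> sw; apply: (@sorted_eq _ (fun k l : 'I_9 => k <= l)%N) => //.
- by move=> y x z; apply: leq_trans.
- by move=> x y; rewrite -eqn_leq => /eqP/val_inj.
- have: pairwise (fun k l : 'I_9 => k < l)%N (enum 'I_9).
    by rewrite -(pairwise_map val ltn) val_enum_ord -sorted_pairwise ?iota_ltn_sorted //; exact: ltn_trans.
  rewrite (sorted_pairwise (leT := fun k l : 'I_9 => (k <= l)%N)); last first.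
    by move=> y x z; apply: leq_trans.
  elim: (enum _) => //= k s IH /andP[/allP ks /IH {}IH].
  rewrite pairwise_cat IH andbT; apply/andP; split.
    apply/allrelP => x y; rewrite mem_nseq => /andP[_ /eqP ->].
    by case/flatten_mapP => k' /ks kk'; rewrite mem_nseq => /andP[_ /eqP ->]; exact: ltnW.
  elim: (count_mem k w) => //= m ->; rewrite andbT.
  by apply/allP => x; rewrite mem_nseq => /andP[_ /eqP ->].
- apply/allP => k _; apply/eqP; rewrite count_flatten -map_comp /=.
  rewrite sumnE big_map (bigD1_seq k) ?mem_enum ?enum_uniq //=.
  rewrite count_nseq /= eqxx mul1n big1 ?addn0 // => l lk.
  by rewrite count_nseq /= (negbTE lk).
Qed.

Lemma word_sorted w : ssorted w -> word w = ordmon (cnt w).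
Proof.
move=> /sorted_flat {1}->; rewrite /word big_flatten big_map /ordmon.
apply: eq_bigr => k _; rewrite mxE absz_nat.
by elim: (count_mem k w) => [|m IH]; rewrite /= ?big_nil // big_cons IH exprS.
Qed.
End Words.

Notation e9 k := (delta_mx 0 k : E9).

(** * Homogeneous elements and combinations with distinct leading exponents *)

Section TgaMore.
Variables (K : fieldType) (n : nat) (c : bichar K 'rV[int]_n).
Local Notation E := 'rV[int]_n.
Local Notation T := (tga c).
Implicit Types (f g : T) (x y : E).

Definition hom v d f := forall x, coef f x != 0 -> dot v x = d.
Lemma hom1 v : hom v 0 1.
Proof.
by move=> x; rewrite -mon0 coef_mon_neq0 => /eqP <-; exact: dot0r.
Qed.
Lemma homM v d d' f g : hom v d f -> hom v d' g -> hom v (d + d') (f * g).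
Proof.
move=> Hf Hg z /tga_coefM_neq0[x [y [-> /Hf <- /Hg <-]]]; exact: dotDr.
Qed.
Lemma homX v d f m : hom v d f -> hom v (d *+ m) (f ^+ m).
Proof.
move=> Hf; elim: m => [|m IH]; first exact: hom1.
by rewrite exprS mulrS; apply: homM.
Qed.

Lemma lead1 ls : lead ls (1 : T) 0.
Proof. by rewrite -mon0; exact: lead_mon. Qed.
Lemma leadX ls f x m : lead ls f x -> lead ls (f ^+ m) (x *+ m).
Proof.
move=> Hf; elim: m => [|m IH]; first exact: lead1.
by rewrite exprS mulrS; apply: leadM.
Qed.

Lemma coef_lin (phi : E -> T) f x :
  coef (lin phi f) x = \sum_(k <- supp f) coef f k * coef (phi k) x.
Proof. by rewrite coef_sum; apply: eq_bigr => k _; rewrite coefZ. Qed.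

Lemma coef_lin_neq0 (phi : E -> T) f x : coef (lin phi f) x != 0 ->
  exists2 k, coef f k != 0 & coef (phi k) x != 0.
Proof.
rewrite coef_lin => H; apply: contra_notP (negP H) => Hn; apply/eqP/big1_seq => k /=.
rewrite -coef_neq0 => fk; case: (eqVneq (coef (phi k) x) 0) => [->|]; first by rewrite mulr0.
by move=> phik; case: Hn; exists k.
Qed.

(** The [phi y] have pairwise distinct leading exponents, so the largest of these cannot be
    cancelled. *)
Lemma lead_lin ls (phi : E -> T) f x : (forall y, coef f y != 0 -> lead ls (phi y) y) ->
  lead ls f x -> lead ls (lin phi f) x.
Proof.
move=> Hphi [fx Hx]; split.
  rewrite coef_lin (bigD1_seq x) ?supp_uniq //= -?coef_neq0 //.
  rewrite big1_seq ?addr0; first by rewrite mulf_neq0 //; case: (Hphi _ fx).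
  move=> k /andP[kx]; rewrite -coef_neq0 => fk.
  case: (eqVneq (coef (phi k) x) 0) => [->|]; first by rewrite mulr0.
  have [_ H] := Hphi _ fk; move/H; rewrite eq_sym (negbTE kx) /=.
  have := Hx _ fk; rewrite (negbTE kx) /= => H1; rewrite -opprB.
  by rewrite (negbTE (lexiN H1)).
move=> z /coef_lin_neq0[k fk]; have [_ H] := Hphi _ fk; move/H.
have := Hx _ fk => /orP[/eqP -> //|H1] /orP[/eqP ->|H2]; first by rewrite H1 orbT.
by rewrite -(subrKA k) lexiD ?orbT.
Qed.

Definition rest (P : pred E) f : T :=
  \sum_(k <- supp f | P k) coef f k *: mon (tga_impl c) k.
Lemma coef_rest P f k : coef (rest P f) k = if P k then coef f k else 0.
Proof.
rewrite coef_sum; case: (boolP (k \in supp f)) => kf.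
  rewrite big_mkcond (bigD1_seq k) ?supp_uniq //= big1 => [|l lk].
    by rewrite addr0; case: ifP => // _; rewrite coefZ coef_mon eqxx mulr1.
  by case: ifP => // _; rewrite coefZ coef_mon (negbTE lk) mulr0.
rewrite big1_seq => [|l /andP[_ lf]].
  by move: kf; rewrite -coef_neq0 negbK => /eqP ->; case: ifP.
rewrite coefZ coef_mon; case: eqP => [lk|_]; last by rewrite mulr0.
by rewrite -lk lf in kf.
Qed.
Lemma restC P f : f = rest P f + rest (predC P) f.
Proof.
by apply: tgaP => k; rewrite coefD !coef_rest /=; case: (P k); rewrite ?addr0 ?add0r.
Qed.
End TgaMore.

(** * The embedding of [R] into the quantum torus *)

Definition nonneg (x : E9) := forall k, 0 <= x 0 k.
(** The three row sums and the three column sums. *)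
Definition mdeg_forms : seq E9 :=
  [seq mvec (fun j => (j == i)%:Z) (fun=> 0) | i <- iota 0 3] ++
  [seq mvec (fun=> 0) (fun j => (j == i)%:Z) | i <- iota 0 3].
Lemma mdeg_list_forms : mdeg_list mdeg_forms.
Proof.
move=> v; rewrite mem_cat => /orP[] /mapP[i _ ->]; first by do 2!eexists.
by exists (fun=> 0), (fun j => (j == i)%:Z).
Qed.

Section Embedding.
Variables (K : fieldType) (q : K) (hq0 : q != 0).
Variables (R : algType K) (Y : 'I_3 -> 'I_3 -> R) (hR : is_OqM3 q Y).
Local Notation T := (tga (qbc hq0)).
Definition gen (k : 'I_9) : R := Y (rw k) (cl k).

Lemma gen_ix i a : gen (ix i a) = Y i a.
Proof. by rewrite /gen rw_ix cl_ix. Qed.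
Lemma gen_rel9 : rel9 q gen.
Proof.
apply/rel9P; have [[H1 [H2 [H3 H4]]] _] := hR.
by split; [|split; [|split]] => *; rewrite !gen_ix; auto.
Qed.

Lemma embedding_exists : exists f : {lrmorphism R -> T}, forall k, f (gen k) = tgen hq0 k.
Proof.
have [_ /(_ T (fun i a => tgen hq0 (ix i a)))[|[f Hf] _]] := hR.
  by have /rel9P := tgen_rel9 hq0.
by exists f => k; rewrite Hf ix_rw_cl.
Qed.

Lemma gen_rect_ind (P : R -> Prop) : P 1 -> (forall a x y, P x -> P y -> P (a *: x + y)) ->
  (forall x y, P x -> P y -> P (x * y)) -> (forall k, P (gen k)) -> forall x, P x.
Proof.
move=> P1 PD PM PX; apply: (gen_ind P1 PD PM hR) => i a.
by rewrite -gen_ix.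
Qed.

Lemma gen_span x : lspan (fun x => exists w, x = word gen w) x.
Proof.
elim/gen_rect_ind: x => [|a x y|x y Hx Hy|k].
- by apply: lspan_mem; exists [::]; rewrite /word big_nil.
- exact: lspan_lin.
- elim: Hx => [|a u v [w ->] _ IH]; first by rewrite mul0r; constructor.
  rewrite mulrDl; apply: (lspan_trans (S' := fun z => exists w, z = word gen w)).
    by move=> z; exact: lspan_mem.
  rewrite -scalerAl; apply: lspan_lin => //.
  elim: Hy => [|b s t [w' ->] _ IH']; first by rewrite mulr0; constructor.
  rewrite mulrDr -scalerAr; apply: lspan_lin => //.
  by apply: lspan_mem; exists (w ++ w'); rewrite /word big_cat.
- by apply: lspan_mem; exists [:: k]; rewrite /word big_seq1.
Qed.

Definition pbw (f : T) : R := lin (ordmon gen) f.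

Lemma pbw_surj x : exists2 f : T, (forall y, coef f y != 0 -> nonneg y) & x = pbw f.
Proof.
have : lspan (fun x => exists2 v, ssorted v & x = word gen v) x.
  by apply: (lspan_trans _ (gen_span x)) => y [w ->]; apply: (straighten gen_rel9).
elim => [|a y z [v sv ->] _ [f Hf ->]].
  exists 0 => [y|]; first by rewrite coef0 eqxx.
  by rewrite /pbw lin0.
exists (a *: mon (tga_impl (qbc hq0)) (cnt v) + f).
  move=> y'; rewrite coefD; case: (eqVneq (coef f y') 0) => [->|/Hf //].
  by rewrite addr0 coefZ mulf_eq0 negb_or coef_mon_neq0 => /andP[_ /eqP <-] k; rewrite mxE.
by rewrite /pbw linD linZ lin_mon word_sorted.
Qed.

Variable iota : {lrmorphism R -> T}.
Hypothesis Hiota : forall k, iota (gen k) = tgen hq0 k.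

Lemma iotaD x y : iota (x + y) = iota x + iota y. Proof. exact: rmorphD. Qed.
Lemma iotaB x y : iota (x - y) = iota x - iota y. Proof. exact: rmorphB. Qed.
Lemma iotaZ a x : iota (a *: x) = a *: iota x. Proof. exact: linearZ. Qed.
Lemma iotaM x y : iota (x * y) = iota x * iota y. Proof. exact: rmorphM. Qed.
Lemma iota0 : iota 0 = 0. Proof. exact: rmorph0. Qed.
Lemma iota1 : iota 1 = 1. Proof. exact: rmorph1. Qed.
Lemma iotaX x n : iota (x ^+ n) = iota x ^+ n. Proof. exact: rmorphXn. Qed.
Lemma iota_prod (I : Type) (s : seq I) (F : I -> R) :
  iota (\prod_(i <- s) F i) = \prod_(i <- s) iota (F i).
Proof. exact: rmorph_prod. Qed.
Lemma iota_sum (I : Type) (s : seq I) (P : pred I) (F : I -> R) :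
  iota (\sum_(i <- s | P i) F i) = \sum_(i <- s | P i) iota (F i).
Proof. exact: rmorph_sum. Qed.

Lemma iota_lin (phi : E9 -> R) (f : T) : iota (lin phi f) = lin (iota \o phi) f.
Proof. by rewrite iota_sum; apply: eq_bigr => k _; rewrite iotaZ. Qed.

Lemma lead_ordmon ls x : mdeg_list ls -> nonneg x ->
  lead (ls ++ [:: psi]) (iota (ordmon gen x)) x.
Proof.
move=> Hls x0; rewrite iota_prod.
have {2}-> : x = \sum_(k <- enum 'I_9) e9 k *+ `|x 0%R k|%N.
  rewrite big_enum; apply/rowP => j; rewrite summxE (bigD1 j) //= mulmxnE mxE !eqxx /=.
  rewrite big1 ?addr0 => [|k kj]; last by rewrite mulmxnE mxE eqxx eq_sym (negbTE kj) mul0rn.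
  by rewrite -[1%:R]/1 natz gez0_abs.
elim: (enum _) => [|k s IH]; rewrite ?big_nil ?big_cons; first exact: lead1.
by apply: leadM => //; rewrite iotaX Hiota; apply/leadX/lead_tgen.
Qed.

Lemma hom_ordmon r s x : nonneg x -> hom (mvec r s) (dot (mvec r s) x) (iota (ordmon gen x)).
Proof.
move=> x0; rewrite iota_prod.
have -> : dot (mvec r s) x = \sum_(k <- enum 'I_9) (r (rw k) + s (cl k)) *+ `|x 0%R k|%N.
  rewrite big_enum; apply: eq_bigr => k _; rewrite mxE.
  by rewrite -[RHS]mulr_natr natz gez0_abs.
elim: (enum _) => [|k t IH]; rewrite ?big_nil ?big_cons; first exact: hom1.
apply: homM => //; rewrite iotaX Hiota; apply: homX => y; exact: tgen_mvec.
Qed.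

(** By [pbw_surj] every element is a combination of ordered monomials, and their images have
    distinct leading exponents by [lead_ordmon]. *)
Lemma iota_inj : injective iota.
Proof.
apply: raddf_inj => x; have [f Hf ->] := pbw_surj x => H.
case: (eqVneq f 0) => [->|/(lead_exists [:: psi])[z Hz]].
  by rewrite /pbw lin0.
have := @lead_lin _ _ _ [:: psi] (iota \o ordmon gen) f z.
rewrite -iota_lin -/(pbw f) H => /(_ _ Hz) [|] //.
  by move=> y /Hf/(lead_ordmon (ls := [::]) _); apply.
by rewrite coef0 eqxx.
Qed.

(* Elements of [R] may have negative exponents in [T], but only next to other
   exponents of the same multidegree. *)
Lemma isolated_nonneg x y0 : coef (iota x) y0 != 0 ->
  (forall y, coef (iota x) y != 0 -> nul mdeg_forms (y - y0) -> y = y0) -> nonneg y0.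
Proof.
have [f Hf ->] := pbw_surj x; rewrite iota_lin => Hy0 Hiso.
pose P k := nul mdeg_forms (k - y0); pose phi := iota \o ordmon gen.
have Hmd k z : coef f k != 0 -> coef (phi k) z != 0 -> nul mdeg_forms (k - z).
  move=> fk Hz; apply/allP => v /mdeg_list_forms[r [s ->]].
  by rewrite dotBr (hom_ordmon r s (Hf _ fk) Hz) subrr.
have cE z : nul mdeg_forms (z - y0) -> coef (lin phi (rest P f)) z = coef (lin phi f) z.
  move=> Hz; rewrite {2}(restC P f) linD coefD.
  suff -> : coef (lin phi (rest (predC P) f)) z = 0 by rewrite addr0.
  apply/eqP; apply: contraT => /coef_lin_neq0[k]; rewrite coef_rest /=.
  case: ifP; last by rewrite eqxx.
  move=> /negP nP fk /(Hmd _ _ fk) Hk; case: nP.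
  by rewrite /P -(subrKA z) nulD.
(* The leading exponent [z] of the part of [f] with the multidegree of [y0] belongs to an ordered
   monomial, hence is nonnegative. It survives in the image, so isolation identifies it with
   [y0]. *)
have [|z Hz] := @lead_exists _ _ _ [:: psi] (rest P f).
  apply: contraNneq Hy0 => f0; rewrite -cE ?subrr ?f0; last by apply/allP => v _; rewrite dot0r.
  by rewrite lin0 coef0.
have [] := @lead_lin _ _ _ [:: psi] phi _ _ _ Hz.
  move=> y; rewrite coef_rest; case: ifP => [_ /Hf|]; last by rewrite eqxx.
  exact: (lead_ordmon (ls := [::])).
case: Hz; rewrite coef_rest; case: ifP => [Pz /Hf z0 _|]; last by rewrite eqxx.
by rewrite cE // => /Hiso <-.
Qed.
End Embedding.

(** * The augmentation ideal and the degree filtration *)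

Section Sqr.
Variables (K : fieldType) (R : algType K) (X : 'I_9 -> R).
(* The square of the augmentation ideal. *)
Definition sqr (x : R) := exists z : 'I_9 -> 'I_9 -> R, x = \sum_k \sum_l X k * X l * z k l.

Lemma sqr_lin a x y : sqr x -> sqr y -> sqr (a *: x + y).
Proof.
move=> [z ->] [t ->]; exists (fun k l => a *: z k l + t k l).
rewrite scaler_sumr -big_split; apply: eq_bigr => k _.
rewrite scaler_sumr -big_split; apply: eq_bigr => l _.
by rewrite mulrDr scalerAr.
Qed.
Lemma sqr0 : sqr 0.
Proof. by exists (fun _ _ => 0); rewrite big1 // => k _; rewrite big1 // => l _; rewrite mulr0. Qed.
Lemma sqrN x : sqr x -> sqr (- x).
Proof. by move=> Hx; rewrite -[- x]addr0 -scaleN1r; exact: sqr_lin Hx sqr0. Qed.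
Lemma sqrMr x y : sqr x -> sqr (x * y).
Proof.
move=> [z ->]; exists (fun k l => z k l * y).
rewrite mulr_suml; apply: eq_bigr => k _; rewrite mulr_suml.
by apply: eq_bigr => l _; rewrite mulrA.
Qed.
Lemma sqr_XX k l : sqr (X k * X l).
Proof.
exists (fun k' l' => ((k' == k) && (l' == l))%:R).
rewrite (bigD1 k) //= (bigD1 l) //= !eqxx mulr1 !big1 ?addr0 // => [k' /negbTE kk|l' /negbTE ll].
  by rewrite big1 // => l' _; rewrite kk mulr0.
by rewrite ll mulr0.
Qed.
End Sqr.

Definition degf : E9 := mvec (fun=> 1) (fun=> 0).
(** A multidegree form whose value on a generator is its index [3 * i + a], so that it separates the
    generators. *)
Definition chi : E9 := mvec (fun i => (3 * i)%:Z) (fun a => a%:Z).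

Lemma dot_dg_e k : dot degf (e9 k) = 1.
Proof.
rewrite /dot (bigD1 k) //= !mxE !eqxx mulr1 big1 ?addr0 // => i ik.
by rewrite !mxE (negbTE ik) andbF mulr0.
Qed.
Lemma dot_chi_e k : dot chi (e9 k) = k%:Z.
Proof.
rewrite /dot (bigD1 k) //= !mxE !eqxx mulr1 big1 ?addr0 => [|i ik].
  by rewrite -PoszD mulnC -divn_eq.
by rewrite !mxE (negbTE ik) andbF mulr0.
Qed.

Section Degree.
Variables (K : fieldType) (q : K) (hq0 : q != 0).
Variables (R : algType K) (Y : 'I_3 -> 'I_3 -> R) (hR : is_OqM3 q Y).
Local Notation T := (tga (qbc hq0)).
Local Notation x_ := (gen Y).
Variable iota : {lrmorphism R -> T}.
Hypothesis Hiota : forall k, iota (x_ k) = tgen hq0 k.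

Lemma tgen_deg (k : 'I_9) y : coef (tgen hq0 k) y != 0 -> dot degf y = 1.
Proof. by move/(tgen_mvec (fun=> 1) (fun=> 0)); rewrite addr0. Qed.
Lemma tgen_chi (k : 'I_9) y : coef (tgen hq0 k) y != 0 -> dot chi y = k%:Z.
Proof.
move/(tgen_mvec (fun i => (3 * i)%:Z) (fun a => a%:Z)) => ->.
by rewrite -PoszD mulnC -divn_eq.
Qed.
Lemma coef_tgen_ee (j k : 'I_9) : coef (tgen hq0 j) (e9 k) = (j == k)%:R.
Proof.
case: eqVneq => [->|jk]; first exact: coef_tgen_e.
apply/eqP; apply: contraT => /tgen_chi; rewrite dot_chi_e => -[kj].
by case/eqP: jk; apply/val_inj.
Qed.

(** The filtration of [R] by total degree, read off in the torus; [fil 2] is the same as [sqr] by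
    [fil_sqr] and [sqr_fil]. *)
Definition fil (d : nat) (x : R) := forall y, coef (iota x) y != 0 -> d%:Z <= dot degf y.

Lemma fil_lin d a x y : fil d x -> fil d y -> fil d (a *: x + y).
Proof.
move=> Hx Hy z; rewrite (iotaD iota) (iotaZ iota) coefD coefZ.
case: (eqVneq (coef (iota x) z) 0) => [->|/Hx //].
by rewrite mulr0 add0r => /Hy.
Qed.
Lemma filM d d' x y : fil d x -> fil d' y -> fil (d + d') (x * y).
Proof.
move=> Hx Hy z; rewrite (iotaM iota) => /tga_coefM_neq0[u [v [-> /Hx Hu /Hy Hv]]].
by rewrite dotDr PoszD lerD.
Qed.
Lemma filN0 d : fil d 0.
Proof. by move=> y; rewrite (iota0 iota) coef0 eqxx. Qed.
Lemma filD d x y : fil d x -> fil d y -> fil d (x + y).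
Proof. by move=> Hx Hy; rewrite -[x]scale1r; apply: fil_lin. Qed.
Lemma filZ d a x : fil d x -> fil d (a *: x).
Proof. by move=> Hx; rewrite -[a *: x]addr0; apply: fil_lin => //; exact: filN0. Qed.
Lemma filN d x : fil d x -> fil d (- x).
Proof. by move=> Hx; rewrite -scaleN1r; exact: filZ. Qed.
Lemma filB d x y : fil d x -> fil d y -> fil d (x - y).
Proof. by move=> Hx Hy; apply: filD => //; exact: filN. Qed.
Lemma filW d d' x : (d <= d')%N -> fil d' x -> fil d x.
Proof. by move=> dd Hx y /Hx; apply: le_trans; rewrite lez_nat. Qed.
Lemma fil_sum d (I : Type) (s : seq I) (F : I -> R) :
  (forall i, fil d (F i)) -> fil d (\sum_(i <- s) F i).
Proof. by move=> HF; apply: big_ind => //; [exact: filN0 | exact: filD]. Qed.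
Lemma fil1 : fil 0 1.
Proof. by move=> y; rewrite (iota1 iota) => /(hom1 degf) ->. Qed.
Lemma filX k : fil 1 (x_ k).
Proof. by move=> y; rewrite Hiota => /tgen_deg ->. Qed.
Lemma fil0 x : fil 0 x.
Proof.
elim/(gen_rect_ind hR): x => [|a x y|x y|k].
- exact: fil1.
- exact: fil_lin.
- exact: filM.
- by apply: (filW (d' := 1)) => //; exact: filX.
Qed.
Lemma fil_sqr x : sqr x_ x -> fil 2 x.
Proof.
move=> [z ->]; apply: fil_sum => k; apply: fil_sum => l.
rewrite -[2%N]addn0; apply: filM; last exact: fil0.
by rewrite -[2%N]/(1 + 1)%N; apply: filM; apply: filX.
Qed.

Lemma gen_decomp x : exists c (l : 'I_9 -> K) (s : R),
  sqr x_ s /\ x = c *: 1 + \sum_k l k *: x_ k + s.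
Proof.
elim: (gen_span hR x) => [|a y z [w ->] _ [c [l [s [Hs ->]]]]].
  exists 0, (fun=> 0), 0; split; first exact: sqr0.
  by rewrite scale0r add0r addr0 big1 // => k _; rewrite scale0r.
case: w => [|k [|k' w]].
- exists (a + c), l, s; split=> //.
  by rewrite /word big_nil scalerDl -!addrA.
- exists c, (fun j => a * (j == k)%:R + l j), s; split=> //.
  have -> : \sum_j (a * (j == k)%:R + l j) *: x_ j = a *: x_ k + \sum_j l j *: x_ j.
    under eq_bigr do rewrite scalerDl.
    rewrite big_split /= (bigD1 k) //= eqxx mulr1 big1 ?addr0 // => j /negbTE ->.
    by rewrite mulr0 scale0r.
  by rewrite /word big_seq1 !addrA; congr (_ + _ + _); rewrite addrC.
- exists c, l, (a *: word x_ [:: k, k' & w] + s); split.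
    apply: sqr_lin => //; rewrite /word !big_cons mulrA; apply: sqrMr; exact: sqr_XX.
  by rewrite addrCA.
Qed.

(** [s] lives in degree at least two, so the constant and linear coefficients can be read off from
    [iota x]. *)
Lemma coef_dec c (l : 'I_9 -> K) s x : sqr x_ s -> x = c *: 1 + \sum_k l k *: x_ k + s ->
  coef (iota x) 0 = c /\ forall k, coef (iota x) (e9 k) = l k.
Proof.
move=> /fil_sqr Hs ->.
have Hz y : dot degf y < 2 -> coef (iota s) y = 0.
  by move=> Hy; apply/eqP; apply: contraT => /Hs; rewrite leNgt Hy.
rewrite !(iotaD iota) (iotaZ iota) (iota1 iota) (iota_sum iota).
split=> [|k]; rewrite !coefD coefZ -mon0 coef_mon coef_sum Hz ?dot0r ?dot_dg_e // addr0.
  rewrite eqxx mulr1 big1 ?addr0 // => k _; rewrite (iotaZ iota) coefZ Hiota.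
  case: (eqVneq (coef (tgen hq0 k) 0) 0) => [->|/tgen_deg]; first by rewrite mulr0.
  by rewrite dot0r.
rewrite (_ : (0 == e9 k) = false) ?mulr0 ?add0r; last first.
  by apply/negP => /eqP /rowP /(_ k); rewrite !mxE !eqxx.
rewrite (bigD1 k) //= big1 => [|j jk]; rewrite (iotaZ iota) coefZ Hiota coef_tgen_ee.
  by rewrite eqxx mulr1 addr0.
by rewrite (negbTE jk) mulr0.
Qed.

Lemma sqr_fil x : fil 2 x -> sqr x_ x.
Proof.
move=> Hx; have [c [l [s [Hs Ex]]]] := gen_decomp x; have [E0 E1] := coef_dec Hs Ex.
have Hz y : dot degf y < 2 -> coef (iota x) y = 0.
  by move=> Hy; apply/eqP; apply: contraT => /Hx; rewrite leNgt Hy.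
rewrite Ex -E0 Hz ?dot0r // scale0r add0r big1 ?add0r // => k _.
by rewrite -E1 Hz ?dot_dg_e // scale0r.
Qed.

Lemma dot_dg0 x y : coef (iota x) y != 0 -> dot degf y = 0 -> y = 0.
Proof.
have [c [l [s [Hs ->]]]] := gen_decomp x; move: (fil_sqr Hs) => {}Hs.
rewrite !(iotaD iota) (iotaZ iota) (iota1 iota) (iota_sum iota) !coefD coefZ => + Hy.
rewrite coef_sum big1 => [|k _]; last first.
  rewrite (iotaZ iota) coefZ Hiota; case: (eqVneq (coef (tgen hq0 k) y) 0) => [->|/tgen_deg].
    by rewrite mulr0.
  by rewrite Hy.
have -> : coef (iota s) y = 0 by apply/eqP; apply: contraT => /Hs; rewrite Hy.
by rewrite !addr0 mulf_eq0 negb_or -mon0 coef_mon_neq0 => /andP[_ /eqP <-].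
Qed.

End Degree.

(** * The radical of the commutation form *)

Lemma Lambda_ee k l : Lambda (e9 k) (e9 l) = omega k l.
Proof.
rewrite Lambda_delta /weight /dot (bigD1 k) //= !mxE !eqxx mulr1 big1 ?addr0 // => j jk.
by rewrite !mxE (negbTE jk) andbF mulr0.
Qed.

(** With [O] the matrix of [omega] and [M] that of the [g k], the first hypothesis reads
    [M O M^T = O]. Hence [O M^T] has the rank of [O], and the left kernel of [O], contained in that
    of [O M^T], is equal to it. *)
Lemma Lambda_nondeg (g : 'I_9 -> E9) d : (forall k l, Lambda (g k) (g l) = omega k l) ->
  (forall k, Lambda d (g k) = 0) -> forall l, weight d l = 0.
Proof.
move=> Hg Hd l.
pose O : 'M[rat]_9 := \matrix_(k, l) (omega k l)%:~R.
pose M : 'M[rat]_9 := \matrix_(k, l) (g k 0 l)%:~R.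
pose D : 'rV[rat]_9 := \row_l (d 0 l)%:~R.
have LE (x y : E9) : (Lambda x y)%:~R =
    \sum_l (\sum_k (x 0 k)%:~R * O k l) * (y 0 l)%:~R :> rat.
  rewrite /Lambda rmorph_sum; apply: eq_bigr => j _; rewrite rmorphM; congr (_ * _).
  by rewrite /weight /dot rmorph_sum; apply: eq_bigr => k _; rewrite !mxE rmorphM mulrC.
have HM : M *m (O *m M^T) = O.
  rewrite mulmxA; apply/matrixP => k j; rewrite [RHS]mxE -Hg LE !mxE.
  apply: eq_bigr => i _; rewrite !mxE; congr (_ * _).
  by apply: eq_bigr => m _; rewrite !mxE.
have HD : D *m (O *m M^T) = 0.
  rewrite mulmxA; apply/rowP => k.
  have /esym H0 : (Lambda d (g k))%:~R = 0 :> rat by rewrite Hd.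
  rewrite [RHS]mxE {}H0 LE !mxE.
  apply: eq_bigr => i _; rewrite !mxE; congr (_ * _).
  by apply: eq_bigr => m _; rewrite !mxE.
have sub : (kermx O <= kermx (O *m M^T))%MS.
  by apply/sub_kermxP; rewrite mulmxA mulmx_ker mul0mx.
have sub' : (kermx (O *m M^T) <= kermx O)%MS.
  rewrite -(geq_leqif (mxrank_leqif_sup sub)) !mxrank_ker leq_sub2l //.
  by rewrite -{1}HM mxrankM_maxr.
have /sub_kermxP : (D <= kermx O)%MS by apply: submx_trans sub'; apply/sub_kermxP.
move=> /rowP/(_ l); rewrite !mxE => H; apply/eqP; rewrite -(intr_eq0 rat) -H.
rewrite /weight /dot rmorph_sum; apply/eqP/eq_bigr => k _.
by rewrite !mxE rmorphM mulrC.
Qed.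

(* The exponents of the monomials in the minors [mn_d], [mn_u], [mn_v], [mn_D]
   and the generators [Y_{1,3}], [Y_{2,3}], [Y_{3,1}], [Y_{3,2}], [Y_{3,3}]. *)
Definition cone (y : E9) : bool :=
  [&& 0 <= y 0 (o9 0), y 0 (o9 0) <= y 0 (o9 4), y 0 (o9 4) <= y 0 (o9 8),
   0 <= y 0 (o9 1), y 0 (o9 1) <= y 0 (o9 5), 0 <= y 0 (o9 3), y 0 (o9 3) <= y 0 (o9 7),
   0 <= y 0 (o9 2) & 0 <= y 0 (o9 6)].
Lemma ord9_ind (P : 'I_9 -> Prop) : P (o9 0) -> P (o9 1) -> P (o9 2) -> P (o9 3) ->
  P (o9 4) -> P (o9 5) -> P (o9 6) -> P (o9 7) -> P (o9 8) -> forall k, P k.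
Proof.
move=> p0 p1 p2 p3 p4 p5 p6 p7 p8 [k k9].
by do 9?[case: k k9 => [|k] k9; first by rewrite (bool_irrelevance k9 isT)].
Qed.

(* Restated so that the ring operations on [int] are syntactically the ones
   that [lia] recognizes. *)
Lemma coD (x y : E9) k : (x + y) 0 k = x 0 k + y 0 k. Proof. by rewrite mxE. Qed.
Lemma coN (x : E9) k : (- x) 0 k = - x 0 k. Proof. by rewrite mxE. Qed.
Lemma coMn (x : E9) n k : (x *+ n) 0 k = n%:Z * x 0 k.
Proof. by rewrite mulmxnE -mulr_natl natz. Qed.
Lemma co0 k : (0 : E9) 0 k = 0. Proof. by rewrite mxE. Qed.
Lemma co_expo s k : (expo s) 0 k = nth 0 s k. Proof. by rewrite mxE. Qed.
Definition coE := (coD, coN, coMn, co0, co_expo).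

Lemma coneD x y : cone x -> cone y -> cone (x + y).
Proof. by rewrite /cone !coE; lia. Qed.
(** The sum of the nine generators of the cone. Each inequality holds with a margin of one, which
    leaves room to add any [e9 k]. *)
Definition nu0 : E9 := expo [:: 1; 1; 1; 1; 2%Z; 2%Z; 1; 2%Z; 3%Z].
Lemma cone_nu0 : cone nu0.
Proof. by rewrite /cone !mxE. Qed.
Lemma cone_nu0e k : cone (nu0 + e9 k).
Proof. by rewrite /cone !mxE /= -!val_eqE /=; case: k => k; do 9?[case: k => [|k] //]. Qed.
Lemma coneX n x : cone x -> cone (x *+ n).
Proof.
move=> Hx; elim: n => [|n IH]; first by rewrite /cone !mxE.
by rewrite mulrS coneD.
Qed.
Lemma cone_shift (s : seq E9) : exists2 v, cone v & forall y, y \in s -> cone (y + v).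
Proof.
elim: s => [|x s [v Hv IH]]; first by exists 0 => //; rewrite /cone !mxE.
pose N := (\sum_k `|x 0%R k|)%N.
have HN k : (`|x 0%R k| <= N)%N by rewrite /N (bigD1 k) //= leq_addr.
(* Each inequality involves at most two coordinates, of absolute value at most [N], and its margin
   at [nu0] is one. *)
have Hx : cone (x + nu0 *+ (2 * N)).
  rewrite /cone !coE /=.
  have := HN (o9 0); have := HN (o9 1); have := HN (o9 2); have := HN (o9 3).
  have := HN (o9 4); have := HN (o9 5); have := HN (o9 6); have := HN (o9 7).
  have := HN (o9 8); move: N HN => N' _ *; lia.
exists (v + nu0 *+ (2 * N)); first by rewrite coneD // coneX // cone_nu0.
move=> y; rewrite inE => /predU1P[->|/IH Hy].
  by rewrite addrCA coneD.
by rewrite addrA coneD // coneX // cone_nu0.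
Qed.

(** * Monomials of the torus that lie in [R] *)

Section Cone.
Variables (K : fieldType) (q : K) (hq0 : q != 0).
Variables (R : algType K) (Y : 'I_3 -> 'I_3 -> R) (hR : is_OqM3 q Y).
Local Notation T := (tga (qbc hq0)).
Local Notation x_ := (gen Y).
Local Notation m := (mon (tga_impl (qbc hq0))).
Variable iota : {lrmorphism R -> T}.
Hypothesis Hiota : forall k, iota (x_ k) = tgen hq0 k.

Lemma iota_minors : [/\ iota (mn_d q x_) = m (expo [:: 0; 0; 0; 0; 1; 0; 0; 0; 1]),
  iota (mn_u q x_) = m (expo [:: 0; 1; 0; 0; 0; 1; 0; 0; 0]),
  iota (mn_v q x_) = m (expo [:: 0; 0; 0; 1; 0; 0; 0; 1; 0]) &
  iota (mn_D q x_) = m (expo [:: 1; 0; 0; 0; 1; 0; 0; 0; 1])].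
Proof.
rewrite -tgen_minor_d -tgen_minor_u -tgen_minor_v -tgen_minor_D /mn_D /mn_d /mn_u /mn_v.
by split; rewrite !(iotaB iota, iotaD iota, iotaZ iota, iotaM iota, Hiota).
Qed.

Definition monomial_hit (y : E9) := exists x, iota x = m y.
Lemma monomial_hitD y z : monomial_hit y -> monomial_hit z -> monomial_hit (y + z).
Proof.
move=> [x Hx] [x' Hx']; exists ((qbc hq0 y z)^-1 *: (x * x')).
by rewrite (iotaZ iota) (iotaM iota) Hx Hx' monM scalerA mulVf ?scale1r ?bc_neq0.
Qed.
Lemma monomial_hitX y n : monomial_hit y -> monomial_hit (y *+ n).
Proof.
move=> Hy; elim: n => [|n IH]; last by rewrite mulrS; apply: monomial_hitD.
by exists 1; rewrite (iota1 iota) mon0.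
Qed.

Lemma cone_hit y : cone y -> monomial_hit y.
Proof.
have [Hd Hu Hv HD] := iota_minors => Hy.
have H1 k : (k \in [:: 2; 5; 6; 7; 8])%N -> forall k9 : (k < 9)%N,
    monomial_hit (expo [seq (i == k :> nat)%:Z | i <- seq.iota 0 9]).
  by move=> kk k9; exists (x_ (Ordinal k9)); rewrite Hiota /= tgen_mon.
(* The multiplicities of the nine generators of the cone are the margins in the inequalities of
   [cone]. *)
have -> : y = expo [:: 1; 0; 0; 0; 1; 0; 0; 0; 1] *+ `|y 0%R (o9 0)|%N
   + expo [:: 0; 0; 0; 0; 1; 0; 0; 0; 1] *+ `|y 0%R (o9 4) - y 0%R (o9 0)|%N
   + expo [:: 0; 0; 0; 0; 0; 0; 0; 0; 1] *+ `|y 0%R (o9 8) - y 0%R (o9 4)|%N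
   + expo [:: 0; 1; 0; 0; 0; 1; 0; 0; 0] *+ `|y 0%R (o9 1)|%N
   + expo [:: 0; 0; 0; 0; 0; 1; 0; 0; 0] *+ `|y 0%R (o9 5) - y 0%R (o9 1)|%N
   + expo [:: 0; 0; 0; 1; 0; 0; 0; 1; 0] *+ `|y 0%R (o9 3)|%N
   + expo [:: 0; 0; 0; 0; 0; 0; 0; 1; 0] *+ `|y 0%R (o9 7) - y 0%R (o9 3)|%N
   + expo [:: 0; 0; 1; 0; 0; 0; 0; 0; 0] *+ `|y 0%R (o9 2)|%N
   + expo [:: 0; 0; 0; 0; 0; 0; 1; 0; 0] *+ `|y 0%R (o9 6)|%N.
  move: Hy; rewrite /cone => Hy; apply/rowP.
  by apply: ord9_ind; rewrite !coE /=; lia.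
repeat apply: monomial_hitD; apply: monomial_hitX;
  try by [exists (mn_d q x_)|exists (mn_u q x_)|exists (mn_v q x_)|exists (mn_D q x_)].
- exact: (H1 8).
- exact: (H1 5).
- exact: (H1 7).
- exact: (H1 2).
- exact: (H1 6).
Qed.
End Cone.

(** * Powers of [q] and leading exponents *)

Section QCommutation.
Variables (K : fieldType) (q : K) (hq0 : q != 0).
Hypothesis hq : forall n : nat, (0 < n)%N -> q ^+ n != 1.
Local Notation T := (tga (qbc hq0)).

Lemma qexp_inj (a b : int) : q ^ a = q ^ b -> a = b.
Proof.
move=> ab; apply/eqP; rewrite -subr_eq0; apply/negPn/negP => d0.
have : q ^ (a - b) = 1.
  by apply: (mulIf (expfz_neq0 b hq0)); rewrite -expfzDr // subrK mul1r.
case: (a - b) d0 => [[|n]|n] // _ H.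
  by have := hq (ltn0Sn n); rewrite exprnP H eqxx.
have := hq (ltn0Sn n); rewrite -invr_eq1 -[_^-1]/(q ^ Negz n) H.
by rewrite eqxx.
Qed.

(** By [lead_comm] the relation passes to the leading terms; as [q] is not a root of unity, the
    power of [q] determines its exponent. *)
Lemma lead_Lam ls (f g : T) x y n : lead ls f x -> lead ls g y ->
  f * g = q ^ n *: (g * f) -> Lambda x y = n.
Proof.
move=> Hf Hg /(lead_comm Hf Hg) /=; rewrite beta_Lambda -expfzDr // => /qexp_inj.
by rewrite [n + _]addrC => /addrI.
Qed.

Lemma mon_comm x y : mon (tga_impl (qbc hq0)) x * mon (tga_impl (qbc hq0)) y =
  q ^ Lambda x y *: (mon (tga_impl (qbc hq0)) y * mon (tga_impl (qbc hq0)) x).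
Proof.
rewrite !monM scalerA /= beta_Lambda expfzDr // mulrC [y + x]addrC.
by [].
Qed.
End QCommutation.

Lemma nulP ls (x : E9) : (forall x, nul ls x = [forall k, weight x k == 0]) ->
  reflect (forall k, weight x k = 0) (nul ls x).
Proof.
by move=> ->; apply: (iffP forallP) => H k; apply/eqP; rewrite ?H.
Qed.

(** * Absence of cancellation between different weights *)

Section NoCancellation.
Variables (K : fieldType) (q : K) (hq0 : q != 0).
Hypothesis hq : forall n : nat, (0 < n)%N -> q ^+ n != 1.
Variables (R : algType K).
Local Notation T := (tga (qbc hq0)).
Local Notation m := (mon (tga_impl (qbc hq0))).
Variable iota : {lrmorphism R -> T}.
Hypothesis inj_iota : injective iota.
Variable s : {lrmorphism R -> R}.
Variable ls : seq E9.
Hypothesis Hls : forall x, nul ls x = [forall k, weight x k == 0].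
Variable mx : E9 -> R.
Hypothesis Hmx : forall y, cone y -> iota (mx y) = m y.
Variable lam : R -> E9.
Hypothesis Hlam : forall x, x != 0 -> lead ls (iota (s x)) (lam x).

Lemma iota_neq0 x : (iota x != 0) = (x != 0).
Proof. by rewrite -(iota0 iota) (inj_eq inj_iota). Qed.

Lemma mx_neq0 y : cone y -> mx y != 0.
Proof. by move=> Hy; rewrite -iota_neq0 Hmx //; apply: (lead_neq0 (lead_mon _ ls y)). Qed.

Lemma iota_sM x y : iota (s (x * y)) = iota (s x) * iota (s y).
Proof. by rewrite rmorphM (iotaM iota). Qed.
Lemma iota_sZ a x : iota (s (a *: x)) = a *: iota (s x).
Proof. by rewrite linearZ (iotaZ iota). Qed.

Lemma lamM x y : x != 0 -> y != 0 -> x * y != 0 /\ lam (x * y) = lam x + lam y.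
Proof.
move=> x0 y0; have xy0 : x * y != 0.
  by rewrite -iota_neq0 (iotaM iota) tga_mulf_eq0 negb_or !iota_neq0 x0.
split=> //; apply: (lead_uniq (Hlam xy0)).
by rewrite iota_sM; apply: leadM; apply: Hlam.
Qed.

Lemma lamZ a x : a != 0 -> x != 0 -> lam (a *: x) = lam x.
Proof.
move=> a0 x0; have ax0 : a *: x != 0 by rewrite scaler_eq0 negb_or a0.
apply: (lead_uniq (Hlam ax0)).
by rewrite iota_sZ; apply: leadZ => //; apply: Hlam.
Qed.

(** The map that [s] induces on the cone by leading exponents. It is additive and, as [s] preserves
    q-commutation, an isometry for [Lambda]. *)
Definition lam_mon y := lam (mx y).

Lemma lam_monD y z : cone y -> cone z -> lam_mon (y + z) = lam_mon y + lam_mon z.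
Proof.
move=> Hy Hz; have [_ <-] := lamM (mx_neq0 Hy) (mx_neq0 Hz).
rewrite -[RHS](lamZ (a := (qbc hq0 y z)^-1)) ?invr_neq0 ?bc_neq0 //; last first.
  by have [] := lamM (mx_neq0 Hy) (mx_neq0 Hz).
congr lam; apply: inj_iota; rewrite Hmx ?coneD // (iotaZ iota) (iotaM iota) !Hmx // monM.
by rewrite scalerA mulVf ?scale1r ?bc_neq0.
Qed.

Lemma lam_comm x y n : x != 0 -> y != 0 -> x * y = q ^ n *: (y * x) ->
  Lambda (lam x) (lam y) = n.
Proof.
move=> x0 y0 xy; apply: (lead_Lam hq (Hlam x0) (Hlam y0)).
by rewrite -!iota_sM xy iota_sZ.
Qed.

Lemma Lambda_lam_mon y z : cone y -> cone z -> Lambda (lam_mon y) (lam_mon z) = Lambda y z.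
Proof.
move=> Hy Hz; apply: lam_comm; rewrite ?mx_neq0 //; apply: inj_iota.
by rewrite (iotaZ iota) !(iotaM iota) !Hmx // mon_comm.
Qed.

(** Unit vectors may lie outside the cone; the differences of [nu0 + e9 k] and [nu0] replace them.
    The corresponding differences of images have Gram matrix [omega], so [Lambda_nondeg] applies. *)
Lemma lam_mon_perp d : (forall z, cone z -> Lambda d (lam_mon z) = 0) -> nul ls d.
Proof.
move=> Hd; apply/(nulP _ Hls).
apply: (Lambda_nondeg (g := fun k => lam_mon (nu0 + e9 k) - lam_mon nu0)) => [k l|k].
  rewrite !(LambdaBl, LambdaBr) !Lambda_lam_mon ?cone_nu0 ?cone_nu0e //.
  by rewrite -Lambda_ee !(LambdaDl, LambdaDr); lia.
by rewrite LambdaBr !Hd ?cone_nu0 ?cone_nu0e // subrr.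
Qed.

Lemma nul_Lam d y : nul ls d -> Lambda d y = 0.
Proof. by move=> /(nulP _ Hls) Hd; rewrite /Lambda big1 // => k _; rewrite Hd mul0r. Qed.

Lemma lam_mon_nul y z : cone y -> cone z -> nul ls (lam_mon y - lam_mon z) = nul ls (y - z).
Proof.
move=> Hy Hz; apply/idP/idP => H.
  apply/(nulP _ Hls) => k; rewrite -Lambda_delta.
  have E u : cone u -> Lambda (y - z) u = 0.
    by move=> Hu; rewrite LambdaBl -!(Lambda_lam_mon _ Hu) // -LambdaBl nul_Lam.
  have := E _ (cone_nu0e k); have := E _ cone_nu0; rewrite LambdaDr => ->.
  by rewrite add0r.
by apply: lam_mon_perp => u Hu; rewrite LambdaBl !Lambda_lam_mon // -LambdaBl nul_Lam.
Qed.

Definition rep (g : T) : R := lin mx g.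
Lemma iota_rep g : (forall y, coef g y != 0 -> cone y) -> iota (rep g) = g.
Proof.
move=> Hg; rewrite {2}(tga_expand g) /rep /lin (iota_sum iota).
apply: eq_big_seq => k; rewrite -coef_neq0 => /Hg Hk.
by rewrite (iotaZ iota) Hmx.
Qed.

Lemma s_lin g : iota (s (rep g)) = lin (fun y => iota (s (mx y))) g.
Proof.
rewrite /rep /lin rmorph_sum (iota_sum iota); apply: eq_bigr => k _.
exact: iota_sZ.
Qed.

(* The part of [g] in one class modulo the radical of [Lambda] is determined by
   its commutation with the [mx z], so that no cancellation can occur in it. *)
Lemma lam_class g y : g != 0 -> cone y ->
  (forall z, coef g z != 0 -> cone z /\ nul ls (z - y)) ->
  rep g != 0 /\ nul ls (lam (rep g) - lam_mon y).
Proof.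
move=> g0 Hy Hg; have ig : iota (rep g) = g by apply: iota_rep => z /Hg[].
have r0 : rep g != 0 by rewrite -iota_neq0 ig.
split=> //; apply: lam_mon_perp => z Hz; rewrite LambdaBl Lambda_lam_mon //.
rewrite (@lam_comm _ _ (Lambda y z)) ?subrr ?mx_neq0 //; apply: inj_iota.
rewrite (iotaZ iota) !(iotaM iota) ig Hmx // (tga_expand g).
rewrite mulr_suml mulr_sumr scaler_sumr; apply: eq_big_seq => k.
rewrite -coef_neq0 => /Hg[_ Hk]; rewrite tgaZl tgaZr mon_comm scalerA [RHS]scalerA mulrC.
by have := nul_Lam z Hk; rewrite LambdaBl => /eqP; rewrite subr_eq0 => /eqP ->.
Qed.

(** Choose an exponent [k] of [g] with [lam_mon k] maximal. By [lam_class] the image of the part of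
    [g] in the class of [k] has a leading exponent [th] congruent to [lam_mon k] modulo the radical.
    The other classes stay strictly below, so [th] survives and bounds [lam (rep g)] from below. *)
Lemma no_cancel g y : (forall z, coef g z != 0 -> cone z) -> coef g y != 0 ->
  rep g != 0 /\ ~~ pos ls (lam_mon y - lam (rep g)).
Proof.
move=> Hg gy; have ig := iota_rep Hg.
have g0 : g != 0 by apply: contra_neq gy => ->; rewrite coef0.
have r0 : rep g != 0 by rewrite -iota_neq0 ig.
split=> //; have sy : map lam_mon (supp g) != [::].
  by move: gy; rewrite coef_neq0; case: (supp g).
have [_ /mapP[k + ->] Hk] := lexi_max ls sy; rewrite -coef_neq0 => gk.
have {}Hk z : coef g z != 0 -> (lam_mon z == lam_mon k) || lexi ls (lam_mon k - lam_mon z).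
  by rewrite coef_neq0 => gz; apply/Hk/map_f.
pose P z := nul ls (z - k).
have [||r10 N1] := @lam_class (rest P g) k _ (Hg _ gk).
- apply: contra_neq gk => g10; have := coef_rest P g k; rewrite g10 coef0.
  by rewrite /P subrr (_ : nul ls 0) // /nul; apply/allP => v _; rewrite dot0r.
- by move=> z; rewrite coef_rest; case: ifP => [Pz /Hg //|]; rewrite eqxx.
have [L1 _] := Hlam r10; set th := lam (rep (rest P g)) in N1 L1.
(* For [z] outside the class, [lam_mon_nul] shows that [lam_mon k - lam_mon z] is not in the
   radical, hence positive for [pos ls]; so [th] exceeds every exponent of the image of [mx z]. *)
have c2 : coef (iota (s (rep (rest (predC P) g)))) th = 0.
  apply/eqP; apply: contraT; rewrite s_lin => /coef_lin_neq0[z].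
  rewrite coef_rest /=; case: ifP; last by rewrite eqxx.
  move=> /negP nPz gz Hz; case: nPz; rewrite /P -lam_mon_nul ?Hg //.
  have [_ /(_ _ Hz) Hth] := Hlam (mx_neq0 (Hg _ gz)); rewrite -/(lam_mon z) in Hth.
  have /orP[/eqP ->|Hz1] := Hk _ gz; first by rewrite subrr; apply/allP => v _; rewrite dot0r.
  apply: contraT => nn.
  have pk : pos ls (lam_mon k - lam_mon z).
    move: Hz1; rewrite lexiE => /orP[//|/andP[Hn _]].
    by rewrite -nulN opprB Hn in nn.
  have pth : pos ls (th - lam_mon z).
    by rewrite -(subrKA (lam_mon k)) addrC; apply: pos_nulD.
  case/orP: Hth => [/eqP E|]; first by rewrite E subrr pos0 in pth.
  move=> Hth; have : lexi ls (th - lam_mon z) by rewrite lexiE pth.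
  by move/lexiN; rewrite opprB Hth.
have Lg : coef (iota (s (rep g))) th != 0.
  have -> : iota (s (rep g)) = iota (s (rep (rest P g))) + iota (s (rep (rest (predC P) g))).
    by rewrite !s_lin -linD -restC.
  by rewrite coefD c2 addr0.
have [_ /(_ _ Lg) Hth] := Hlam r0.
apply/negP => py.
have pth : pos ls (lam_mon y - th).
  case/orP: Hth => [/eqP -> //|]; rewrite lexiE => /orP[H1|/andP[H1 _]].
    by rewrite -(subrKA (lam (rep g))) posD.
  by rewrite -(subrKA (lam (rep g))) pos_nulD.
have pk : pos ls (lam_mon y - lam_mon k) by rewrite -(subrKA th) pos_nulD.
case/orP: (Hk _ gy) => [/eqP E|]; first by rewrite E subrr pos0 in pk.
move=> H1; have : lexi ls (lam_mon y - lam_mon k) by rewrite lexiE pk.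
by move/lexiN; rewrite opprB H1.
Qed.

(* By [lam_class], the leading term of [s y] survives in [s P]. *)
Lemma lam_ge P y : cone y -> coef (iota P) y != 0 -> ~~ pos ls (lam_mon y - lam P).
Proof.
move=> Hy Py; have P0 : P != 0 by rewrite -iota_neq0; apply: contra_neq Py => ->; rewrite coef0.
(* Multiplication by a monomial of exponent [v] moves all exponents of [P] into the cone, where
   [no_cancel] applies; both leading exponents are shifted by [lam_mon v]. *)
have [v Hv Hs] := cone_shift (supp (iota P)).
have cE z : coef (iota P * m v) (z + v) = coef (iota P) z * qbc hq0 z v.
  rewrite {1}(tga_expand (iota P)) mulr_suml coef_sum.
  under eq_bigr => k _ do rewrite tgaZl monM !coefZ coef_mon.
  case: (boolP (z \in supp (iota P))) => zP.
    rewrite (bigD1_seq z) ?supp_uniq //= eqxx mulr1 big1 ?addr0 // => k kz.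
    by rewrite (inj_eq (addIr v)) (negbTE kz) !mulr0.
  rewrite big1_seq => [|k /= kP]; last first.
    rewrite (inj_eq (addIr v)); case: eqP => [kz|_]; last by rewrite !mulr0.
    by rewrite -kz kP in zP.
  by move: zP; rewrite -coef_neq0 negbK => /eqP ->; rewrite mul0r.
have Hg z : coef (iota P * m v) z != 0 -> cone z.
  rewrite -(subrK v z) cE mulf_eq0 negb_or => /andP[]; rewrite coef_neq0 => /Hs //.
have [|_] := @no_cancel (iota P * m v) (y + v) Hg.
  by rewrite cE mulf_neq0 ?bc_neq0.
have -> : rep (iota P * m v) = P * mx v.
  by apply: inj_iota; rewrite iota_rep // (iotaM iota) Hmx.
have [_ ->] := lamM P0 (mx_neq0 Hv); rewrite lam_monD // -/(lam_mon v).
by rewrite opprD addrACA subrr addr0.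
Qed.
End NoCancellation.

(** * Linear equations for the radical and the multidegree *)

Lemma sum9 (F : 'I_9 -> int) : \sum_k F k = F (o9 0) + F (o9 1) + F (o9 2) + F (o9 3)
  + F (o9 4) + F (o9 5) + F (o9 6) + F (o9 7) + F (o9 8).
Proof.
rewrite !big_ord_recr big_ord0 /= add0r.
by do ![congr (_ + _)]; congr F; apply: val_inj.
Qed.

Lemma dot_row9 (f : nat -> int) (x : E9) : dot (\row_(k < 9) f k) x =
  f 0%N * x 0 (o9 0) + f 1%N * x 0 (o9 1) + f 2%N * x 0 (o9 2) + f 3%N * x 0 (o9 3)
  + f 4%N * x 0 (o9 4) + f 5%N * x 0 (o9 5) + f 6%N * x 0 (o9 6)
  + f 7%N * x 0 (o9 7) + f 8%N * x 0 (o9 8).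
Proof. by rewrite /dot sum9 !mxE. Qed.

Lemma dot_mvec9 r s (x : E9) : let f k := r (k %/ 3)%N + s (k %% 3)%N in dot (mvec r s) x =
  f 0%N * x 0 (o9 0) + f 1%N * x 0 (o9 1) + f 2%N * x 0 (o9 2) + f 3%N * x 0 (o9 3)
  + f 4%N * x 0 (o9 4) + f 5%N * x 0 (o9 5) + f 6%N * x 0 (o9 6)
  + f 7%N * x 0 (o9 7) + f 8%N * x 0 (o9 8).
Proof. exact: (dot_row9 (fun k => r (k %/ 3)%N + s (k %% 3)%N)). Qed.

Definition weight_forms : seq E9 := [seq omega_col l | l : 'I_9].
Lemma nul_weight_forms x : nul weight_forms x = [forall k, weight x k == 0].
Proof.
apply/allP/forallP => [H k|H v /mapP[k _ ->]]; last exact: H.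
by apply: H; apply: image_f.
Qed.
Lemma nul_opp_weight_forms x : nul (map -%R weight_forms) x = [forall k, weight x k == 0].
Proof. by rewrite nul_opp nul_weight_forms. Qed.

Lemma weight_coords (x : E9) : nul weight_forms x ->
  [/\ - x 0 (o9 1) - x 0 (o9 2) - x 0 (o9 3) - x 0 (o9 6) = 0,
      x 0 (o9 0) - x 0 (o9 2) - x 0 (o9 4) - x 0 (o9 7) = 0,
      x 0 (o9 0) + x 0 (o9 1) - x 0 (o9 5) - x 0 (o9 8) = 0,
      x 0 (o9 0) - x 0 (o9 4) - x 0 (o9 5) - x 0 (o9 6) = 0 &
  [/\ x 0 (o9 1) + x 0 (o9 3) - x 0 (o9 5) - x 0 (o9 7) = 0,
      x 0 (o9 2) + x 0 (o9 3) + x 0 (o9 4) - x 0 (o9 8) = 0,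
      x 0 (o9 0) + x 0 (o9 3) - x 0 (o9 7) - x 0 (o9 8) = 0,
      x 0 (o9 1) + x 0 (o9 4) + x 0 (o9 6) - x 0 (o9 8) = 0 &
      x 0 (o9 2) + x 0 (o9 5) + x 0 (o9 6) + x 0 (o9 7) = 0]].
Proof.
rewrite nul_weight_forms => /forallP H.
have {}H k : weight x k = 0 by apply/eqP.
have HE (k : 'I_9) := dot_row9 (fun j => omega j k) x.
have := HE (o9 0); have := HE (o9 1); have := HE (o9 2); have := HE (o9 3).
have := HE (o9 4); have := HE (o9 5); have := HE (o9 6); have := HE (o9 7).
have := HE (o9 8); rewrite -!/(weight x _) !H {H HE}.
move: (x 0 (o9 0)) (x 0 (o9 1)) (x 0 (o9 2)) (x 0 (o9 3)) (x 0 (o9 4))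
  (x 0 (o9 5)) (x 0 (o9 6)) (x 0 (o9 7)) (x 0 (o9 8)).
move=> x0 x1 x2 x3 x4 x5 x6 x7 x8; rewrite /omega /=.
by move=> *; split; [| | | |split]; lia.
Qed.

Lemma mdeg_coords (x : E9) : nul mdeg_forms x ->
  [/\ x 0 (o9 0) + x 0 (o9 1) + x 0 (o9 2) = 0, x 0 (o9 3) + x 0 (o9 4) + x 0 (o9 5) = 0,
      x 0 (o9 6) + x 0 (o9 7) + x 0 (o9 8) = 0 &
  [/\ x 0 (o9 0) + x 0 (o9 3) + x 0 (o9 6) = 0, x 0 (o9 1) + x 0 (o9 4) + x 0 (o9 7) = 0 &
      x 0 (o9 2) + x 0 (o9 5) + x 0 (o9 8) = 0]].
Proof.
move=> /and5P[/eqP H1 /eqP H2 /eqP H3 /eqP H4 /and3P[/eqP H5 /eqP H6 _]].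
move: H1 H2 H3 H4 H5 H6; rewrite !dot_mvec9 /=.
move: (x 0 (o9 0)) (x 0 (o9 1)) (x 0 (o9 2)) (x 0 (o9 3)) (x 0 (o9 4))
  (x 0 (o9 5)) (x 0 (o9 6)) (x 0 (o9 7)) (x 0 (o9 8)).
move=> x0 x1 x2 x3 x4 x5 x6 x7 x8 *.
by split; [| | |split]; lia.
Qed.

(** This supplies the isolation needed in [isolated_nonneg] for elements all of whose exponents have
    the same weight. *)
Lemma radical_mdeg d : nul weight_forms d -> nul mdeg_forms d -> d = 0.
Proof.
move=> /weight_coords[? ? ? ? [? ? ? ? ?]] /mdeg_coords[? ? ? [? ? ?]].
apply/rowP; apply: ord9_ind; rewrite coE; lia.
Qed.

(** * Rigidity of automorphisms close to the identity *)

Section Rigidity.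
Variables (K : fieldType) (q : K) (hq0 : q != 0).
Hypothesis hq : forall n : nat, (0 < n)%N -> q ^+ n != 1.
Variables (R : algType K) (Y : 'I_3 -> 'I_3 -> R) (hR : is_OqM3 q Y).
Local Notation T := (tga (qbc hq0)).
Local Notation m := (mon (tga_impl (qbc hq0))).
Local Notation x_ := (gen Y).
Variable iota : {lrmorphism R -> T}.
Hypothesis Hiota : forall k, iota (x_ k) = tgen hq0 k.
Let inj_iota : injective iota := iota_inj hR Hiota.
Local Notation fil := (fil iota).

Lemma mx_exists : exists mx : E9 -> R, forall y, cone y -> iota (mx y) = m y.
Proof.
suff /choice[f Hf] : forall z, exists w, cone z -> iota w = m z by exists f.
move=> z; case: (boolP (cone z)) => [/(cone_hit Hiota)[w Hw]|_]; first by exists w.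
by exists 0.
Qed.

(** Unipotence of [u] at [x], relative to a lower bound [d] for the degree so that it passes to
    products. *)
Definition near (u : R -> R) d x := fil d x /\ fil d.+1 (u x - x).

Lemma nearM (u : {lrmorphism R -> R}) d d' x y :
  near u d x -> near u d' y -> near u (d + d') (x * y).
Proof.
move=> [Hx Hux] [Hy Huy]; split; first exact: filM.
rewrite rmorphM (_ : u x * u y - x * y = (u x - x) * u y + x * (u y - y)); last first.
  by rewrite mulrBl mulrBr addrA subrK.
apply: filD; last by rewrite -addnS; apply: filM.
rewrite -addSn; apply: filM => //; rewrite -(subrK y (u y)); apply: filD => //.
exact: filW Huy.
Qed.
Lemma near_lin (u : {lrmorphism R -> R}) a d x y :
  near u d x -> near u d y -> near u d (a *: x + y).
Proof.
move=> [Hx Hux] [Hy Huy]; split; first exact: fil_lin.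
rewrite linearP opprD addrACA -scalerBr; exact: fil_lin.
Qed.
Lemma nearB (u : {lrmorphism R -> R}) a d x y :
  near u d x -> near u d y -> near u d (x - a *: y).
Proof. by move=> Hx Hy; rewrite addrC -scaleNr; apply: near_lin. Qed.

Section Pair.
Variables s t : {lrmorphism R -> R}.
Hypotheses (st : forall x, s (t x) = x) (ts : forall x, t (s x) = x).

Lemma leading_coef u d x mu : iota x = m mu -> dot degf mu = d%:Z -> near u d x ->
  coef (iota (u x)) mu = 1.
Proof.
move=> Hx Hmu [_ Hu]; rewrite -(subrK x (u x)) (iotaD iota) coefD Hx coef_mon eqxx.
suff -> : coef (iota (u x - x)) mu = 0 by rewrite add0r.
apply/eqP; apply: contraT => /Hu; rewrite Hmu; lia.
Qed.

(** As [mu] occurs in [t x], [lam_ge] compares the leading exponent of [s x] with that of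
    [s (t x) = x], which is [mu]. *)
Lemma rigid_half ls x mu d : (forall x, nul ls x = [forall k, weight x k == 0]) ->
  iota x = m mu -> cone mu -> dot degf mu = d%:Z -> near t d x ->
  forall y, coef (iota (s x)) y != 0 -> ~~ pos ls (y - mu).
Proof.
move=> Hls Hx Hmu Hd Ht y Hy.
have inj_s : injective s by apply: can_inj ts.
have [mx Hmx] : exists mx : E9 -> R, forall y, cone y -> iota (mx y) = m y.
  exact: mx_exists.
have [lam Hlam] : exists lam : R -> E9, forall x, x != 0 -> lead ls (iota (s x)) (lam x).
  suff /choice[f Hf] : forall z, exists w, z != 0 -> lead ls (iota (s z)) w by exists f.
  move=> z.
  case: (eqVneq z 0) => [->|z0]; first by exists 0.
  have [|w Hw] := lead_exists ls (f := iota (s z)); last by exists w.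
  by rewrite -(iota0 iota) (inj_eq inj_iota) -(rmorph0 s) (inj_eq inj_s).
have x0 : x != 0.
  by rewrite -(inj_eq inj_iota) (iota0 iota) Hx; apply: (lead_neq0 (lead_mon _ ls mu)).
have tx0 : t x != 0 by apply: contra_neq x0 => tx0; rewrite -(st x) tx0 rmorph0.
have Htx : coef (iota (t x)) mu != 0 by rewrite (leading_coef Hx Hd Ht) oner_eq0.
have := lam_ge hq inj_iota Hls Hmx Hlam Hmu Htx.
have -> : lam (t x) = mu.
  apply: (lead_uniq (Hlam _ tx0)); rewrite st Hx; exact: lead_mon.
have -> : lam_mon mx lam mu = lam x by congr lam; apply: inj_iota; rewrite Hmx.
apply: contra => Hpos; have [_ /(_ _ Hy)] := Hlam _ x0.
case/orP => [/eqP <- //|]; rewrite lexiE => /orP[H|/andP[H _]].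
  by rewrite -(subrKA y) posD.
by rewrite -(subrKA y) addrC pos_nulD.
Qed.

(** The order and its opposite bound the exponents of [s x] from both sides. *)
Lemma rigid x mu d : iota x = m mu -> cone mu -> dot degf mu = d%:Z -> near t d x ->
  forall y, coef (iota (s x)) y != 0 -> nul weight_forms (y - mu).
Proof.
move=> Hx Hmu Hd Ht y Hy.
have N1 := rigid_half nul_weight_forms Hx Hmu Hd Ht Hy.
have N2 := rigid_half nul_opp_weight_forms Hx Hmu Hd Ht Hy.
by rewrite pos_opp in N2; have := pos_total weight_forms (y - mu); rewrite (negbTE N1) (negbTE N2).
Qed.
End Pair.

Definition exD : E9 := expo [:: 1; 0; 0; 0; 1; 0; 0; 0; 1].

(** The exponents of [t x] are of the form [mu + exD *+ i], so [t x] is, up to a scalar, [x * h]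
    with [h] a polynomial in the determinant. Then [s x * s h] is a multiple of [x]. Top degrees
    add, and that of [s h] is nonnegative, so [s x] has degree at most [d]; but [s x - x] has only
    terms of degree above [d]. *)
Lemma rigid_fix (s t : {lrmorphism R -> R}) x mu d :
  (forall x, s (t x) = x) -> (forall x, t (s x) = x) ->
  iota x = m mu -> cone mu -> dot degf mu = d%:Z -> near s d x -> near t d x ->
  (forall y, nul weight_forms (y - mu) -> nonneg y -> exists i : nat, y = mu + exD *+ i) ->
  s x = x.
Proof.
move=> st ts Hx Hmu Hd Hs Ht Hrad.
have Htx y : coef (iota (t x)) y != 0 -> exists i : nat, y = mu + exD *+ i.
  move=> Hy; have Hw := rigid ts st Hx Hmu Hd Hs.
  (* Two exponents of [t x] with the same multidegree differ by a radical vector of multidegree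
     zero, so every exponent is isolated. *)
  apply: (Hrad _ (Hw _ Hy)); apply: (isolated_nonneg hR Hiota Hy) => z /Hw zw Hz.
  have Hzy : nul weight_forms (z - y) by rewrite -(subrKA mu) nulD // -nulN opprB Hw.
  by apply/eqP; rewrite -subr_eq0 (radical_mdeg Hzy Hz).
have Dcone i : cone (exD *+ i) by apply: coneX; rewrite /cone !coE.
pose g : T := m (- mu) * iota (t x).
have Hg y : coef g y != 0 -> cone y.
  move=> /tga_coefM_neq0[u [v [-> + /Htx[i ->]]]].
  by rewrite coef_mon_neq0 => /eqP <-; rewrite addKr.
have [mx Hmx] : exists mx : E9 -> R, forall y, cone y -> iota (mx y) = m y.
  exact: mx_exists.
pose h := rep mx g; have ih : iota h = g := iota_rep Hmx Hg.
have xh : x * h = qbc hq0 mu (- mu) *: t x.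
  apply: inj_iota; rewrite (iotaM iota) (iotaZ iota) ih Hx /g mulrA monM subrr mon0.
  by rewrite tgaZl mul1r.
have x0 : iota x != 0 by rewrite Hx; apply: (lead_neq0 (lead_mon _ [::] mu)).
have shx : s x * s h = qbc hq0 mu (- mu) *: x.
  have <- : s (x * h) = s x * s h by rewrite rmorphM.
  by rewrite xh linearZ /= st.
have : iota (s x) * iota (s h) = qbc hq0 mu (- mu) *: m mu.
  by rewrite -(iotaM iota) shx (iotaZ iota) Hx.
move=> E.
have Lm := leadZ (bc_neq0 (qbc hq0) mu (- mu)) (lead_mon (qbc hq0) [:: degf] mu).
have [sx0 sh0] : iota (s x) != 0 /\ iota (s h) != 0.
  by apply/andP; rewrite -negb_or -tga_mulf_eq0 E (lead_neq0 Lm).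
have [l1 L1] := lead_exists [:: degf] sx0; have [l2 L2] := lead_exists [:: degf] sh0.
have El : mu = l1 + l2 by apply: (lead_uniq Lm); rewrite -E; apply: leadM.
have d2 : 0 <= dot degf l2 by apply: (fil0 hR Hiota (x := s h)); case: L2.
have Hsx y : coef (iota (s x)) y != 0 -> dot degf y <= d%:Z.
  move=> Hy; have [_ /(_ _ Hy)] := L1; rewrite -Hd El dotDr.
  case/orP => [/eqP ->|]; first by lia.
  by rewrite lexiE => /orP[/=|/andP[/=]]; rewrite dotBr; lia.
apply/eqP; rewrite -subr_eq0 -(inj_eq inj_iota) (iota0 iota); apply/eqP/tgaP => y.
rewrite coef0; apply/eqP; apply: contraT => Hy.
have [_ /(_ _ Hy) Hdy] := Hs; move: Hy; rewrite (iotaB iota) coefB Hx coef_mon.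
case: (eqVneq mu y) => [Ey|_]; first by move: Hdy; rewrite -Ey Hd; lia.
by rewrite subr0 => /Hsx; lia.
Qed.
End Rigidity.

Section LRMorphism.
Variables (K : fieldType) (A B : algType K) (u : {lrmorphism A -> B}).
Lemma lrB x y : u (x - y) = u x - u y. Proof. exact: rmorphB. Qed.
Lemma lrD x y : u (x + y) = u x + u y. Proof. exact: rmorphD. Qed.
Lemma lrM x y : u (x * y) = u x * u y. Proof. exact: rmorphM. Qed.
Lemma lrZ a x : u (a *: x) = a *: u x. Proof. exact: linearZ. Qed.
End LRMorphism.

Lemma tgen_neq0 (K : fieldType) (q : K) (hq0 : q != 0) (k : 'I_9) : tgen hq0 k != 0.
Proof. exact: (lead_neq0 (lead_tgen hq0 k (ls := [::]) _)). Qed.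

(** * Unipotent automorphisms on the lower right entries *)

Section UnipotentHalf.
Variables (K : fieldType) (q : K) (hq0 : q != 0).
Hypothesis hq : forall n : nat, (0 < n)%N -> q ^+ n != 1.
Variables (R : algType K) (Y : 'I_3 -> 'I_3 -> R) (hR : is_OqM3 q Y).
Local Notation x_ := (gen Y).
Variables s t : {lrmorphism R -> R}.
Hypotheses (st : forall x, s (t x) = x) (ts : forall x, t (s x) = x).
Hypothesis us : forall k, sqr x_ (s (x_ k) - x_ k).
Hypothesis ut : forall k, sqr x_ (t (x_ k) - x_ k).

Lemma unip_half : [/\ s (x_ (o9 8)) = x_ (o9 8), s (x_ (o9 7)) = x_ (o9 7),
  s (x_ (o9 5)) = x_ (o9 5) & s (x_ (o9 4)) = x_ (o9 4)].
Proof.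
have [iota Hiota] := embedding_exists hq0 hR.
have nX (u : {lrmorphism R -> R}) k : sqr x_ (u (x_ k) - x_ k) -> near iota u 1 (x_ k).
  by move=> Hu; split; [exact: (filX Hiota) | exact: (fil_sqr hR Hiota Hu)].
have nd (u : {lrmorphism R -> R}) : (forall k, sqr x_ (u (x_ k) - x_ k)) ->
    near iota u 2 (mn_d q x_).
  move=> Hu; by apply: nearB; apply: (nearM (d := 1) (d' := 1)); apply: nX.
have fixX k mu : iota (x_ k) = mon (tga_impl (qbc hq0)) mu -> cone mu -> dot degf mu = 1 ->
  (forall y, nul weight_forms (y - mu) -> nonneg y -> exists i : nat, y = mu + exD *+ i) ->
  s (x_ k) = x_ k.
  move=> Hmu Cmu Dmu; apply: (rigid_fix hq hR Hiota st ts Hmu Cmu Dmu); exact: nX.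
have [Hd _ _ _] := iota_minors Hiota.
(* The first weight equation and nonnegativity force [y] to vanish at the indices 1, 2, 3 and 6; the
   remaining equations leave only multiples of [exD], counted by the coordinate 0. *)
have rad (mu : E9) : mu 0 (o9 6) = 0 -> mu 0 (o9 2) = 0 -> mu 0 (o9 1) = 0 -> mu 0 (o9 3) = 0 ->
  mu 0 (o9 0) = 0 ->
  forall y : E9, nul weight_forms (y - mu) -> nonneg y -> exists i : nat, y = mu + exD *+ i.
  move=> m6 m2 m1 m3 m0 y /weight_coords; rewrite !coE m6 m2 m1 m3 m0.
  move=> [? ? ? ? [? ? ? ? ?]] y0; exists `|y 0%R (o9 0)|%N.
  have := y0 (o9 0); have := y0 (o9 1); have := y0 (o9 2); have := y0 (o9 3).
  have := y0 (o9 6) => *.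
  apply/rowP; apply: ord9_ind; rewrite !coE /= ?m6 ?m2 ?m1 ?m3 ?m0; lia.
have s8 : s (x_ (o9 8)) = x_ (o9 8).
  apply: (fixX _ (expo [:: 0; 0; 0; 0; 0; 0; 0; 0; 1])).
  - by rewrite Hiota /= tgen_mon.
  - by rewrite /cone !coE.
  - by rewrite (dot_mvec9 (fun=> 1) (fun=> 0)) !coE.
  - by apply: rad; rewrite coE.
have s7 : s (x_ (o9 7)) = x_ (o9 7).
  apply: (fixX _ (expo [:: 0; 0; 0; 0; 0; 0; 0; 1; 0])).
  - by rewrite Hiota /= tgen_mon.
  - by rewrite /cone !coE.
  - by rewrite (dot_mvec9 (fun=> 1) (fun=> 0)) !coE.
  - by apply: rad; rewrite coE.
have s5 : s (x_ (o9 5)) = x_ (o9 5).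
  apply: (fixX _ (expo [:: 0; 0; 0; 0; 0; 1; 0; 0; 0])).
  - by rewrite Hiota /= tgen_mon.
  - by rewrite /cone !coE.
  - by rewrite (dot_mvec9 (fun=> 1) (fun=> 0)) !coE.
  - by apply: rad; rewrite coE.
have sd : s (mn_d q x_) = mn_d q x_.
  apply: (rigid_fix hq hR Hiota st ts (d := 2) Hd).
  - by rewrite /cone !coE.
  - by rewrite (dot_mvec9 (fun=> 1) (fun=> 0)) !coE.
  - exact: nd.
  - exact: nd.
  - by apply: rad; rewrite coE.
split=> //; have inj_iota := iota_inj hR Hiota.
(* The other three entries of the minor are fixed, so the change of entry 4 is annihilated by entry
   8, in a domain. *)
move: sd; rewrite /mn_d lrB lrZ !lrM s8 s7 s5.
move/addIr/eqP; rewrite -subr_eq0 -mulrBl -(inj_eq inj_iota) (iota0 iota) (iotaM iota).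
rewrite tga_mulf_eq0 [X in _ || X](_ : _ = false) ?orbF; last first.
  by rewrite Hiota; apply/negbTE/tgen_neq0.
by rewrite -(iota0 iota) (inj_eq inj_iota) subr_eq0 => /eqP.
Qed.
End UnipotentHalf.

(** * Reversal of rows and columns *)

Section Reverse.
Variables (K : fieldType).
Definition rev2 (B : Type) (Y : 'I_3 -> 'I_3 -> B) i a := Y (rev_ord i) (rev_ord a).

Lemma rev_ltn (i j : 'I_3) : (rev_ord i < rev_ord j)%N = (j < i)%N.
Proof. by case: i j => [i Hi] [j Hj] /=; lia. Qed.

Lemma qM3_rev (q : K) (hq0 : q != 0) (B : algType K) (Y : 'I_3 -> 'I_3 -> B) :
  qM3_rel q Y -> qM3_rel q^-1 (rev2 Y).
Proof.
move=> [H1 [H2 [H3 H4]]]; rewrite /qM3_rel /rev2 invrK; split; [|split; [|split]].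
- move=> i a b ab; have := H1 (rev_ord i) (rev_ord b) (rev_ord a).
  by rewrite rev_ltn => -> //; rewrite scalerA divff // scale1r.
- move=> i j a ij; have := H2 (rev_ord j) (rev_ord i) (rev_ord a).
  by rewrite rev_ltn => -> //; rewrite scalerA divff // scale1r.
- move=> i j a b ij ba; have := H3 (rev_ord j) (rev_ord i) (rev_ord b) (rev_ord a).
  by rewrite !rev_ltn => ->.
- move=> i j a b ij ab; have := H4 (rev_ord j) (rev_ord i) (rev_ord b) (rev_ord a).
  rewrite !rev_ltn => -> //.
  (* The factors of the correction term appear in the opposite order; they commute. *)
  have := H3 (rev_ord j) (rev_ord i) (rev_ord a) (rev_ord b).
  rewrite !rev_ltn => -> //.
  by rewrite -[q^-1 - q]opprB scaleNr opprK subrK.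
Qed.

Lemma is_OqM3_rev (q : K) (hq0 : q != 0) (R : algType K) (Y : 'I_3 -> 'I_3 -> R) :
  is_OqM3 q Y -> is_OqM3 q^-1 (rev2 Y).
Proof.
move=> [H HU]; split; first exact: qM3_rev.
move=> B Z /(qM3_rev (invr_neq0 hq0)); rewrite invrK => /HU[[f Hf] Hu].
split; first by exists f => i a; rewrite Hf /rev2 !rev_ordK.
move=> g h gh; apply: Hu => i a; have := gh (rev_ord i) (rev_ord a).
by rewrite /rev2 !rev_ordK.
Qed.

Lemma gen_rev (R : algType K) (Y : 'I_3 -> 'I_3 -> R) k : gen (rev2 Y) k = gen Y (rev_ord k).
Proof.
rewrite /gen /rev2; congr Y; apply: val_inj; case: k => k k9 /=; lia.
Qed.

Lemma sqr_rev (R : algType K) (Y : 'I_3 -> 'I_3 -> R) x : sqr (gen Y) x -> sqr (gen (rev2 Y)) x.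
Proof.
move=> [z ->]; exists (fun k l => z (rev_ord k) (rev_ord l)).
rewrite (reindex_inj rev_ord_inj); apply: eq_bigr => k _.
rewrite (reindex_inj rev_ord_inj); apply: eq_bigr => l _.
by rewrite !gen_rev.
Qed.
End Reverse.

(** * Unipotent automorphisms are trivial *)

Section Unipotent.
Variables (K : fieldType) (q : K) (hq0 : q != 0).
Hypothesis hq : forall n : nat, (0 < n)%N -> q ^+ n != 1.
Variables (R : algType K) (Y : 'I_3 -> 'I_3 -> R) (hR : is_OqM3 q Y).
Local Notation x_ := (gen Y).

Lemma q_q1 : q - q^-1 != 0.
Proof.
rewrite subr_eq0; apply: contra (hq (isT : 0 < 2)%N) => /eqP qq.
by rewrite expr2 {2}qq divff.
Qed.

Lemma mul_eq0_cases (x y : R) : x * y = 0 -> x = 0 \/ y = 0.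
Proof.
have [iota Hiota] := embedding_exists hq0 hR; have inj_iota := iota_inj hR Hiota.
move=> xy; have : iota x * iota y == 0 by rewrite -(iotaM iota) xy (iota0 iota).
rewrite tga_mulf_eq0 -(iota0 iota) !(inj_eq inj_iota).
by case/orP => /eqP; [left|right].
Qed.

Lemma gen_neq0 k : x_ k != 0.
Proof.
have [iota Hiota] := embedding_exists hq0 hR; have inj_iota := iota_inj hR Hiota.
rewrite -(inj_eq inj_iota) (iota0 iota) Hiota.
exact: tgen_neq0.
Qed.

Variables s t : {lrmorphism R -> R}.
Hypotheses (st : forall x, s (t x) = x) (ts : forall x, t (s x) = x).
Hypothesis us : forall k, sqr x_ (s (x_ k) - x_ k).
Hypothesis ut : forall k, sqr x_ (t (x_ k) - x_ k).

Lemma unip_id k : s (x_ k) = x_ k.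
Proof.
have [s8 s7 s5 s4] := unip_half hq0 hq hR st ts us ut.
have hqV n : (0 < n)%N -> q^-1 ^+ n != 1.
  by move=> /hq; rewrite exprVn invr_eq1.
have us' k' : sqr (gen (rev2 Y)) (s (gen (rev2 Y) k') - gen (rev2 Y) k').
  by rewrite gen_rev; apply: sqr_rev.
have ut' k' : sqr (gen (rev2 Y)) (t (gen (rev2 Y) k') - gen (rev2 Y) k').
  by rewrite gen_rev; apply: sqr_rev.
have [] := unip_half (invr_neq0 hq0) hqV (is_OqM3_rev hq0 hR) st ts us' ut'.
rewrite !gen_rev => s0 s1 s3 _.
have E0 : rev_ord (o9 8) = o9 0 by exact: val_inj.
have E1 : rev_ord (o9 7) = o9 1 by exact: val_inj.
have E3 : rev_ord (o9 5) = o9 3 by exact: val_inj.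
rewrite E0 in s0; rewrite E1 in s1; rewrite E3 in s3.
have XR := gen_rel9 hR.
have q1 : - (q - q^-1) != 0 by rewrite oppr_eq0; exact: q_q1.
(* The correction terms of these relations are the products of the entries 2, 4 and 4, 6; everything
   else in them is already fixed. *)
have rel15 := XR (o9 5) (o9 1) isT; have rel37 := XR (o9 7) (o9 3) isT.
have [N1 N2] : NW (o9 1) (o9 5) /\ NW (o9 3) (o9 7) by [].
rewrite N1 in rel15; rewrite N2 in rel37.
have F1 : ix (rw (o9 1)) (cl (o9 5)) = o9 2 by exact: val_inj.
have F2 : ix (rw (o9 5)) (cl (o9 1)) = o9 4 by exact: val_inj.
have F3 : ix (rw (o9 3)) (cl (o9 7)) = o9 4 by exact: val_inj.
have F4 : ix (rw (o9 7)) (cl (o9 3)) = o9 6 by exact: val_inj.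
rewrite F1 F2 in rel15; rewrite F3 F4 in rel37.
have s2 : s (x_ (o9 2)) = x_ (o9 2).
  have := congr1 s rel15; rewrite lrB !lrZ !lrM s1 s5 s4 rel15.
  move/addrI/oppr_inj/(scalerI (q_q1)) => /eqP; rewrite -subr_eq0 -mulrBl => /eqP.
  case/mul_eq0_cases => /eqP; last by rewrite (negbTE (gen_neq0 _)).
  by rewrite subr_eq0 => /eqP.
have s6 : s (x_ (o9 6)) = x_ (o9 6).
  have := congr1 s rel37; rewrite lrB !lrZ !lrM s3 s7 s4 rel37.
  move/addrI/oppr_inj/(scalerI (q_q1)) => /eqP; rewrite -subr_eq0 -mulrBr => /eqP.
  case/mul_eq0_cases => /eqP; first by rewrite (negbTE (gen_neq0 _)).
  by rewrite subr_eq0 => /eqP.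
by move: k; apply: ord9_ind.
Qed.
End Unipotent.

Lemma hom_lin (K : fieldType) (n : nat) (c : bichar K 'rV[int]_n) v d a (f g : tga c) :
  hom v d f -> hom v d g -> hom v d (a *: f + g).
Proof.
move=> Hf Hg x; rewrite coefD coefZ; case: (eqVneq (coef f x) 0) => [->|/Hf //].
by rewrite mulr0 add0r => /Hg.
Qed.

Lemma omega_NW (k l : 'I_9) : omega k l != 0 -> ~~ NW k l && ~~ NW l k.
Proof.
rewrite omegaE /NW; case: (eqVneq (rw k) (rw l)) => [->|_]; first by rewrite ltnn.
by case: (eqVneq (cl k) (cl l)) => [->|_]; rewrite ?eqxx // ltnn !andbF.
Qed.

Lemma rel9_comm (K : fieldType) (q : K) (hq0 : q != 0) (B : algType K) (Z : 'I_9 -> B)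
  k l : rel9 q Z -> ~~ NW k l -> ~~ NW l k -> Z k * Z l = q ^ omega k l *: (Z l * Z k).
Proof.
move=> HZ Nkl Nlk; case: (ltngtP k l) => [kl|lk|/val_inj ->].
- have := HZ l k kl; rewrite (negbTE Nkl) subr0 omegaN => ->.
  by rewrite scalerA -expfzDr // subrr expr0z scale1r.
- by have := HZ k l lk; rewrite (negbTE Nlk) subr0.
- by have -> : omega l l = 0; [have := omegaN l l; lia | rewrite expr0z scale1r].
Qed.

Lemma zmod_aux (V : zmodType) (a a' b b' z : V) :
  z - (b - b') = - (a - a' - z - (a - b) + (a' - b')).
Proof.
have -> : a - a' - z - (a - b) = b - z - a'.
  by rewrite opprB addrC -[a - a' - z]addrA subrKA addrA addrAC.
by rewrite subrKA !opprB addrCA addrC.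
Qed.

(** * The linear part of an automorphism *)

Section LinearPart.
Variables (K : fieldType) (q : K) (hq0 : q != 0).
Hypothesis hq : forall n : nat, (0 < n)%N -> q ^+ n != 1.
Variables (R : algType K) (Y : 'I_3 -> 'I_3 -> R) (hR : is_OqM3 q Y).
Local Notation T := (tga (qbc hq0)).
Local Notation m := (mon (tga_impl (qbc hq0))).
Local Notation x_ := (gen Y).
Variable iota : {lrmorphism R -> T}.
Hypothesis Hiota : forall k, iota (x_ k) = tgen hq0 k.
Let inj_iota : injective iota := iota_inj hR Hiota.
Local Notation fil := (fil iota).

Lemma gen_comm k l : ~~ NW k l -> ~~ NW l k -> x_ k * x_ l = q ^ omega k l *: (x_ l * x_ k).
Proof. exact: (rel9_comm hq0 (gen_rel9 hR)). Qed.

(** For the order by lowest degree a nonzero constant term would lead. The image q-commutes with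
    that of a neighbour [l] with [omega k l] nonzero, and [lead_Lam] would give
    [Lambda 0 z = omega k l]. *)
Lemma const0 (u : {lrmorphism R -> R}) k : injective u -> coef (iota (u (x_ k))) 0 = 0.
Proof.
move=> inj_u; apply/eqP; apply: contraT => H0.
have [l Hl] : exists l : 'I_9, omega k l != 0.
  move: k {H0}; apply: ord9_ind; first [by exists (o9 1) | by exists (o9 0)
    | by exists (o9 4) | by exists (o9 3) | by exists (o9 7) | by exists (o9 6)].
have L0 : lead [:: - degf] (iota (u (x_ k))) 0.
  split=> // y Hy; have := fil0 hR Hiota Hy; rewrite le_eqVlt => /predU1P[E|Hd].
    by rewrite (dot_dg0 hR Hiota Hy) ?eqxx.
  by apply/orP; right; rewrite lexiE /= sub0r dotNl dotNr opprK Hd.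
have [|z Lz] := lead_exists [:: - degf] (f := iota (u (x_ l))).
  rewrite -(iota0 iota) (inj_eq inj_iota) -(rmorph0 u) (inj_eq inj_u).
  exact: (gen_neq0 hq0 hR).
have /andP[N1 N2] := omega_NW Hl.
have := lead_Lam hq (n := omega k l) L0 Lz.
rewrite -!(iotaM iota) -!lrM gen_comm // lrZ (iotaZ iota) => /(_ erefl) E.
by move: Hl; rewrite -E /Lambda big1 ?eqxx // => j _; rewrite /weight dot0r mul0r.
Qed.

Definition lincoef (u : R -> R) k j := coef (iota (u (x_ k))) (e9 j).
Definition linpart (u : R -> R) k := \sum_j lincoef u k j *: x_ j.

Lemma linpart_sqr (u : {lrmorphism R -> R}) k : injective u -> sqr x_ (u (x_ k) - linpart u k).
Proof.
move=> /(const0 k); have [c [l [h [Hh E]]]] := gen_decomp hR (u (x_ k)).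
have [Ec El] := coef_dec hR Hiota Hh E; rewrite Ec => c0; rewrite {1}E c0 scale0r add0r.
have El' j : lincoef u k j = l j := El j.
have -> : linpart u k = \sum_j l j *: x_ j by apply: eq_bigr => j _; rewrite El'.
by rewrite [_ + h]addrC addrK.
Qed.

Lemma fil_linpart u k : fil 1 (linpart u k).
Proof. by apply: fil_sum => j; apply: filZ; apply: filX. Qed.
Lemma fil1_aut (u : {lrmorphism R -> R}) k : injective u -> fil 1 (u (x_ k)).
Proof.
move=> iu; rewrite -(subrK (linpart u k) (u (x_ k))); apply: filD; last exact: fil_linpart.
by apply: (filW (d' := 2)) => //; exact: (fil_sqr hR Hiota (linpart_sqr k iu)).
Qed.
Lemma aut_sqr (u : {lrmorphism R -> R}) x : injective u -> sqr x_ x -> sqr x_ (u x).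
Proof.
move=> iu [z ->]; apply: (sqr_fil hR Hiota); rewrite rmorph_sum.
apply: fil_sum => k; rewrite rmorph_sum; apply: fil_sum => l.
rewrite !rmorphM -[2%N]addn0; apply: filM; last exact: (fil0 hR Hiota).
by rewrite -[2%N]/(1 + 1)%N; apply: filM; apply: fil1_aut.
Qed.

Lemma coef_linpart u k j : coef (iota (linpart u k)) (e9 j) = lincoef u k j.
Proof.
rewrite (iota_sum iota) coef_sum (bigD1 j) //= big1 => [|i ij];
  rewrite (iotaZ iota) coefZ Hiota coef_tgen_ee ?eqxx ?mulr1 ?addr0 //.
by rewrite (negbTE ij) mulr0.
Qed.

(** Endomorphisms that preserve [sqr] act on the quotient by it, and there on the span of the
    generators; composition becomes the matrix product. *)
Lemma lincoefM (s t : {lrmorphism R -> R}) k i : injective s -> injective t ->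
  (forall x, t (s x) = x) -> \sum_j lincoef s k j * lincoef t j i = (k == i)%:R.
Proof.
move=> is_ it ts; rewrite -(coef_tgen_ee hq0) -Hiota -(ts (x_ k)).
rewrite -(subrK (linpart s k) (s (x_ k))) lrD (iotaD iota) coefD.
have -> : coef (iota (t (s (x_ k) - linpart s k))) (e9 i) = 0.
  apply/eqP; apply: contraT => /(fil_sqr hR Hiota (aut_sqr it (linpart_sqr k is_))).
  by rewrite dot_dg_e.
rewrite add0r /linpart rmorph_sum (iota_sum iota) coef_sum; apply: eq_bigr => j _.
transitivity (coef (iota (lincoef s k j *: t (x_ j))) (e9 i)); last by rewrite -lrZ.
by rewrite (iotaZ iota) coefZ.
Qed.

Lemma hom_linpart u k : hom degf 1 (iota (linpart u k)).
Proof.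
rewrite /linpart (iota_sum iota).
apply: (big_ind (fun f => hom degf 1 f)) => [y|f g Hf Hg|j _].
- by rewrite coef0 eqxx.
- by rewrite -[f]scale1r; apply: hom_lin.
- rewrite (iotaZ iota) Hiota -[_ *: _]addr0; apply: hom_lin => y; first exact: tgen_deg.
  by rewrite coef0 eqxx.
Qed.

(** The defect [D] of a relation between linear parts is homogeneous of degree two, and the relation
    between the images puts it in degree at least three. *)
Lemma linpart_rel9 (u : {lrmorphism R -> R}) : injective u -> rel9 q (linpart u).
Proof.
move=> iu k l lk; have := congr1 u (gen_rel9 hR lk).
set c := (q - q^-1); pose b := NW l k.
set a := ix _ _; set a' := ix _ _.
have -> : (if NW l k then c *: (x_ a * x_ a') else 0) = (if b then c else 0) *: (x_ a * x_ a').
  by rewrite /b; case: (NW l k); rewrite ?scale0r.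
have -> : (if NW l k then c *: (linpart u a * linpart u a') else 0) = (if b then c else 0) *: (linpart u a * linpart u a').
  by rewrite /b; case: (NW l k); rewrite ?scale0r.
rewrite lrB !lrZ !lrM; move: (if b then c else 0) => d Hrel.
pose df i j := u (x_ i) * u (x_ j) - linpart u i * linpart u j.
have Hdf i j : fil 3 (df i j).
  have -> : df i j = (u (x_ i) - linpart u i) * u (x_ j) + linpart u i * (u (x_ j) - linpart u j).
    by rewrite mulrBl mulrBr addrA subrK.
  apply: filD.
    by apply: (filM (d := 2) (d' := 1)); [exact: (fil_sqr hR Hiota (linpart_sqr i iu))|exact: fil1_aut].
  by apply: (filM (d := 1) (d' := 2)); [exact: fil_linpart|exact: (fil_sqr hR Hiota (linpart_sqr j iu))].
apply/eqP; rewrite -subr_eq0; set D := _ - _.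
have D3 : fil 3 D.
  have -> : D = - (df k l - q ^ omega k l *: df l k + d *: df a a').
    rewrite /df !scalerBr Hrel /D; set A := _ *: (u _ * _); set A' := _ *: (u _ * _).
    set B := _ *: _; set B' := _ *: _; set Z0 := _ * _.
    exact: zmod_aux.
  apply: filN; apply: filD; last by apply: filZ; exact: Hdf.
  by apply: filB; [exact: Hdf | apply: filZ; exact: Hdf].
have D2 : hom degf 2 (iota D).
  have Hz : hom degf 2 (iota 0) by move=> y; rewrite (iota0 iota) coef0 eqxx.
  have H (x y : R) a0 : hom degf 2 (iota x) -> hom degf 2 (iota y) -> hom degf 2 (iota (x - a0 *: y)).
    move=> Hx Hy; rewrite addrC -scaleNr (iotaD iota) (iotaZ iota); exact: hom_lin.
  have HZ i j : hom degf 2 (iota (linpart u i * linpart u j)).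
    by rewrite (iotaM iota); apply: (homM (d := 1) (d' := 1)); exact: hom_linpart.
  rewrite /D -[_ - d *: _]scale1r; apply: (H _ _ 1 (HZ _ _)); apply: H; last exact: HZ.
  rewrite -[X in iota X]addr0 (iotaD iota) (iotaZ iota).
  by apply: hom_lin; [exact: HZ | exact: Hz].
rewrite -(inj_eq inj_iota) (iota0 iota); apply/eqP/tgaP => y; rewrite coef0.
apply/eqP; apply: contraT => Hy; have := D3 _ Hy; rewrite (D2 _ Hy); lia.
Qed.
End LinearPart.

(** * Linear forms that q-commute with the generators *)

Section LinearForms.
Variables (K : fieldType) (q : K) (hq0 : q != 0).
Hypothesis hq : forall n : nat, (0 < n)%N -> q ^+ n != 1.
Variables (R : algType K) (Y : 'I_3 -> 'I_3 -> R) (hR : is_OqM3 q Y).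
Local Notation T := (tga (qbc hq0)).
Local Notation m := (mon (tga_impl (qbc hq0))).
Local Notation x_ := (gen Y).
Variable iota : {lrmorphism R -> T}.
Hypothesis Hiota : forall k, iota (x_ k) = tgen hq0 k.
Let inj_iota : injective iota := iota_inj hR Hiota.

Definition linform (w : 'I_9 -> K) : R := \sum_j w j *: x_ j.

Lemma coef_linform w (j : 'I_9) y : coef (tgen hq0 j) y != 0 ->
  coef (iota (linform w)) y = w j * coef (tgen hq0 j) y.
Proof.
move=> Hy; rewrite (iota_sum iota) coef_sum (bigD1 j) //= big1 => [|i ij].
  by rewrite addr0 (iotaZ iota) coefZ Hiota.
rewrite (iotaZ iota) coefZ Hiota; case: (eqVneq (coef (tgen hq0 i) y) 0) => [->|].
  by rewrite mulr0.
move=> Hi; have := tgen_chi Hi; rewrite (tgen_chi Hy) => -[ji].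
by case/eqP: ij; apply: val_inj.
Qed.

Lemma coef_linform_e w j : coef (iota (linform w)) (e9 j) = w j.
Proof. by rewrite (coef_linform _ (j := j)) coef_tgen_e ?mulr1 ?oner_eq0. Qed.

Lemma mdeg_list1 (s : int) : mdeg_list [:: s *: chi].
Proof.
move=> v; rewrite inE => /eqP ->.
exists (fun i => s * (3 * i)%:Z), (fun a => s * a%:Z).
by apply/rowP => k; rewrite !mxE mulrDr.
Qed.
Lemma dot_scale (s : int) (x : E9) : dot (s *: chi) x = s * dot chi x.
Proof. by rewrite /dot mulr_sumr; apply: eq_bigr => k _; rewrite mxE mulrA. Qed.

(** For orders starting with [chi] or its opposite, the leading exponent of [linform g] must be
    [e9 k]. As [chi] separates the generators, only the term [k] is left. *)
Lemma linform_normal w g k : linform w != 0 -> linform w * x_ k = linform g * linform w ->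
  linform w * x_ k = g k *: (x_ k * linform w).
Proof.
move=> w0 wk; have iw0 : iota (linform w) != 0 by rewrite -(iota0 iota) (inj_eq inj_iota).
have L s : lead ([:: s *: chi] ++ [:: psi]) (iota (linform g)) (e9 k).
  have [z Lz] := lead_exists ([:: s *: chi] ++ [:: psi]) iw0.
  have Lk := lead_tgen hq0 k (@mdeg_list1 s); rewrite -Hiota in Lk.
  have g0 : iota (linform g) != 0.
    have : iota (linform w) * iota (x_ k) != 0 by rewrite tga_mulf_eq0 negb_or iw0 (lead_neq0 Lk).
    by rewrite -(iotaM iota) wk (iotaM iota) tga_mulf_eq0 negb_or => /andP[].
  have [z' Lz'] := lead_exists ([:: s *: chi] ++ [:: psi]) g0.
  have := lead_uniq (leadM Lz Lk); rewrite -(iotaM iota) wk (iotaM iota) => /(_ _ (leadM Lz' Lz)).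
  by rewrite [z' + z]addrC => /addrI ->.
have Hg j : j != k -> g j = 0.
  move=> jk; apply/eqP; apply: contraT; rewrite -coef_linform_e => Hj.
  have P s : 0 <= s * (k%:Z - j%:Z).
    have [_ /(_ _ Hj)/orP[/eqP /(congr1 (fun x : E9 => x 0 j))|]] := L s.
      by rewrite !mxE !eqxx (negbTE jk).
    rewrite lexiE => /orP[|/andP[]]; rewrite /= dot_scale dotBr !dot_chi_e.
      by case/orP => [/ltW //|/andP[/eqP ->]].
    by case/andP => /eqP ->.
  have := P 1; have := P (-1); rewrite mul1r mulN1r => P1 P2.
  by case/eqP: jk; apply: val_inj; move: P1 P2 => /=; move: (nat_of_ord k) (nat_of_ord j) => a b; lia.
rewrite wk {1}/linform (bigD1 k) //= big1 => [|j /Hg ->]; last by rewrite scale0r.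
by rewrite addr0 scalerAl.
Qed.

(** Multiplication by a monomial does not mix the terms of [f], so each term satisfies the relation
    separately. *)
Lemma comm_weight (f : T) a k x : f * m (e9 k) = a *: (m (e9 k) * f) ->
  coef f x != 0 -> q ^ weight x k = a.
Proof.
move=> fk fx; have := congr1 (fun h : T => coef h (x + e9 k)) fk; rewrite /= coefZ.
rewrite {1 2}(tga_expand f) mulr_suml mulr_sumr !coef_sum.
have E1 y' : coef ((coef f y' *: m y') * m (e9 k)) (x + e9 k) =
    (y' == x)%:R * (coef f y' * qbc hq0 y' (e9 k)).
  by rewrite tgaZl monM !coefZ coef_mon (inj_eq (addIr _)); case: eqP; rewrite ?mul0r ?mulr0 // mul1r mulr1.
have E2 y' : coef (m (e9 k) * (coef f y' *: m y')) (x + e9 k) =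
    (y' == x)%:R * (coef f y' * qbc hq0 (e9 k) y').
  by rewrite tgaZr monM !coefZ coef_mon [e9 k + _]addrC (inj_eq (addIr _)); case: eqP; rewrite ?mul0r ?mulr0 // mul1r mulr1.
under eq_bigr do rewrite E1.
under [X in _ = _ * X]eq_bigr do rewrite E2.
have S F : \sum_(y' <- supp f) (y' == x)%:R * F y' = F x :> K.
  rewrite (bigD1_seq x) ?supp_uniq -?coef_neq0 //= eqxx mul1r big1 ?addr0 // => y' /negbTE ->.
  by rewrite mul0r.
rewrite !S mulrCA => /(mulfI fx) /=; rewrite beta_Lambda expfzDr // mulrC => /mulIf.
by rewrite expfz_neq0 // Lambda_delta => ->.
Qed.

Lemma eq_weight (f : T) a k y z : f * m (e9 k) = a *: (m (e9 k) * f) ->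
  coef f y != 0 -> coef f z != 0 -> weight y k = weight z k.
Proof.
by move=> fk /(comm_weight fk) Hy /(comm_weight fk) Hz; apply: (qexp_inj hq0 hq); rewrite Hy Hz.
Qed.
End LinearForms.

Lemma weight_e j k : weight (e9 j) k = omega j k.
Proof. by rewrite -Lambda_delta Lambda_ee. Qed.

(** The last row and the last column, where the image in the torus is a single monomial. *)
Definition is_mono (k : 'I_9) : bool := (k : nat) \in [:: 2; 5; 6; 7; 8]%N.

(** * Linear parts at the corners *)

Section Classify.
Variables (K : fieldType) (q : K) (hq0 : q != 0).
Hypothesis hq : forall n : nat, (0 < n)%N -> q ^+ n != 1.
Variables (R : algType K) (Y : 'I_3 -> 'I_3 -> R) (hR : is_OqM3 q Y).
Local Notation T := (tga (qbc hq0)).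
Local Notation m := (mon (tga_impl (qbc hq0))).
Local Notation x_ := (gen Y).
Variable iota : {lrmorphism R -> T}.
Hypothesis Hiota : forall k, iota (x_ k) = tgen hq0 k.
Let inj_iota : injective iota := iota_inj hR Hiota.
Local Notation lf := (linform Y).
Local Notation Zl := (linpart Y iota).
Local Notation Lc := (lincoef Y iota).

Lemma iota_is_mono k : is_mono k -> iota (x_ k) = m (e9 k).
Proof. by move=> Hk; rewrite Hiota tgen_mon // expo_delta. Qed.

(** Such a generator [x_ j] cannot occur in a linear form that q-commutes with [x_ k], when the
    latter is a monomial in the torus. *)
Definition bad (j k : 'I_9) := exists y z,
  [/\ coef (tgen hq0 j) y != 0, coef (tgen hq0 j) z != 0 & weight y k != weight z k].

Lemma bad_ex (j k : 'I_9) n s : (1%Z, n, s) \in gen_lit j ->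
  omega j k != foldr (fun i a => omega i k * nth 0 s i + a) 0 (seq.iota 0 9) -> bad j k.
Proof.
move=> Hs Hne; exists (e9 j), (expo s); rewrite coef_tgen_e oner_eq0 (coef_tgen hq0 Hs) expfz_neq0 //.
by split=> //; rewrite weight_e /weight (dot_row (fun i => omega i k)).
Qed.
Lemma bad08 : bad (o9 0) (o9 8).
Proof. exact: (@bad_ex _ _ 1 [:: 0; 0; 1; 0; 0; 0; 1; 0; -1]). Qed.
Lemma bad15 : bad (o9 1) (o9 5).
Proof. exact: (@bad_ex _ _ 1 [:: 0; 0; 1; 0; 1; -1; 0; 0; 0]). Qed.
Lemma bad37 : bad (o9 3) (o9 7).
Proof. exact: (@bad_ex _ _ 1 [:: 0; 0; 0; 0; 1; 0; 1; -1; 0]). Qed.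
Lemma bad48 : bad (o9 4) (o9 8).
Proof. exact: (@bad_ex _ _ 1 [:: 0; 0; 0; 0; 0; 1; 0; 1; -1]). Qed.

Lemma linform_bad w a j k : is_mono k -> lf w * x_ k = a *: (x_ k * lf w) -> bad j k -> w j = 0.
Proof.
move=> Hk Hw [y [z [Hy Hz /eqP Hne]]]; apply/eqP; apply: contraT => wj; case: Hne.
apply: (eq_weight hq (f := iota (lf w)) (a := a)).
- by rewrite -iota_is_mono // -!(iotaM iota) Hw (iotaZ iota).
- by rewrite (coef_linform Hiota _ Hy) mulf_neq0.
- by rewrite (coef_linform Hiota _ Hz) mulf_neq0.
Qed.

Lemma linform_weight w a j j' k : is_mono k -> lf w * x_ k = a *: (x_ k * lf w) ->
  w j != 0 -> w j' != 0 -> omega j k = omega j' k.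
Proof.
move=> Hk Hw wj wj'; rewrite -!weight_e.
apply: (eq_weight hq (f := iota (lf w)) (a := a)); rewrite ?(coef_linform_e Hiota) //.
by rewrite -iota_is_mono // -!(iotaM iota) Hw (iotaZ iota).
Qed.

Lemma linform_single w j : (forall i, i != j -> w i = 0) -> lf w = w j *: x_ j.
Proof.
move=> Hw; rewrite /linform (bigD1 j) //= big1 ?addr0 // => i /Hw ->.
by rewrite scale0r.
Qed.

(* [o9 2] and [o9 6] are the indices of [Y_{1,3}] and [Y_{3,1}]. *)
Lemma linform_normal_corner w : lf w != 0 ->
  (forall k, exists a, lf w * x_ k = a *: (x_ k * lf w)) ->
  exists2 j, (j = o9 2 \/ j = o9 6) & forall i, i != j -> w i = 0.
Proof.
move=> w0 Hw.
have Wb j k : is_mono k -> bad j k -> w j = 0.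
  by move=> Hk; have [a Ha] := Hw k; exact: linform_bad Ha.
have w08 := Wb _ (o9 8) isT bad08; have w15 := Wb _ (o9 5) isT bad15.
have w37 := Wb _ (o9 7) isT bad37; have w48 := Wb _ (o9 8) isT bad48.
have [j wj] : exists j, w j != 0.
  apply: contra_notP (negP w0) => Hn; rewrite /linform big1 ?eqxx // => j _.
  by case: (eqVneq (w j) 0) => [->|wj]; [rewrite scale0r | case: Hn; exists j].
(* The remaining indices 2, 5, 6, 7 and 8 are separated by their commutation exponents with each
   other. *)
have Hj i : i != j -> w i = 0.
  move=> ij; apply/eqP; apply: contraT => wi.
  have H k : is_mono k -> omega i k = omega j k.
    by move=> Hk; have [a Ha] := Hw k; apply: linform_weight Ha wi wj.
  have := H (o9 2) isT; have := H (o9 5) isT; have := H (o9 6) isT.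
  have := H (o9 7) isT; have := H (o9 8) isT.
  move: i j ij wi wj {H}; apply: ord9_ind; rewrite ?w08 ?w15 ?w37 ?w48 ?eqxx //;
   by apply: ord9_ind; rewrite ?w08 ?w15 ?w37 ?w48 ?eqxx.
have Ej := linform_single Hj.
(* The cases of [j] equal to 5, 7 and 8 are excluded because entries 1, 3 and 4, respectively, do
   not q-commute with [x_ j]. *)
have Nb i : is_mono j -> bad i j -> False.
  move=> mj [y [z [Hy Hz /eqP Hne]]]; case: Hne.
  have [a] := Hw i; rewrite Ej -scalerAl -scalerAr => Ha.
  have {}Ha : x_ j * x_ i = a *: (x_ i * x_ j).
    by apply: (scalerI wj); rewrite Ha !scalerA mulrC.
  have a0 : a != 0.
    apply: contra_eq_neq Ha => ->; rewrite scale0r; apply/eqP => /(mul_eq0_cases hq0 hR)[] /eqP;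
      by rewrite (negbTE (gen_neq0 hq0 hR _)).
  apply: (eq_weight hq (f := iota (x_ i)) (a := a^-1)); rewrite ?Hiota //.
  by rewrite -Hiota -iota_is_mono // -!(iotaM iota) Ha (iotaZ iota) scalerA mulVf // scale1r.
exists j => //; move: (j) wj Nb; apply: ord9_ind;
  rewrite ?w08 ?w15 ?w37 ?w48 ?eqxx //; try by [left|right].
- by move=> _ /(_ _ isT bad15).
- by move=> _ /(_ _ isT bad37).
- by move=> _ /(_ _ isT bad48).
Qed.

Section Aut.
Variables s t : {lrmorphism R -> R}.
Hypotheses (st : forall x, s (t x) = x) (ts : forall x, t (s x) = x).
Let inj_s : injective s := can_inj ts.
Let inj_t : injective t := can_inj st.

Lemma gen_linpart k : x_ k = \sum_j Lc t k j *: Zl s j.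
Proof.
under eq_bigr do rewrite /linpart scaler_sumr.
rewrite exchange_big /=.
under eq_bigr => i _ do under eq_bigr => j _ do rewrite scalerA.
under eq_bigr => i _ do rewrite -scaler_suml (lincoefM hq hR Hiota k i inj_t inj_s st).
by rewrite (bigD1 k) //= eqxx scale1r big1 ?addr0 // => i /negbTE ik; rewrite eq_sym ik scale0r.
Qed.

Lemma lincoef_row_neq0 k : exists j, Lc s k j != 0.
Proof.
have := lincoefM hq hR Hiota k k inj_s inj_t ts; rewrite eqxx => H.
apply: contrapT => Hn; move/eqP: H; rewrite big1 1?eq_sym ?oner_eq0 // => j _.
by case: (eqVneq (Lc s k j) 0) => [->|Hj]; [rewrite mul0r | case: Hn; exists j].
Qed.

Lemma linpart_neq0 k : Zl s k != 0.
Proof.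
have [j] := lincoef_row_neq0 k; apply: contra_neq => H.
by rewrite -(coef_linpart Hiota) H (iota0 iota) coef0.
Qed.

(** The hypothesis makes [x_ k0] q-commute with all generators, hence [Zl s k0] with all [Zl s j],
    and these span the generators. *)
Lemma linpart_corner k0 : (forall j, ~~ NW k0 j && ~~ NW j k0) ->
  exists2 j, (j = o9 2 \/ j = o9 6) & forall i, i != j -> Lc s k0 i = 0.
Proof.
move=> HN; apply: (@linform_normal_corner (Lc s k0)); first exact: linpart_neq0.
(* [x_ k] is expanded by [gen_linpart], each [Zl s j] contributes the factor [q ^ omega k0 j], and
   [g] collects the result in terms of generators. *)
move=> k; pose g i := \sum_j Lc t k j * q ^ omega k0 j * Lc s j i.
exists (g k); apply: (linform_normal hR Hiota); first exact: linpart_neq0.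
rewrite -[linform _ _]/(Zl s k0).
have -> : linform Y g = \sum_j (Lc t k j * q ^ omega k0 j) *: Zl s j.
  rewrite /linform /g; under [RHS]eq_bigr do rewrite /linpart scaler_sumr.
  rewrite [RHS]exchange_big /=; apply: eq_bigr => i _.
  by rewrite scaler_suml; apply: eq_bigr => j _; rewrite scalerA.
rewrite {1}(gen_linpart k) mulr_sumr mulr_suml; apply: eq_bigr => j _.
have /andP[N1 N2] := HN j.
rewrite -scalerAr (rel9_comm hq0 (linpart_rel9 hq hR Hiota inj_s) N1 N2) scalerA.
by rewrite -scalerAl.
Qed.

(** Here [Zl s k0] is a multiple of a monomial, so [comm_weight] tests the q-commutation term by
    term. *)
Lemma linpart_supp k0 a k j : is_mono k0 -> a != 0 -> Zl s k0 = a *: x_ k0 ->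
  ~~ NW k0 k -> ~~ NW k k0 -> Lc s k j != 0 -> omega j k0 = omega k k0.
Proof.
move=> m0 a0 Ek0 N1 N2 Hj.
have := rel9_comm hq0 (linpart_rel9 hq hR Hiota inj_s) N2 N1.
rewrite Ek0 -scalerAr -scalerAl scalerA mulrC -scalerA => /(scalerI a0) H.
have {H} : iota (Zl s k) * m (e9 k0) = q ^ omega k k0 *: (m (e9 k0) * iota (Zl s k)).
  by rewrite -iota_is_mono // -!(iotaM iota) H (iotaZ iota).
move=> H; rewrite -weight_e; apply: (qexp_inj hq0 hq); apply: (comm_weight H).
by rewrite (coef_linpart Hiota).
Qed.
End Aut.
End Classify.

(** * Transposition, scalings and inverses *)

Lemma qM3_tr (K : fieldType) (q : K) (B : algType K) (Y : 'I_3 -> 'I_3 -> B) :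
  qM3_rel q Y -> qM3_rel q (fun i a => Y a i).
Proof.
move=> [H1 [H2 [H3 H4]]]; split; [|split; [|split]].
- by move=> i a b ab; exact: H2.
- by move=> i j a ij; exact: H1.
- by move=> i j a b ij ba; rewrite -(H3 b a j i).
- by move=> i j a b ij ab; rewrite (H4 a b i j) // (H3 a b j i).
Qed.

(** The array [l] has rank at most one, which is what the correction terms demand of a scaling. *)
Definition multiplicative_minors (K : fieldType) (l : 'I_9 -> K) :=
  forall k k' : 'I_9, NW k' k -> l k * l k' = l (ix (rw k') (cl k)) * l (ix (rw k) (cl k')).

Lemma scal_rel9 (K : fieldType) (q : K) (B : algType K) (X : 'I_9 -> B) l :
  multiplicative_minors l -> rel9 q X -> rel9 q (fun k => l k *: X k).
Proof.
move=> Hl HX k k' kk'; have E (u v : 'I_9) : (l u *: X u) * (l v *: X v) = (l u * l v) *: (X u * X v).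
  by rewrite -scalerAl -scalerAr scalerA.
cbv beta. rewrite !E HX // scalerBr !scalerA.
rewrite [l k' * l k]mulrC [q ^ _ * _]mulrC; congr (_ - _).
case: ifP => [/Hl ->|_].   by rewrite !scalerA; rewrite mulrC.
by rewrite scaler0.
Qed.

Section InverseMorphism.
Variables (K : fieldType) (R : algType K) (s : {lrmorphism R -> R}) (h : R -> R).
Hypotheses (sh : cancel s h) (hs : cancel h s).
Definition lr_inv : R -> R := fun x => h x.
Lemma lr_inv_linear : linear lr_inv.
Proof. by move=> a x y; apply: (can_inj sh); rewrite /lr_inv lrD lrZ !hs. Qed.
Lemma lr_inv_monoid : monoid_morphism lr_inv.
Proof.
split=> [|x y]; apply: (can_inj sh); rewrite /lr_inv ?lrM !hs //.
exact/esym/rmorph1.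
Qed.
HB.instance Definition _ := GRing.isLinear.Build K R R _ lr_inv lr_inv_linear.
HB.instance Definition _ := GRing.isMonoidMorphism.Build R R lr_inv lr_inv_monoid.
Definition lr_inv_morphism : {lrmorphism R -> R} := lr_inv.
End InverseMorphism.

Lemma alg_autP (K : fieldType) (R : algType K) (f : R -> R) : is_alg_aut f ->
  exists s t : {lrmorphism R -> R}, [/\ f =1 s, forall x, s (t x) = x & forall x, t (s x) = x].
Proof.
move=> [s [fs [h fh hf]]].
have sh : cancel s h by move=> x; rewrite -fs fh.
have hs : cancel h s by move=> x; rewrite -fs hf.
by exists s, (lr_inv_morphism sh hs).
Qed.

Lemma alg_aut_intro (K : fieldType) (R : algType K) (f : R -> R) (s t : {lrmorphism R -> R}) :
  f =1 s -> (forall x, s (t x) = x) -> (forall x, t (s x) = x) -> is_alg_aut f.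
Proof.
move=> fs st ts; exists s; split=> //; exists t => x; first by rewrite fs ts.
by rewrite fs st.
Qed.

(** * From linear parts to automorphisms *)

Section Automorphisms.
Variables (K : fieldType) (q : K) (hq0 : q != 0).
Hypothesis hq : forall n : nat, (0 < n)%N -> q ^+ n != 1.
Variables (R : algType K) (Y : 'I_3 -> 'I_3 -> R) (hR : is_OqM3 q Y).
Local Notation x_ := (gen Y).

Lemma morph_ext (f g : {lrmorphism R -> R}) : (forall k, f (x_ k) = g (x_ k)) -> f =1 g.
Proof.
move=> fg; have [_ /(_ R Y)[|_ H]] := hR; first by case: hR.
by apply: H => i a; rewrite -!(gen_ix Y) fg.
Qed.

Lemma morph_exists (Z : 'I_9 -> R) : rel9 q Z ->
  exists f : {lrmorphism R -> R}, forall k, f (x_ k) = Z k.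
Proof.
move=> /rel9P HZ; have [_ /(_ R _ HZ)[[f Hf] _]] := hR.
by exists f => k; rewrite Hf ix_rw_cl.
Qed.

(** The relation for the scaled generators and the scaled relation differ by a multiple of the
    correction term, which is nonzero because [R] is a domain and [q - q^-1] is nonzero. *)
Lemma scal_minors l : rel9 q (fun k => l k *: x_ k) -> multiplicative_minors l.
Proof.
move=> Hl k k' Hkk.
have kk' : (k' < k)%N.
  move: Hkk; rewrite /NW /= => /andP[H _]; rewrite ltnNge; apply: contraL H => H.
  by rewrite -leqNgt leq_div2r.
have E (u v : 'I_9) : (l u *: x_ u) * (l v *: x_ v) = (l u * l v) *: (x_ u * x_ v).
  by rewrite -scalerAl -scalerAr scalerA.
have := Hl _ _ kk'; rewrite Hkk !E (gen_rel9 hR kk') Hkk scalerBr [l k' * l k]mulrC.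
rewrite !scalerA [q ^ _ * _]mulrC => /addrI/oppr_inj/eqP; rewrite -subr_eq0 -scalerBl.
rewrite [_ * (q - _)]mulrC -mulrBr scaler_eq0 mulf_eq0 (negbTE (q_q1 hq0 hq)) /= subr_eq0.
case/orP => [/eqP //|/eqP/(mul_eq0_cases hq0 hR)[] /eqP]; by rewrite (negbTE (gen_neq0 hq0 hR _)).
Qed.

Lemma torus_exists l : (forall k, l k != 0) -> multiplicative_minors l ->
  exists f g : {lrmorphism R -> R}, [/\ forall k, f (x_ k) = l k *: x_ k,
    forall k, g (x_ k) = (l k)^-1 *: x_ k, forall x, f (g x) = x & forall x, g (f x) = x].
Proof.
move=> l0 Hl; have Hl' : multiplicative_minors (fun k => (l k)^-1).
  by move=> k k' /Hl H; rewrite -!invfM H.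
have [f Hf] := morph_exists (scal_rel9 Hl (gen_rel9 hR)).
have [g Hg] := morph_exists (scal_rel9 Hl' (gen_rel9 hR)).
have E (u v : {lrmorphism R -> R}) (a b : 'I_9 -> K) : (forall k, u (x_ k) = a k *: x_ k) ->
    (forall k, v (x_ k) = b k *: x_ k) -> (forall k, a k * b k = 1) -> forall x, u (v x) = x.
  move=> Hu Hv ab; apply: (@morph_ext (u \o v) idfun) => k /=.
  by rewrite Hv lrZ Hu scalerA mulrC ab scale1r.
exists f, g; split=> //; [apply: (E _ _ l _ Hf Hg) | apply: (E _ _ _ l Hg Hf)] => k.
  by rewrite divff.
by rewrite mulVf.
Qed.

Lemma tau_exists : exists tau : {lrmorphism R -> R},
  (forall i a, tau (Y i a) = Y a i) /\ forall x, tau (tau x) = x.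
Proof.
have [H HU] := hR; have [[f Hf] _] := HU R _ (qM3_tr H).
exists f; split=> //; apply: (@morph_ext (f \o f) idfun) => k.
by rewrite /= /gen !Hf.
Qed.

Section Aut.
Variables s t : {lrmorphism R -> R}.
Hypotheses (st : forall x, s (t x) = x) (ts : forall x, t (s x) = x).
Let inj_s : injective s := can_inj ts.
Let inj_t : injective t := can_inj st.

(** By [linpart_corner] the corners 2 and 6 are fixed or exchanged up to scalars. If they are fixed,
    commutation exponents with known generators locate the other linear parts. *)
Lemma aut_diag_or_anti : exists a b : K,
   (sqr x_ (s (x_ (o9 2)) - a *: x_ (o9 2)) /\
      (exists l, forall k, l k != 0 /\ sqr x_ (s (x_ k) - l k *: x_ k)))
   \/ (sqr x_ (s (x_ (o9 2)) - a *: x_ (o9 6)) /\ [/\ sqr x_ (s (x_ (o9 6)) - b *: x_ (o9 2)) & b != 0]).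
Proof.
have [iota Hiota] := embedding_exists hq0 hR.
have NW2 j : ~~ NW (o9 2) j && ~~ NW j (o9 2) by move: j; apply: ord9_ind.
have NW6 j : ~~ NW (o9 6) j && ~~ NW j (o9 6) by move: j; apply: ord9_ind.
have sgl k j : (forall i, i != j -> lincoef Y iota s k i = 0) ->
    linpart Y iota s k = lincoef Y iota s k j *: x_ j.
  exact: linform_single.
have row0 k j : (forall i, i != j -> lincoef Y iota s k i = 0) -> lincoef Y iota s k j != 0.
  move=> H; have [i Hi] := lincoef_row_neq0 hq hR Hiota st ts k.
  by case: (eqVneq i j) => [<- //|/H E]; rewrite E eqxx in Hi.
have ZS k := linpart_sqr hq hR Hiota k inj_s.
have [j2 Hj2 L2] := linpart_corner hq hR Hiota st ts NW2.
have [j6 Hj6 L6] := linpart_corner hq hR Hiota st ts NW6.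
(* Otherwise two rows of the invertible matrix of linear parts would be proportional. *)
have j26 : j2 != j6.
  apply/eqP => jj; have := lincoefM hq hR Hiota (o9 2) (o9 6) inj_s inj_t ts.
  have := lincoefM hq hR Hiota (o9 6) (o9 6) inj_s inj_t ts.
  rewrite (bigD1 j6) //= big1 => [|i /L6 ->]; last by rewrite mul0r.
  rewrite addr0 => H1; rewrite (bigD1 j2) //= big1 => [|i /L2 ->]; last by rewrite mul0r.
  move/eqP; rewrite addr0 jj mulf_eq0 => /orP[|/eqP H2].
    by rewrite -jj (negbTE (row0 _ _ L2)).
  by case/eqP: (oner_neq0 K); rewrite -[LHS]/(true%:R) -H1 H2 mulr0.
exists (lincoef Y iota s (o9 2) j2), (lincoef Y iota s (o9 6) j6).
have := ZS (o9 2); have := ZS (o9 6); rewrite (sgl _ _ L2) (sgl _ _ L6) => S6 S2.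
case: Hj2 => Ej2; case: Hj6 => Ej6; subst j2 j6; rewrite ?eqxx // in j26; last by right; split=> //; split=> //; exact: row0.
left; split=> //.
have H2 k j : lincoef Y iota s k j != 0 -> omega j (o9 2) = omega k (o9 2).
  have /andP[N1 N2] := NW2 k.
  exact: (linpart_supp hq hR Hiota ts (k0 := o9 2) isT (row0 _ _ L2) (sgl _ _ L2) N1 N2).
have H6 k j : lincoef Y iota s k j != 0 -> omega j (o9 6) = omega k (o9 6).
  have /andP[N1 N2] := NW6 k.
  exact: (linpart_supp hq hR Hiota ts (k0 := o9 6) isT (row0 _ _ L6) (sgl _ _ L6) N1 N2).
(* The commutation exponents with entries 2 and 6 separate all indices except 2, 4 and 6, where both
   are zero; 2 and 6 are settled by [L2] and [L6]. *)
have D k : k != o9 4 -> forall j, j != k -> lincoef Y iota s k j = 0.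
  move=> k4 j jk; apply/eqP; apply: contraT => Hj.
  move: (H2 _ _ Hj) (H6 _ _ Hj); move: k j k4 jk Hj.
  apply: ord9_ind => // j _; try by [move/L2 -> ; rewrite eqxx | move/L6 ->; rewrite eqxx];
  by move: j; apply: ord9_ind.
(* Index 4 is told from 2 and 6 by entries 5 and 7, now known to be diagonal. *)
have D4 j : j != o9 4 -> lincoef Y iota s (o9 4) j = 0.
  move=> jk; apply/eqP; apply: contraT => Hj.
  have L5 := D (o9 5) isT; have L7 := D (o9 7) isT.
  have := linpart_supp hq hR Hiota ts (k0 := o9 5) (k := o9 4) isT (row0 _ _ L5) (sgl _ _ L5) isT isT Hj.
  have := linpart_supp hq hR Hiota ts (k0 := o9 7) (k := o9 4) isT (row0 _ _ L7) (sgl _ _ L7) isT isT Hj.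
  by move: (H2 _ _ Hj) (H6 _ _ Hj); move: j jk {Hj}; apply: ord9_ind.
exists (fun k => lincoef Y iota s k k) => k.
have Dk j : j != k -> lincoef Y iota s k j = 0.
  by case: (eqVneq k (o9 4)) => [->|/D]; [exact: D4 | apply].
by split; [exact: row0 | rewrite -sgl].
Qed.

(** The diagonal linear part satisfies the relations and so defines a torus automorphism. Composing
    [s] with its inverse gives a unipotent automorphism, trivial by [unip_id]. *)
Lemma aut_diag l : (forall k, l k != 0) -> (forall k, sqr x_ (s (x_ k) - l k *: x_ k)) ->
  forall k, s (x_ k) = l k *: x_ k.
Proof.
move=> l0 Hl; have [iota Hiota] := embedding_exists hq0 hR.
have Zk k : linpart Y iota s k = l k *: x_ k.
  have Hk j : lincoef Y iota s k j = l k * (k == j)%:R.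
    rewrite -(coef_tgen_ee hq0) -Hiota -coefZ -(iotaZ iota) /lincoef.
    apply/eqP; rewrite -subr_eq0 -coefB -(iotaB iota); apply: contraT.
    by move/(fil_sqr hR Hiota (Hl k)); rewrite dot_dg_e.
  rewrite /linpart (bigD1 k) //= Hk eqxx mulr1 big1 ?addr0 // => j jk.
  by rewrite Hk eq_sym (negbTE jk) mulr0 scale0r.
have Hmin : multiplicative_minors l.
  apply: scal_minors => k k' kk'; rewrite -!Zk; exact: (linpart_rel9 hq hR Hiota inj_s).
have [f [g [Hf Hg fg gf]]] := torus_exists l0 Hmin.
pose u : {lrmorphism R -> R} := s \o g; pose v : {lrmorphism R -> R} := f \o t.
have uv x : u (v x) = x by rewrite /u /v /= gf st.
have vu x : v (u x) = x by rewrite /u /v /= ts fg.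
have inj_v : injective v by exact: can_inj uv.
have Hu k : sqr x_ (u (x_ k) - x_ k).
  have -> : u (x_ k) - x_ k = (l k)^-1 *: (s (x_ k) - l k *: x_ k) + 0.
    by rewrite addr0 /u /= Hg lrZ scalerBr scalerA mulVf ?scale1r.
  by apply: sqr_lin => //; exact: sqr0.
have Hv k : sqr x_ (v (x_ k) - x_ k).
  have -> : v (x_ k) - x_ k = - v (u (x_ k) - x_ k) by rewrite lrB vu opprB.
  by apply: sqrN; apply: (aut_sqr hq hR Hiota inj_v).
move=> k; have := unip_id hq0 hq hR uv vu Hu Hv k; rewrite /u /= Hg lrZ => E.
by rewrite -[in RHS]E scalerA divff // scale1r.
Qed.
End Aut.
End Automorphisms.

(** * The structure of the automorphism group *)

Section Final.
Variables (K : fieldType) (q : K) (hq0 : q != 0).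
Hypothesis hq : forall n : nat, (0 < n)%N -> q ^+ n != 1.
Variables (R : algType K) (Y : 'I_3 -> 'I_3 -> R) (hR : is_OqM3 q Y).
Local Notation x_ := (gen Y).

(** If both [s] and [s \o tau] exchanged the corners, the image under [s] of entry 6 would have as
    linear part both a nonzero multiple of entry 2 and a multiple of entry 6. *)
Lemma aut_cases (s t tau : {lrmorphism R -> R}) :
  (forall x, s (t x) = x) -> (forall x, t (s x) = x) ->
  (forall i a, tau (Y i a) = Y a i) -> (forall x, tau (tau x) = x) ->
  exists l, (forall k, l k != 0) /\
    ((forall k, s (x_ k) = l k *: x_ k) \/ (forall k, s (tau (x_ k)) = l k *: x_ k)).
Proof.
move=> st ts Htau tt; have [a [b [[_ [l Hl]]|[_ [S6 b0]]]]] := aut_diag_or_anti hq0 hq hR st ts.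
  have l0 k : l k != 0 by case: (Hl k).
  exists l; split=> //; left; apply: (aut_diag hq0 hq hR st ts l0) => k.
  by case: (Hl k).
pose s' : {lrmorphism R -> R} := s \o tau; pose t' : {lrmorphism R -> R} := tau \o t.
have st' x : s' (t' x) = x by rewrite /s' /t' /= tt st.
have ts' x : t' (s' x) = x by rewrite /s' /t' /= ts tt.
have [a' [b' [[_ [l Hl]]|[S2 _]]]] := aut_diag_or_anti hq0 hq hR st' ts'.
  have l0 k : l k != 0 by case: (Hl k).
  exists l; split=> //; right; apply: (aut_diag hq0 hq hR st' ts' l0) => k.
  by case: (Hl k).
have [iota Hiota] := embedding_exists hq0 hR.
have E26 : tau (x_ (o9 2)) = x_ (o9 6).
  by rewrite /gen Htau; congr Y; apply: val_inj.
rewrite /s' /= E26 in S2.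
have := sqr_lin (-1) S6 S2; rewrite scaleN1r opprB addrA subrK.
move/(fil_sqr hR Hiota)/(_ (e9 (o9 2))).
rewrite (iotaB iota) !(iotaZ iota) coefB !coefZ !Hiota !coef_tgen_ee mulr1 mulr0 subr0 b0 dot_dg_e.
by move=> /(_ isT).
Qed.

Lemma diag_minors (s : {lrmorphism R -> R}) l : (forall k, s (x_ k) = l k *: x_ k) ->
  multiplicative_minors l.
Proof.
move=> Hs; apply: (scal_minors hq0 hq hR) => k k' kk'; rewrite -!Hs.
have := congr1 s (gen_rel9 hR kk'); rewrite lrM lrB lrZ lrM => ->; congr (_ - _).
by case: (NW k' k); rewrite ?lrZ ?lrM //; exact: rmorph0.
Qed.

Lemma diag_torus (f : R -> R) l : is_alg_aut f -> (forall k, l k != 0) ->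
  (forall k, f (x_ k) = l k *: x_ k) -> is_torus_aut Y f.
Proof.
move=> Hf l0 Hl; split=> //.
have [s [t [fs st ts]]] := alg_autP Hf.
have Hmin : multiplicative_minors l by apply: (@diag_minors s) => k; rewrite -fs.
pose i0 : 'I_3 := ord0; pose i1 : 'I_3 := inord 1; pose i2 : 'I_3 := ord_max.
(* The third column has factor 1 in [bvec], so it gives the row scalars; the minors through the
   first row and the third column give the rest. *)
exists (fun i => l (ix i i2)), (l (ix i0 i0) / l (ix i0 i2)), (l (ix i0 i1) / l (ix i0 i2)).
split; first by split=> //; split; rewrite mulf_neq0 ?invr_neq0.
move=> i a; rewrite -(gen_ix Y) Hl; congr (_ *: _).
have main (b : 'I_3) : (b < 2)%N -> l (ix i b) = l (ix i i2) * (l (ix i0 b) / l (ix i0 i2)).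
  move=> b2; apply: (mulIf (l0 (ix i0 i2))); rewrite mulrA divfK //.
  case: (posnP i) => [iz|ip].
    have -> : i = i0 by apply: val_inj; exact: iz.
    by rewrite mulrC.
  have /Hmin : NW (ix i0 b) (ix i i2) by rewrite /NW !rw_ix !cl_ix /= ip b2.
  by rewrite !rw_ix !cl_ix => ->; rewrite mulrC.
rewrite /bvec; case: (eqVneq (nat_of_ord a) 0%N) => [a0|a0].
  have -> : a = i0 by apply: val_inj.
  exact: main.
case: (eqVneq (nat_of_ord a) 1%N) => [a1|a1].
  have -> : a = i1 by apply: val_inj; rewrite /= inordK.
  by apply: main; rewrite inordK.
rewrite mulr1; congr (l (ix i _)); apply: val_inj => /=.
by have := ltn_ord a; lia.
Qed.

Lemma torus_aut_exists (a : 'I_3 -> K) (b1 b2 : K) : torus_param a b1 b2 ->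
  exists f : R -> R, is_alg_aut f /\ acts_as_torus Y a b1 b2 f.
Proof.
move=> [a0 [b10 b20]]; pose l k := a (rw k) * bvec b1 b2 (cl k).
have l0 k : l k != 0.
  by rewrite mulf_neq0 // /bvec; do 2!case: ifP => _ //; exact: oner_neq0.
have Hmin : multiplicative_minors l.
  by move=> k k' _; rewrite /l !rw_ix !cl_ix; ring.
have [f [g [Hf _ fg gf]]] := torus_exists hR l0 Hmin.
exists f; split; first exact: (alg_aut_intro (fun=> erefl) fg gf).
by move=> i al; rewrite -(gen_ix Y) Hf /l rw_ix cl_ix.
Qed.

Lemma torusP (f : R -> R) : is_torus_aut Y f ->
  is_alg_aut f /\ exists2 l, (forall k, l k != 0) & forall k, f (x_ k) = l k *: x_ k.
Proof.
move=> [Hf [a [b1 [b2 [[a0 [b10 b20]] Ha]]]]]; split=> //.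
exists (fun k => a (rw k) * bvec b1 b2 (cl k)) => k; last exact: Ha.
by rewrite mulf_neq0 // /bvec; do 2!case: ifP => _ //; exact: oner_neq0.
Qed.
End Final.

Theorem theorem2p4 (K : fieldType) (q : K)
  (hq0 : q != 0) (hq : forall n : nat, (0 < n)%N -> q ^+ n != 1)
  (R : algType K) (Y : 'I_3 -> 'I_3 -> R) (hR : is_OqM3 q Y) :
  (* H consists of automorphisms: every sigma_h, h in (K^x)^5, exists *)
  (forall (a : 'I_3 -> K) (b1 b2 : K), torus_param a b1 b2 ->
     exists f : R -> R, is_alg_aut f /\ acts_as_torus Y a b1 b2 f) /\
  (* the transposition tau is an automorphism, of order 2, not in H, and
     Aut(R) = H \rtimes <tau> *)
  exists tau : R -> R,
    is_alg_aut tau /\ acts_as_transpose Y tau /\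
    tau \o tau =1 id /\
    ~ is_torus_aut Y tau /\
    (* H is normal in Aut(R) *)
    (forall f finv g : R -> R, is_alg_aut f -> cancel f finv -> cancel finv f ->
       is_torus_aut Y g -> is_torus_aut Y (f \o g \o finv)) /\
    (* Aut(R) = H <tau> : every automorphism is sigma_h or sigma_h o tau *)
    (forall f : R -> R, is_alg_aut f ->
       is_torus_aut Y f \/
       exists g : R -> R, is_torus_aut Y g /\ f =1 g \o tau).
Proof.
split; first by move=> a b1 b2; exact: (torus_aut_exists hR).
have [tau [Htau tt]] := tau_exists hR; exists tau.
have tauA : is_alg_aut tau by exact: (alg_aut_intro (fun=> erefl) tt tt).
have tauX k : tau (gen Y k) = gen Y (ix (cl k) (rw k)) by rewrite /gen Htau rw_ix cl_ix.
split=> //; split; first exact: Htau.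
split; first exact: tt.
split.
  move=> /torusP[_ [l l0 Hl]]; have [iota Hiota] := embedding_exists hq0 hR.
  have := Hl (o9 2); rewrite tauX (_ : ix _ _ = o9 6); last exact: val_inj.
  move/(congr1 (fun x => coef (iota x) (e9 (o9 2)))); rewrite (iotaZ iota) coefZ !Hiota !coef_tgen_ee mulr1.
  by move/eqP; rewrite eq_sym (negbTE (l0 _)).
split.
  move=> f finv g Hf fK Kf /torusP[Hg [l l0 Hl]].
  have [s [t [fs st ts]]] := alg_autP Hf; have [u [v [gu uv vu]]] := alg_autP Hg.
  have Et x : finv x = t x by rewrite -[in RHS](Kf x) fs ts.
  pose S : {lrmorphism R -> R} := s \o u \o t; pose S' : {lrmorphism R -> R} := s \o v \o t.
  have HA : is_alg_aut (f \o g \o finv).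
    apply: (alg_aut_intro (s := S) (t := S')) => x; rewrite /S /S' /=.
    - by rewrite fs gu Et.
    - by rewrite ts uv st.
    - by rewrite ts vu st.
  (* If [f] is diagonal, conjugation keeps the scalars [l]; if [f \o tau] is, they are
     transposed. *)
  have [c [c0 [Hs|Hs]]] := aut_cases hq0 hq hR st ts Htau tt.
    apply: (diag_torus hq0 hq hR (l := l) HA l0) => k /=.
    have -> : finv (gen Y k) = (c k)^-1 *: gen Y k.
      by rewrite Et -[gen Y k in LHS](scale1r) -(mulVf (c0 k)) -scalerA -Hs lrZ ts.
    by rewrite gu lrZ -gu Hl fs !lrZ Hs !scalerA mulrAC mulVf // mul1r.
  pose k' k := ix (cl k) (rw k).
  have kk k : k' (k' k) = k by rewrite /k' rw_ix cl_ix ix_rw_cl.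
  apply: (diag_torus hq0 hq hR (l := l \o k') HA) => [k|k /=]; first exact: l0.
  have -> : finv (gen Y k) = (c k)^-1 *: gen Y (k' k).
    rewrite Et -[gen Y k in LHS](scale1r) -(mulVf (c0 k)) -scalerA -Hs lrZ ts.
    by rewrite tauX.
  rewrite gu lrZ -gu Hl fs !lrZ -tauX Hs !scalerA mulrAC mulVf // mul1r //.
move=> f Hf; have [s [t [fs st ts]]] := alg_autP Hf.
have [c [c0 [Hs|Hs]]] := aut_cases hq0 hq hR st ts Htau tt.
  by left; apply: (diag_torus hq0 hq hR Hf c0) => k; rewrite fs.
right; exists (f \o tau); split; last by move=> x /=; rewrite tt.
apply: (diag_torus hq0 hq hR _ c0) => [|k]; last by rewrite /= fs.
pose S : {lrmorphism R -> R} := s \o tau; pose S' : {lrmorphism R -> R} := tau \o t.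
apply: (alg_aut_intro (s := S) (t := S')) => x; rewrite /S /S' /=.
- by rewrite fs.
- by rewrite tt st.
- by rewrite ts tt.
Qed.
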